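(* Let $m,n$ be nonnegative integers (not both zero) and let $T=\tau+\widehat E[-1]=\big[\delta_{ij}\tau+e_{ij}[-1](-1)^{\bar\imath}\big]_{1\le i,j\le m+n}$. All the coefficients $\sigma_{kl},h_{kl},b_{kl}\in\mathrm U(t^{-1}\mathfrak{gl}_{m|n}[t^{-1}])$ in the expansions $$\mathrm{str}_{1,\dots,k}\,A_kT_1\cdots T_k=\sigma_{k0}\tau^k+\sigma_{k1}\tau^{k-1}+\dots+\sigma_{kk},$$ $$\mathrm{str}_{1,\dots,k}\,H_kT_1\cdots T_k=h_{k0}\tau^k+h_{k1}\tau^{k-1}+\dots+h_{kk},$$ $$\mathrm{Ber}(1+uT)=\sum_{k=0}^\infty\sum_{l=0}^kb_{kl}\,u^k\tau^{k-l}$$ are Segal–Sugawara vectors for $\widehat{\mathfrak{gl}}_{m|n}$. Moreover, $b_{kl}=\sigma_{kl}$ for all $k$ and $l$.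
   Context: The base field is $\mathbb C$. For $1\le i\le m+n$ set $\bar\imath=0$ if $i\le m$ and $\bar\imath=1$ if $i\ge m+1$; $e_{ij}$ denotes the standard basis element of $\mathfrak{gl}_{m|n}$ (or matrix unit in $\mathrm{End}\,\mathbb C^{m|n}$), of parity $\bar\imath+\bar\jmath$, and $e_{ij}[r]=e_{ij}t^r$. The affine Lie superalgebra $\widehat{\mathfrak{gl}}_{m|n}=\mathfrak{gl}_{m|n}[t,t^{-1}]\oplus\mathbb CK$ has even central element $K$ and relations $$[e_{ij}[r],e_{kl}[s]]=\delta_{kj}e_{il}[r+s]-\delta_{il}e_{kj}[r+s](-1)^{(\bar\imath+\bar\jmath)(\bar k+\bar l)}+K\Big(\delta_{kj}\delta_{il}(-1)^{\bar\imath}-\frac{\delta_{ij}\delta_{kl}}{m-n}(-1)^{\bar\imath+\bar k}\Big)r\,\delta_{r,-s}$$ for $m\ne n$. To treat all $m,n$ uniformly the central element is rescaled by $K=K'(n-m)$, so that the last term reads $K'\big((n-m)\delta_{kj}\delta_{il}(-1)^{\bar\imath}+\delta_{ij}\delta_{kl}(-1)^{\bar\imath+\bar k}\big)r\,\delta_{r,-s}$; for $m=n$ the central element is $K'$. The Lie superalgebra $\widehat{\mathfrak{gl}}_{m|n}\oplus\mathbb C\tau$ has $\tau$ even with $[\tau,e_{ij}[r]]=-r\,e_{ij}[r-1]$, $[\tau,K]=0$ (resp. $[\tau,K']=0$). Let $\mathrm U=\mathrm U(\widehat{\mathfrak{gl}}_{m|n}\oplus\mathbb C\tau)$. The vacuum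 module at the critical level, $V_{n-m}(\mathfrak{gl}_{m|n})$, is the quotient of $\mathrm U(\widehat{\mathfrak{gl}}_{m|n})$ by the left ideal generated by $\mathfrak{gl}_{m|n}[t]$ and $K-(n-m)$ (in rescaled terms: $K'-1$), identified as a superspace with $\mathrm U(t^{-1}\mathfrak{gl}_{m|n}[t^{-1}])$. A Segal–Sugawara vector is an element $b\in V_{n-m}(\mathfrak{gl}_{m|n})$ with $\mathfrak{gl}_{m|n}[t]\,b=0$. Tensor products of superalgebras use the sign rule $(x\otimes y)(x'\otimes y')=(xx'\otimes yy')(-1)^{\deg y\deg x'}$. In $(\mathrm{End}\,\mathbb C^{m|n})^{\otimes k}\otimes\mathrm U$ put $T_a=\sum_{i,j}1^{\otimes(a-1)}\otimes e_{ij}\otimes1^{\otimes(k-a)}\otimes T_{ij}(-1)^{\bar\imath\bar\jmath+\bar\jmath}$, where $T_{ij}$ are the entries of $T$. The natural action of $\mathfrak S_k$ on $(\mathbb C^{m|n})^{\otimes k}$ represents $\sigma$ by $P_\sigma$, with $(a\,b)$, $a<b$, represented by $P_{ab}=\sum_{i,j}1^{\otimes(a-1)}\otimes e_{ij}\otimes1^{\otimes(b-a-1)}\otimes e_{ji}\otimes1^{\otimes(k-b)}\otimes1\,(-1)^{\bar\jmath}$; $H_k=\frac1{k!}\sum_{\sigma}P_\sigma$, $A_k=\frac1{k!}\sum_\sigma\mathrm{sgn}\,\sigma\,P_\sigma$. The supertrace $\mathrm{str}_{1,\dots,k}$ sends $e_{i_1j_1}\otimes\dots\otimes e_{i_kj_k}\otimes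 y$ to $\delta_{i_1j_1}\cdots\delta_{i_kj_k}(-1)^{\bar\imath_1+\dots+\bar\imath_k}y$. The Berezinian is $$\mathrm{Ber}(1+uT)=\sum_{\sigma\in\mathfrak S_m}\mathrm{sgn}\,\sigma\;x_{\sigma(1)1}\cdots x_{\sigma(m)m}\times\sum_{\rho\in\mathfrak S_n}\mathrm{sgn}\,\rho\;x'_{m+1,m+\rho(1)}\cdots x'_{m+n,m+\rho(n)},$$ where $[x_{ij}]=1+uT$ and $[x'_{ij}]=(1+uT)^{-1}$ as matrices over formal power series in $u$. All expansions are obtained by moving all powers of $\tau$ to the right. *)

(* Defs.v *)
(* MathComp, with the classical layer of MathComp-Analysis (boolp) used to form
   quotients by relations that are not decidable. *)
From HB Require Import structures.
From mathcomp Require Import all_boot all_order all_algebra all_fingroup.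
From mathcomp Require Import ring_quotient generic_quotient.
From mathcomp Require Import boolp reals complex.

Set Implicit Arguments.
Unset Strict Implicit.
Unset Printing Implicit Defensive.

Import GRing.Theory.
Local Open Scope ring_scope.
Local Open Scope quotient_scope.

(* Presentation of a Lie superalgebra over [F] by a homogeneous basis: parities
   of the basis vectors and the superbracket of two basis vectors, the latter as
   a formal linear combination.  The super Jacobi identity is not used in the
   definition of the enveloping algebra and is not recorded. *)
Record superLie (F : fieldType) := SuperLie {
  sl_basis :> Type;
  sl_par : sl_basis -> bool;
  sl_br : sl_basis -> sl_basis -> seq (F * sl_basis);
  sl_br_par : forall x y, all
    (fun p => (p.1 == 0) || (sl_par p.2 == sl_par x (+) sl_par y)) (sl_br x y)
}.

Section Enveloping.
Variables (F : fieldType) (L : superLie F).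

(* U(L) is the unital associative F-algebra generated by the basis of L subject
   to x y - (-1)^(|x||y|) y x = [x, y].  It is built as the algebra of formal
   expressions modulo the least congruence [ueq] containing the axioms of
   associative F-algebras and these relations. *)
Inductive uterm :=
| Tgen of L
| Tsc of F
| Tadd of uterm & uterm
| Tmul of uterm & uterm.

Definition tlin (s : seq (F * L)) : uterm :=
  foldr (fun p t => Tadd (Tmul (Tsc p.1) (Tgen p.2)) t) (Tsc 0) s.

Inductive ueq : uterm -> uterm -> Prop :=
| ueq_refl x : ueq x x
| ueq_sym x y : ueq x y -> ueq y x
| ueq_trans y x z : ueq x y -> ueq y z -> ueq x z
| ueq_add x x' y y' : ueq x x' -> ueq y y' -> ueq (Tadd x y) (Tadd x' y')
| ueq_mul x x' y y' : ueq x x' -> ueq y y' -> ueq (Tmul x y) (Tmul x' y')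
| ueq_addA x y z : ueq (Tadd x (Tadd y z)) (Tadd (Tadd x y) z)
| ueq_addC x y : ueq (Tadd x y) (Tadd y x)
| ueq_add0 x : ueq (Tadd (Tsc 0) x) x
| ueq_addN x : ueq (Tadd (Tmul (Tsc (-1)) x) x) (Tsc 0)
| ueq_mulA x y z : ueq (Tmul x (Tmul y z)) (Tmul (Tmul x y) z)
| ueq_mul1l x : ueq (Tmul (Tsc 1) x) x
| ueq_mul1r x : ueq (Tmul x (Tsc 1)) x
| ueq_mulDl x y z : ueq (Tmul (Tadd x y) z) (Tadd (Tmul x z) (Tmul y z))
| ueq_mulDr x y z : ueq (Tmul x (Tadd y z)) (Tadd (Tmul x y) (Tmul x z))
| ueq_scD a b : ueq (Tsc (a + b)) (Tadd (Tsc a) (Tsc b))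
| ueq_scM a b : ueq (Tsc (a * b)) (Tmul (Tsc a) (Tsc b))
| ueq_scC a x : ueq (Tmul (Tsc a) x) (Tmul x (Tsc a))
| ueq_br (x y : L) :
    ueq (Tmul (Tgen x) (Tgen y))
        (Tadd (Tmul (Tsc ((-1) ^+ (sl_par x && sl_par y)))
                    (Tmul (Tgen y) (Tgen x)))
              (tlin (sl_br x y))).

HB.instance Definition _ := gen_eqMixin uterm.
HB.instance Definition _ := gen_choiceMixin uterm.

Definition ueqb (x y : uterm) : bool := `[< ueq x y >].

Lemma ueqb_is_equiv : equiv_class_of ueqb.
Proof.
split=> [x|x y|y x z].
- by apply/asboolP; apply: ueq_refl.
- by apply/asbool_equiv_eq; split; apply: ueq_sym.
- by move=> /asboolP xy /asboolP yz; apply/asboolP; apply: ueq_trans xy yz.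
Qed.

Canonical ueqb_equiv := EquivRelPack ueqb_is_equiv.
Canonical ueqb_encModRel := defaultEncModRel ueqb.

Definition Uenv := {eq_quot ueqb}.
HB.instance Definition _ := Choice.on Uenv.
HB.instance Definition _ := EqQuotient.on Uenv.

Lemma ueqP (x y : uterm) : (\pi_Uenv x = \pi_Uenv y) <-> ueq x y.
Proof.
split; first by move=> /eqmodP /asboolP.
by move=> xy; apply/eqmodP/asboolP.
Qed.

Lemma repr_pi (x : uterm) : ueq (repr (\pi_Uenv x)) x.
Proof. by apply/ueqP; rewrite reprK. Qed.

Definition ugen (x : L) : Uenv := \pi_Uenv (Tgen x).
Definition usc (c : F) : Uenv := \pi_Uenv (Tsc c).
Definition uadd := lift_op2 Uenv Tadd.
Definition umul := lift_op2 Uenv Tmul.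
Definition uopp := lift_op1 Uenv (Tmul (Tsc (-1))).
Definition uscale (c : F) (x : Uenv) : Uenv := umul (usc c) x.

Lemma pi_uadd x y : uadd (\pi_Uenv x) (\pi_Uenv y) = \pi_Uenv (Tadd x y).
Proof. by unlock uadd; apply/ueqP; apply: ueq_add; apply: repr_pi. Qed.
Lemma pi_umul x y : umul (\pi_Uenv x) (\pi_Uenv y) = \pi_Uenv (Tmul x y).
Proof. by unlock umul; apply/ueqP; apply: ueq_mul; apply: repr_pi. Qed.
Lemma pi_uopp x : uopp (\pi_Uenv x) = \pi_Uenv (Tmul (Tsc (-1)) x).
Proof. by unlock uopp; apply/ueqP; apply: ueq_mul; [apply: ueq_refl | apply: repr_pi]. Qed.

Local Definition uE := (pi_uadd, pi_umul, pi_uopp).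

Lemma uaddA : associative uadd.
Proof.
by elim/quotW=> x; elim/quotW=> y; elim/quotW=> z; rewrite !uE; apply/ueqP; apply: ueq_addA.
Qed.
Lemma uaddC : commutative uadd.
Proof. by elim/quotW=> x; elim/quotW=> y; rewrite !uE; apply/ueqP; apply: ueq_addC. Qed.
Lemma uadd0 : left_id (usc 0) uadd.
Proof. by elim/quotW=> x; rewrite !uE; apply/ueqP; apply: ueq_add0. Qed.
Lemma uaddN : left_inverse (usc 0) uopp uadd.
Proof. by elim/quotW=> x; rewrite !uE; apply/ueqP; apply: ueq_addN. Qed.
Lemma umulA : associative umul.
Proof.
by elim/quotW=> x; elim/quotW=> y; elim/quotW=> z; rewrite !uE; apply/ueqP; apply: ueq_mulA.
Qed.
Lemma umul1l : left_id (usc 1) umul.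
Proof. by elim/quotW=> x; rewrite !uE; apply/ueqP; apply: ueq_mul1l. Qed.
Lemma umul1r : right_id (usc 1) umul.
Proof. by elim/quotW=> x; rewrite !uE; apply/ueqP; apply: ueq_mul1r. Qed.
Lemma umulDl : left_distributive umul uadd.
Proof.
by elim/quotW=> x; elim/quotW=> y; elim/quotW=> z; rewrite !uE; apply/ueqP; apply: ueq_mulDl.
Qed.
Lemma umulDr : right_distributive umul uadd.
Proof.
by elim/quotW=> x; elim/quotW=> y; elim/quotW=> z; rewrite !uE; apply/ueqP; apply: ueq_mulDr.
Qed.

Fixpoint tcounit (t : uterm) : F :=
  match t with
  | Tgen _ => 0
  | Tsc c => c
  | Tadd x y => tcounit x + tcounit y
  | Tmul x y => tcounit x * tcounit y
  end.

Lemma tcounit_ueq x y : ueq x y -> tcounit x = tcounit y.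
Proof.
elim=> //= {x y}.
- by move=> y x z _ -> _ ->.
- by move=> x x' y y' _ -> _ ->.
- by move=> x x' y y' _ -> _ ->.
- by move=> *; rewrite addrA.
- by move=> *; rewrite addrC.
- by move=> *; rewrite add0r.
- by move=> *; rewrite mulN1r addNr.
- by move=> *; rewrite mulrA.
- by move=> *; rewrite mul1r.
- by move=> *; rewrite mulr1.
- by move=> *; rewrite mulrDl.
- by move=> *; rewrite mulrDr.
- by move=> *; rewrite mulrC.
move=> x y; rewrite !mulr0 add0r.
by elim: (sl_br x y) => //= p s <-; rewrite mulr0 addr0.
Qed.

Lemma usc1_neq0 : usc 1 != usc 0.
Proof.
by apply/eqP=> /ueqP/tcounit_ueq/= /eqP; rewrite oner_eq0.
Qed.

HB.instance Definition _ := GRing.isZmodule.Build Uenv uaddA uaddC uadd0 uaddN.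
HB.instance Definition _ := GRing.Zmodule_isNzRing.Build Uenv
  umulA umul1l umul1r umulDl umulDr usc1_neq0.

Lemma uscD a b : usc (a + b) = usc a + usc b.
Proof. by rewrite [RHS]pi_uadd; apply/ueqP; apply: ueq_scD. Qed.
Lemma uscM a b : usc (a * b) = usc a * usc b.
Proof. by rewrite [RHS]pi_umul; apply/ueqP; apply: ueq_scM. Qed.
Lemma uscC a x : usc a * x = x * usc a.
Proof. by elim/quotW: x => x; rewrite ![LHS]pi_umul ![RHS]pi_umul; apply/ueqP; apply: ueq_scC. Qed.

Lemma uscaleA a b v : uscale a (uscale b v) = uscale (a * b) v.
Proof. by rewrite [RHS](_ : _ = usc (a * b) * v) // uscM -mulrA. Qed.
Lemma uscale1 : left_id 1 uscale.
Proof. by move=> v; apply: umul1l. Qed.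
Lemma uscaleDr : right_distributive uscale +%R.
Proof. by move=> a u v; apply: mulrDr. Qed.
Lemma uscaleDl v : {morph uscale^~ v : a b / a + b}.
Proof. by move=> a b; rewrite [LHS](_ : _ = usc (a + b) * v) // uscD mulrDl. Qed.

HB.instance Definition _ :=
  GRing.Zmodule_isLmodule.Build F Uenv uscaleA uscale1 uscaleDr uscaleDl.

Lemma uscaleAl (a : F) (u v : Uenv) : a *: (u * v) = (a *: u) * v.
Proof. exact: mulrA. Qed.
HB.instance Definition _ := GRing.Lmodule_isLalgebra.Build F Uenv uscaleAl.

Lemma uscaleAr (a : F) (u v : Uenv) : a *: (u * v) = u * (a *: v).
Proof.
by rewrite [LHS](_ : _ = usc a * (u * v)) // mulrA uscC -mulrA.
Qed.
HB.instance Definition _ := GRing.Lalgebra_isAlgebra.Build F Uenv uscaleAr.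

Lemma uscE c : usc c = c%:A.
Proof. exact: esym (mulr1 (usc c)). Qed.

Lemma pi_tlin s : \pi_Uenv (tlin s) = \sum_(p <- s) p.1 *: ugen p.2.
Proof.
elim: s => [|p s IH] /=; first by rewrite big_nil.
by rewrite big_cons -IH -pi_uadd -pi_umul.
Qed.

Lemma ugen_br x y : ugen x * ugen y =
  (-1) ^+ (sl_par x && sl_par y) *: (ugen y * ugen x)
  + \sum_(p <- sl_br x y) p.1 *: ugen p.2.
Proof.
rewrite -pi_tlin [LHS]pi_umul; have /ueqP -> := ueq_br x y.
by rewrite -pi_uadd -!pi_umul.
Qed.

End Enveloping.

Section Lift.
Variables (F : fieldType) (L : superLie F) (A : algType F) (f : L -> A).
Hypothesis fP : forall x y : L, f x * f y =
  (-1) ^+ (sl_par x && sl_par y) *: (f y * f x)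
  + \sum_(p <- sl_br x y) p.1 *: f p.2.

Fixpoint teval (t : uterm L) : A :=
  match t with
  | Tgen x => f x
  | Tsc c => c%:A
  | Tadd x y => teval x + teval y
  | Tmul x y => teval x * teval y
  end.

Lemma teval_lin s : teval (tlin s) = \sum_(p <- s) p.1 *: f p.2.
Proof.
elim: s => [|p s IH] /=; first by rewrite big_nil scale0r.
by rewrite big_cons IH mulr_algl.
Qed.

Lemma teval_ueq x y : ueq x y -> teval x = teval y.
Proof.
elim=> //= {x y}.
- by move=> y x z _ -> _ ->.
- by move=> x x' y y' _ -> _ ->.
- by move=> x x' y y' _ -> _ ->.
- by move=> *; rewrite addrA.
- by move=> *; rewrite addrC.
- by move=> *; rewrite scale0r add0r.
- by move=> *; rewrite mulr_algl scaleN1r addNr scale0r.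
- by move=> *; rewrite mulrA.
- by move=> *; rewrite scale1r mul1r.
- by move=> *; rewrite scale1r mulr1.
- by move=> *; rewrite mulrDl.
- by move=> *; rewrite mulrDr.
- by move=> *; rewrite scalerDl.
- by move=> *; rewrite mulr_algl scalerA.
- by move=> *; rewrite mulr_algl mulr_algr.
by move=> x y; rewrite teval_lin mulr_algl.
Qed.

(* The homomorphism U(L) -> A extending f. *)
Definition ulift (u : Uenv L) : A := teval (repr u).

Lemma ulift_pi t : ulift (\pi_(Uenv L) t) = teval t.
Proof. by apply: teval_ueq; apply: repr_pi. Qed.

Lemma ulift_gen x : ulift (ugen x) = f x.
Proof. exact: ulift_pi. Qed.

Lemma uliftD : {morph ulift : u v / u + v}.
Proof.
by elim/quotW=> u; elim/quotW=> v; rewrite [X in ulift X]pi_uadd !ulift_pi.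
Qed.

Lemma uliftM : {morph ulift : u v / u * v}.
Proof.
by elim/quotW=> u; elim/quotW=> v; rewrite [X in ulift X]pi_umul !ulift_pi.
Qed.

Lemma uliftZ (c : F) u : ulift (c *: u) = c *: ulift u.
Proof.
elim/quotW: u => u.
by rewrite [X in ulift X]pi_umul !ulift_pi /= mulr_algl.
Qed.

Lemma ulift1 : ulift 1 = 1.
Proof. by rewrite [LHS]ulift_pi /= scale1r. Qed.

End Lift.

(* The parity automorphism of U(L): y |-> (-1)^(deg y) y on homogeneous y.  It
   encodes the Z/2-grading of U(L). *)
Definition upar_gen (F : fieldType) (L : superLie F) (x : L) : Uenv L :=
  (-1) ^+ sl_par x *: ugen x.
Definition upar (F : fieldType) (L : superLie F) : Uenv L -> Uenv L :=
  ulift (@upar_gen F L).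

Lemma upar_genP (F : fieldType) (L : superLie F) (x y : L) :
  upar_gen x * upar_gen y =
  (-1) ^+ (sl_par x && sl_par y) *: (upar_gen y * upar_gen x)
  + \sum_(p <- sl_br x y) p.1 *: upar_gen p.2.
Proof.
rewrite /upar_gen -!scalerAl -!scalerAr !scalerA ugen_br scalerDr !scalerA.
congr (_ + _); first by congr (_ *: _); rewrite mulrC -mulrA [X in _ * X]mulrC.
have /= := sl_br_par x y; elim: (sl_br x y) => [|p s IH] /=.
  by rewrite !big_nil scaler0.
rewrite !big_cons scalerDr => /andP[hp /IH->]; congr (_ + _).
rewrite !scalerA -signr_addb; case/orP: hp => /eqP ->.
  by rewrite mulr0 mul0r.
by rewrite mulrC.
Qed.

Lemma upar_ugen (F : fieldType) (L : superLie F) (x : L) :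
  upar (ugen x) = (-1) ^+ sl_par x *: ugen x.
Proof. by rewrite /upar ulift_gen //; apply: upar_genP. Qed.

Lemma upar_hom (F : fieldType) (L : superLie F) :
  [/\ {morph @upar F L : u v / u + v}, {morph @upar F L : u v / u * v},
      forall (c : F) (u : Uenv L), upar (c *: u) = c *: upar u & upar (1 : Uenv L) = 1].
Proof.
have P := @upar_genP F L.
by split; [exact: uliftD | exact: uliftM | exact: uliftZ | exact: ulift1].
Qed.

Inductive subalg (F : fieldType) (A : algType F) (S : A -> Prop) : A -> Prop :=
| subalg_gen s : S s -> subalg S s
| subalg_sc c : subalg S c%:A
| subalg_add x y : subalg S x -> subalg S y -> subalg S (x + y)
| subalg_mul x y : subalg S x -> subalg S y -> subalg S (x * y).

Section LeftQuotient.
Variables (A : nzRingType) (S : A -> Prop).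

Inductive lideal : A -> Prop :=
| lideal0 : lideal 0
| lidealD u s x : S s -> lideal x -> lideal (u * s + x).

Definition lidealb : {pred A} := [pred x | `[< lideal x >]].

Lemma lideal_add x y : lideal x -> lideal y -> lideal (x + y).
Proof.
by move=> lx ly; elim: lx => [|u s z Ss _ IH]; rewrite ?add0r // -addrA; apply: lidealD.
Qed.

Lemma lideal_mul u x : lideal x -> lideal (u * x).
Proof.
elim=> [|v s z Ss _ IH]; first by rewrite mulr0; apply: lideal0.
by rewrite mulrDr mulrA; apply: lidealD.
Qed.

Lemma lidealb_closed : zmod_closed lidealb.
Proof.
split=> [|x y]; first by apply/asboolP/lideal0.
move=> /asboolP lx /asboolP ly; apply/asboolP/lideal_add => //.
by rewrite -mulN1r; apply: lideal_mul.
Qed.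
HB.instance Definition _ := GRing.isZmodClosed.Build A lidealb lidealb_closed.

(* The left A-module A / (A S). *)
Definition lquot := Quotient.quot lidealb.
HB.instance Definition _ := GRing.Zmodule.on lquot.
HB.instance Definition _ := EqQuotient.on lquot.

Definition lq_scale (u : A) : lquot -> lquot := lift_op1 lquot ( *%R u).

Lemma pi_lq_scale u x : lq_scale u (\pi_lquot x) = \pi_lquot (u * x).
Proof.
have /asboolP lx : repr (\pi_lquot x) - x \in lidealb.
  by rewrite Quotient.idealrBE reprK.
rewrite /lq_scale; unlock; apply/eqP; rewrite -Quotient.idealrBE -mulrBr.
by apply/asboolP; apply: lideal_mul.
Qed.

Lemma pi_lqD x y : \pi_lquot (x + y) = \pi_lquot x + \pi_lquot y.
Proof. exact: raddfD. Qed.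

Lemma lq_scaleA a b v : lq_scale a (lq_scale b v) = lq_scale (a * b) v.
Proof. by elim/quotW: v => v; rewrite !pi_lq_scale mulrA. Qed.
Lemma lq_scale1 : left_id 1 lq_scale.
Proof. by elim/quotW=> v; rewrite pi_lq_scale mul1r. Qed.
Lemma lq_scaleDr : right_distributive lq_scale +%R.
Proof.
move=> a; elim/quotW=> u; elim/quotW=> v.
by rewrite -pi_lqD !pi_lq_scale mulrDr pi_lqD.
Qed.
Lemma lq_scaleDl v : {morph lq_scale^~ v : a b / a + b}.
Proof. by elim/quotW: v => v a b; rewrite !pi_lq_scale mulrDl pi_lqD. Qed.

HB.instance Definition _ := GRing.Zmodule_isLmodule.Build A lquot
  lq_scaleA lq_scale1 lq_scaleDr lq_scaleDl.

Lemma lquot_scaleE (u x : A) : u *: (\pi_lquot x : lquot) = \pi_lquot (u * x).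
Proof. exact: pi_lq_scale. Qed.

Lemma lquot_eq0 (x : A) : (\pi_lquot x = 0 :> lquot) <-> lideal x.
Proof.
rewrite -[0](raddf0 \pi_lquot); split.
  by move=> /eqP; rewrite -Quotient.idealrBE subr0 => /asboolP.
by move=> lx; apply/eqP; rewrite -Quotient.idealrBE subr0; apply/asboolP.
Qed.

End LeftQuotient.

(* Formal power series in a central variable u over a ring. *)
Record fps (A : Type) := FPS { fcoef : nat -> A }.

Section FormalSeries.
Variable A : nzRingType.
Implicit Types f g h : fps A.

Lemma fpsP f g : (forall k, fcoef f k = fcoef g k) -> f = g.
Proof. by case: f g => [f] [g] /= fg; congr FPS; apply/funext. Qed.

HB.instance Definition _ := gen_eqMixin (fps A).
HB.instance Definition _ := gen_choiceMixin (fps A).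

Definition fpsC (c : A) : fps A := FPS (fun k => if k == 0%N then c else 0).
Definition fpsX : fps A := FPS (fun k => (k == 1%N)%:R).
Definition fps_add f g := FPS (fun k => fcoef f k + fcoef g k).
Definition fps_opp f := FPS (fun k => - fcoef f k).
Definition fps_mul f g := FPS (fun k => \sum_(i < k.+1) fcoef f i * fcoef g (k - i)).

Lemma fps_addA : associative fps_add.
Proof. by move=> f g h; apply: fpsP => k /=; rewrite addrA. Qed.
Lemma fps_addC : commutative fps_add.
Proof. by move=> f g; apply: fpsP => k /=; rewrite addrC. Qed.
Lemma fps_add0 : left_id (fpsC 0) fps_add.
Proof. by move=> f; apply: fpsP => k /=; rewrite if_same add0r. Qed.
Lemma fps_addN : left_inverse (fpsC 0) fps_opp fps_add.
Proof. by move=> f; apply: fpsP => k /=; rewrite if_same addNr. Qed.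
HB.instance Definition _ :=
  GRing.isZmodule.Build (fps A) fps_addA fps_addC fps_add0 fps_addN.

Let tr N f : {poly A} := \poly_(i < N.+1) fcoef f i.

Lemma tr_mul N f g k : (k <= N)%N -> fcoef (fps_mul f g) k = (tr N f * tr N g)`_k.
Proof.
move=> kN; rewrite coefM /=; apply: eq_bigr => i _.
by rewrite !coef_poly !ltnS !(leq_trans _ kN) ?leq_subr // -ltnS.
Qed.

Lemma fps_mulA : associative fps_mul.
Proof.
move=> f g h; apply: fpsP => k.
transitivity ((tr k f * (tr k g * tr k h))`_k).
  rewrite coefM /=; apply: eq_bigr => i _.
  by rewrite -tr_mul ?leq_subr // coef_poly ltn_ord.
rewrite mulrA coefM /=; apply: eq_bigr => i _.
have ik : (i <= k)%N by rewrite -ltnS.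
by rewrite -tr_mul // coef_poly ltnS leq_subr.
Qed.
Lemma fps_mul1l : left_id (fpsC 1) fps_mul.
Proof.
move=> f; apply: fpsP => k /=; rewrite big_ord_recl /= mul1r subn0 big1 ?addr0 //.
by move=> i _; rewrite mul0r.
Qed.
Lemma fps_mul1r : right_id (fpsC 1) fps_mul.
Proof.
move=> f; apply: fpsP => k /=; rewrite big_ord_recr /= subnn mulr1 big1 ?add0r //.
by move=> i _; rewrite subn_eq0 leqNgt ltn_ord /= mulr0.
Qed.
Lemma fps_mulDl : left_distributive fps_mul fps_add.
Proof.
move=> f g h; apply: fpsP => k /=; rewrite -big_split.
by apply: eq_bigr => i _; rewrite mulrDl.
Qed.
Lemma fps_mulDr : right_distributive fps_mul fps_add.
Proof.
move=> f g h; apply: fpsP => k /=; rewrite -big_split.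
by apply: eq_bigr => i _; rewrite mulrDr.
Qed.
Lemma fps_1neq0 : fpsC 1 != fpsC 0.
Proof. by apply/eqP=> /(congr1 (fun f => fcoef f 0)) /= /eqP; rewrite oner_eq0. Qed.
HB.instance Definition _ := GRing.Zmodule_isNzRing.Build (fps A)
  fps_mulA fps_mul1l fps_mul1r fps_mulDl fps_mulDr fps_1neq0.

Lemma fcoef_sum I (r : seq I) P (G : I -> fps A) k :
  fcoef (\sum_(i <- r | P i) G i) k = \sum_(i <- r | P i) fcoef (G i) k.
Proof.
by apply: (big_morph (fun f => fcoef f k)) => //=; rewrite if_same.
Qed.

End FormalSeries.

Section Berezinian.
Variables (m n : nat).

(* [X'] stands for the inverse of [X]. *)
Definition Ber (A : nzRingType) (X X' : 'M[A]_(m + n)) : A :=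
  (\sum_(s : 'S_m) (-1) ^+ s * \prod_(i < m) X (lshift n (s i)) (lshift n i)) *
  (\sum_(r : 'S_n) (-1) ^+ r * \prod_(i < n) X' (rshift m i) (rshift m (r i))).

Variables (A : nzRingType) (T : 'M[A]_(m + n)).

Definition one_uT : 'M[fps A]_(m + n) := 1%:M + fpsX A *: map_mx (@fpsC A) T.

(* The geometric series; see [one_uT_inv]. *)
Definition inv_one_uT : 'M[fps A]_(m + n) :=
  \matrix_(i, j) FPS (fun k => ((- T) ^+ k) i j).

Definition Ber_uT : fps A := Ber one_uT inv_one_uT.

Let cmx (X : 'M[fps A]_(m + n)) k : 'M[A]_(m + n) := map_mx (fun f => fcoef f k) X.

Lemma cmx_mul X Y k : cmx (X *m Y) k = \sum_(a < k.+1) cmx X a *m cmx Y (k - a).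
Proof.
apply/matrixP => i j; rewrite summxE !mxE fcoef_sum /=.
rewrite exchange_big /=; apply: eq_bigr => a _.
by rewrite mxE; apply: eq_bigr => l _; rewrite !mxE.
Qed.

Lemma cmx_inj X Y : (forall k, cmx X k = cmx Y k) -> X = Y.
Proof.
move=> XY; apply/matrixP => i j; apply: fpsP => k.
by have /matrixP/(_ i j) := XY k; rewrite !mxE.
Qed.

Lemma cmx1 k : cmx 1%:M k = if k == 0 then 1%:M else 0.
Proof.
by apply/matrixP => i j; case: k => [|k]; rewrite !mxE /=; case: (i == j).
Qed.

Lemma cmx_one_uT k : cmx one_uT k = if k == 0 then 1%:M else if k == 1 then T else 0.
Proof.
apply/matrixP => i j; rewrite !mxE /=; case: k => [|[|k]].
- by rewrite big_ord1 /= mul0r addr0 mxE; case: (i == j).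
- by rewrite !big_ord_recl big_ord0 /= mul0r mul1r addr0 add0r; case: (i == j); rewrite /= add0r.
rewrite big1 ?addr0 => [|[[|[|a]] ha] _ /=]; rewrite ?mul0r ?mulr0 ?mxE //.
by case: (i == j).
Qed.

Lemma cmx_inv k : cmx inv_one_uT k = (- T) ^+ k.
Proof. by apply/matrixP => i j; rewrite !mxE. Qed.

Lemma one_uT_inv : one_uT *m inv_one_uT = 1%:M /\ inv_one_uT *m one_uT = 1%:M.
Proof.
split; apply: cmx_inj => k; rewrite cmx_mul cmx1; case: k => [|k].
- by rewrite big_ord1 cmx_one_uT cmx_inv mul1mx.
- rewrite !big_ord_recl big1 => [|a _]; last by rewrite cmx_one_uT mul0mx.
  by rewrite !cmx_one_uT !cmx_inv /= mul1mx addr0 subSS !subn0 exprS mulNr -mulmxE addNr.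
- by rewrite big_ord1 cmx_one_uT cmx_inv mul1mx.
rewrite !big_ord_recr big1 => [|a _] /=; last first.
  by rewrite cmx_one_uT subSn ?(ltnW (ltn_ord a)) // -subnSK // mulmx0.
by rewrite !cmx_one_uT !cmx_inv subnn subSn // subnn /= mulmx1 add0r exprSr mulrN -mulmxE addrN.
Qed.

End Berezinian.

Section SuperTensor.
Variables (m n : nat).

Definition par (i : 'I_(m + n)) : bool := (m <= i)%N.

Variables (F : fieldType) (L : superLie F).
Local Notation U := (Uenv L).

(* An element sum_(I, J) e_(I_1 J_1) (x) ... (x) e_(I_k J_k) (x) X_(I, J) of
   (End C^(m|n))^(x)k (x) U is encoded by its coefficients X_(I, J) in U. *)
Definition multi k := {ffun 'I_k -> 'I_(m + n)}.
Definition tens k := {ffun multi k * multi k -> U}.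

Definition epar k (I J : multi k) (a : 'I_k) : bool := par (I a) (+) par (J a).

(* Exponent of the sign in
   (x_1 (x) ... (x) x_k) (x'_1 (x) ... (x) x'_k)
     = +- x_1 x'_1 (x) ... (x) x_k x'_k
   for deg x_a = p a and deg x'_a = q a; the same exponent gives the sign of
   x_1 (x) ... (x) x_k applied to v_1 (x) ... (x) v_k with deg v_a = q a. *)
Definition ksign k (p q : 'I_k -> bool) : nat :=
  (\sum_(a < k) \sum_(b < k | b < a) p a * q b)%N.

(* (x (x) y)(x' (x) y') = (-1)^(deg y deg x') x x' (x) y y'. *)
Definition tens_mul k (X Y : tens k) : tens k := [ffun IJ : multi k * multi k =>
  \sum_(M : multi k) (-1) ^+ ksign (epar IJ.1 M) (epar M IJ.2) *
    iter (\sum_(a < k) epar M IJ.2 a)%N (@upar F L) (X (IJ.1, M)) * Y (M, IJ.2)].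

Definition tens_one k : tens k := [ffun IJ : multi k * multi k => (IJ.1 == IJ.2)%:R].

(* T_a, for an even matrix T over U and a tensor factor a. *)
Definition Tfactor (T : 'M[U]_(m + n)) k (a : 'I_k) : tens k :=
  [ffun IJ : multi k * multi k =>
    if [forall (b | b != a), IJ.1 b == IJ.2 b] then
      (-1) ^+ (par (IJ.1 a) * par (IJ.2 a) + par (IJ.2 a))%N * T (IJ.1 a) (IJ.2 a)
    else 0].

(* The natural action of S_k moves the a-th tensor factor to the position s a:
   e_(J_1) (x) ... (x) e_(J_k) is sent to (-1)^(inv_sign s J) times
   e_(I_1) (x) ... (x) e_(I_k), where I_(s a) = J_a. *)
Definition inv_sign k (s : 'S_k) (J : multi k) : nat :=
  (\sum_(a < k) \sum_(b < k | (a < b) && (s b < s a)) par (J a) * par (J b))%N.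

(* The additional sign comes from writing the operator in terms of the
   e_(I_1 J_1) (x) ... (x) e_(I_k J_k), whose action involves signs. *)
Definition Pperm k (s : 'S_k) : tens k := [ffun IJ : multi k * multi k =>
  if [forall a, IJ.1 (s a) == IJ.2 a] then
    (-1) ^+ (inv_sign s IJ.2 + ksign (epar IJ.1 IJ.2) (fun a => par (IJ.2 a)))%N
  else 0].

Definition Hsym k : tens k := (k`!%:R : F)^-1 *: \sum_(s : 'S_k) Pperm s.

Definition Asym k : tens k :=
  (k`!%:R : F)^-1 *: \sum_(s : 'S_k) ((-1) ^+ s : F) *: Pperm s.

Definition Tprod (T : 'M[U]_(m + n)) k : tens k :=
  \big[@tens_mul k/tens_one k]_(a < k) Tfactor T a.

Definition str k (X : tens k) : U :=
  \sum_(I : multi k) (-1) ^+ (\sum_(a < k) par (I a))%N * X (I, I).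

(* P_(a b) = sum_(i, j) 1 (x) e_ij (x) 1 (x) e_ji (x) 1 (-1)^(par j), with the
   matrix units at the positions a < b. *)
Lemma Pperm_tperm k (a b : 'I_k) (I J : multi k) : (a < b)%N ->
  Pperm (tperm a b) (I, J) =
  if [&& I a == J b, I b == J a & [forall (c | (c != a) && (c != b)), I c == J c]]
  then (-1) ^+ par (J a) else 0.
Proof.
move=> ab; rewrite ffunE /=; set C1 := [forall _, _]; set C2 := [&& _, _ & _].
have nab : a != b by rewrite -val_eqE neq_ltn ab.
have -> : C1 = C2.
  apply/idP/idP.
    move=> /forallP h; apply/and3P; split.
    - by have := h b; rewrite tpermR.
    - by have := h a; rewrite tpermL.
    apply/forallP=> c; apply/implyP=> /andP[ca cb].
    by have := h c; rewrite tpermD // eq_sym.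
  case/and3P=> h1 h2 /forallP h; apply/forallP=> c.
  case: (eqVneq c a) => [->|ca]; first by rewrite tpermL.
  case: (eqVneq c b) => [->|cb]; first by rewrite tpermR.
  by have := h c; rewrite ca cb tpermD // eq_sym.
case: ifP => // /and3P[/eqP h1 /eqP h2 /forallP h].
have hI c : c != a -> c != b -> I c = J c.
  by move=> ca cb; have := h c; rewrite ca cb => /eqP.
have eD c : epar I J c = ((c == a) || (c == b)) && (par (J a) (+) par (J b)).
  rewrite /epar; case: (eqVneq c a) => [->|ca] /=; first by rewrite h1 addbC.
  by case: (eqVneq c b) => [->|cb] /=; rewrite ?h2 // hI // addbb.
rewrite -signr_odd -[in RHS]signr_odd; congr (_ ^+ nat_of_bool _); rewrite oddb oddD.
pose S := (\sum_(c < k | a < c < b) par (J c))%N.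
have tD c : c != a -> c != b -> tperm a b c = c.
  by move=> ca cb; rewrite tpermD // eq_sym.
have E1 : inv_sign (tperm a b) J =
    (par (J a) * par (J b) + (par (J a) + par (J b)) * S)%N.
  rewrite /inv_sign (bigD1 a) //= tpermL (bigD1 b) /= ?tpermR ?ab //.
  rewrite mulnDl -!addnA; congr (_ + _)%N; congr (_ + _)%N.
    rewrite /S big_distrr; apply: eq_bigl => d /=.
    case: (eqVneq d b) => [->|db]; first by rewrite ltnn !andbF.
    case: (eqVneq d a) => [->|da]; first by rewrite ltnn.
    by rewrite tD // andbT.
  rewrite (bigD1 b) 1?eq_sym //= tpermR big1 ?add0n; last first.
    move=> d /andP[bd]; case: (eqVneq d a) => [->|da]; first by rewrite tpermL ltnNge ltnW.
    rewrite tD //; last by rewrite -val_eqE neq_ltn bd orbT.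
    by move=> da'; have := ltn_trans (ltn_trans bd da') ab; rewrite ltnn.
  rewrite /S big_distrr /= [RHS]big_mkcond /= [RHS](bigD1 a) //= ltnn add0n.
  rewrite [RHS](bigD1 b) 1?eq_sym //= ltnn andbF add0n.
  apply: eq_bigr => c /andP[ca cb]; rewrite tD // big_mkcond (bigD1 b) //= tpermR.
  rewrite big1 ?addn0 => [|d db]; first by rewrite andbC mulnC.
  case: (eqVneq d a) => [->|da]; last first.
    by rewrite tD //; case: ltngtP.
  rewrite tpermL; case: ifP => // /andP[h3 h4].
  by have := ltn_trans (ltn_trans h4 h3) ab; rewrite ltnn.
have Eb : (\sum_(d < k | (d < b)%N) par (J d) =
    \sum_(d < k | (d < a)%N) par (J d) + (par (J a) + S))%N.
  rewrite (bigID (fun d : 'I_k => (d < a)%N)) /=; congr (_ + _)%N.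
    apply: eq_bigl => d; apply: andb_idl => da; exact: ltn_trans da ab.
  rewrite (bigD1 a) ?ltnn ?ab //=; congr (_ + _)%N; apply: eq_bigl => d.
  by rewrite -leqNgt -val_eqE /=; case: (ltngtP a d); rewrite ?andbT ?andbF.
have E2 : odd (ksign (epar I J) (fun c => par (J c))) =
    (par (J a) (+) par (J b)) && (par (J a) (+) odd S).
  rewrite /ksign (bigD1 a) //= [X in (_ + X)%N](bigD1 b) 1?eq_sym //= [X in (_ + (_ + X))%N]big1 ?addn0.
    rewrite -!big_distrr /= !eD !eqxx orbT /= -mulnDr oddM oddb; congr (_ && _).
    by rewrite Eb !oddD oddb addKb.
  move=> c /andP[ca cb]; apply: big1 => d _.
  by rewrite eD (negbTE ca) (negbTE cb).
rewrite E1 E2 oddD !oddM !oddD !oddb.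
by case: (par (J a)); case: (par (J b)); case: (odd S).
Qed.

End SuperTensor.

Arguments Asym {m n F L} k.
Arguments Hsym {m n F L} k.
Arguments Tprod {m n F L} T k.

Section Affine.
Variables (F : fieldType) (m n : nat).

(* Basis of the affine Lie superalgebra: [Aff_e i j r] is e_ij t^r and [Aff_K]
   is the rescaled central element K'. *)
Inductive aff_basis := Aff_e of 'I_(m + n) & 'I_(m + n) & int | Aff_K.

Definition aff_par (x : aff_basis) : bool :=
  if x is Aff_e i j _ then par i (+) par j else false.

Definition aff_br (x y : aff_basis) : seq (F * aff_basis) :=
  match x, y with
  | Aff_e i j r, Aff_e k l s =>
    [:: ((k == j)%:R, Aff_e i l (r + s));
        (- ((i == l)%:R * (-1) ^+ ((par i (+) par j) && (par k (+) par l))),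
         Aff_e k j (r + s));
        (((n%:R - m%:R) * ((k == j)%:R * (i == l)%:R * (-1) ^+ par i)
          + (i == j)%:R * (k == l)%:R * (-1) ^+ (par i + par k)%N)
         * r%:~R * (r == - s)%:R, Aff_K)]
  | _, _ => [::]
  end.

Lemma aff_br_par x y : all
  (fun p => (p.1 == 0) || (aff_par p.2 == aff_par x (+) aff_par y)) (aff_br x y).
Proof.
case: x y => [i j r|] [k l s|] //=; rewrite andbT; apply/and3P; split.
- case: (eqVneq k j) => [->|_]; last by rewrite eqxx.
  by case: (par i); case: (par j); case: (par l); rewrite orbT.
- case: (eqVneq i l) => [->|_]; last by rewrite mul0r oppr0 eqxx.
  by case: (par l); case: (par j); case: (par k); rewrite orbT.
case: (boolP ((k == j) && (i == l))) => [/andP[/eqP-> /eqP->]|h1].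
  by case: (par l); case: (par j); rewrite orbT.
case: (boolP ((i == j) && (k == l))) => [/andP[/eqP-> /eqP->]|h2].
  by rewrite !addbb orbT.
by rewrite -!natrM !mulnb (negbTE h1) (negbTE h2) !(mul0r, mulr0, addr0) eqxx.
Qed.

Definition aff : superLie F := SuperLie aff_br_par.

(* The extension by tau, which is the basis vector [None]. *)
Definition afft_par (x : option aff_basis) : bool :=
  if x is Some y then aff_par y else false.

Definition afft_br (x y : option aff_basis) : seq (F * option aff_basis) :=
  match x, y with
  | Some u, Some v => [seq (p.1, Some p.2) | p <- aff_br u v]
  | None, Some (Aff_e i j r) => [:: (- r%:~R, Some (Aff_e i j (r - 1)))]
  | Some (Aff_e i j r), None => [:: (r%:~R, Some (Aff_e i j (r - 1)))]
  | _, _ => [::]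
  end.

Lemma afft_br_par x y : all
  (fun p => (p.1 == 0) || (afft_par p.2 == afft_par x (+) afft_par y)) (afft_br x y).
Proof.
case: x y => [[i j r|]|] [[k l s|]|] //=.
- exact: (aff_br_par (Aff_e i j r) (Aff_e k l s)).
- by rewrite addbF eqxx orbT.
- by rewrite eqxx orbT.
Qed.

Definition afft : superLie F := SuperLie afft_br_par.

Local Notation Uaff := (Uenv aff).
Local Notation Uafft := (Uenv afft).

Definition e_ (i j : 'I_(m + n)) (r : int) : Uaff := ugen (L := aff) (Aff_e i j r).
Definition K' : Uaff := ugen (L := aff) Aff_K.
Definition tau : Uafft := ugen (L := afft) None.

Definition iota_gen (x : aff) : Uafft := ugen (L := afft) (Some x).
Definition iota_aff : Uaff -> Uafft := ulift iota_gen.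

Lemma iota_genP (x y : aff) : iota_gen x * iota_gen y =
  (-1) ^+ (sl_par x && sl_par y) *: (iota_gen y * iota_gen x)
  + \sum_(p <- sl_br x y) p.1 *: iota_gen p.2.
Proof.
have -> : \sum_(p <- sl_br x y) p.1 *: iota_gen p.2 =
    \sum_(p <- @sl_br F afft (Some x) (Some y)) p.1 *: ugen p.2.
  by case: x y => [i j r|] [k l s|]; rewrite /= !(big_cons, big_nil).
exact: ugen_br.
Qed.

Lemma iota_aff_gen x : iota_aff (ugen x) = iota_gen x.
Proof. exact: (ulift_gen iota_genP). Qed.

(* U(t^-1 gl_{m|n}[t^-1]), as the subalgebra of U(aff) that it is by the
   Poincare-Birkhoff-Witt theorem. *)
Definition Uneg : Uaff -> Prop :=
  subalg (fun u => exists i j (r : int), r < 0 /\ u = e_ i j r).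

(* The vacuum module at the critical level, as a left U(aff)-module. *)
Definition vac_rel (u : Uaff) : Prop :=
  (exists i j (r : int), 0 <= r /\ u = e_ i j r) \/ u = K' - 1.
Definition Vcrit := lquot vac_rel.
HB.instance Definition _ := GRing.Lmodule.on Vcrit.
Definition to_vac (u : Uaff) : Vcrit := \pi_(lquot vac_rel) u.

Definition segal_sugawara (b : Vcrit) : Prop :=
  forall i j (r : int), 0 <= r -> e_ i j r *: b = 0.

Definition Tmat : 'M[Uafft]_(m + n) := \matrix_(i, j)
  ((i == j)%:R * tau + (-1) ^+ par i * iota_aff (e_ i j (-1))).

(* x = c_0 tau^k + c_1 tau^(k-1) + ... + c_k, with coefficients in
   U(t^-1 gl_{m|n}[t^-1]). *)
Definition tau_expansion k (x : Uafft) (c : {ffun 'I_k.+1 -> Uaff}) : Prop :=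
  (forall l, Uneg (c l)) /\ x = \sum_(l < k.+1) iota_aff (c l) * tau ^+ (k - l).

End Affine.

(* Main.v *)
(* T is a super Manin matrix: [T_1, T_2] (1 + P_12) = 0.  This relation alone
   implies the sum over a + b = n of [T_1^a, T_2^b] (1 + P_12) to vanish for all
   n.  With p_j = str T^j and sigma_k, h_k the supertraces of A_k T_1 .. T_k and
   H_k T_1 .. T_k, it also gives the Newton identities
     k sigma_k = sum_j (-1)^(j-1) sigma_(k-j) p_j,   k h_k = sum_j p_j h_(k-j),
   proved by absorbing the signs into a crossed product with the parity
   automorphism.  Removing the rows and columns of 1 + uT one at a time by
   Cramer's rule yields
     u d/du Ber(1 + uT) = Ber(1 + uT) sum_j (-1)^(j-1) p_j u^j,
   so that Ber(1 + uT) = sum_k sigma_k u^k.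

   The elements of U(t^-1 gl[t^-1]) that normalise the left ideal J defining the
   vacuum module form an algebra stable under ad tau, and they represent
   Segal-Sugawara vectors.  By the Newton identities it suffices that the
   coefficients of all p_k lie in it, that is, that every e_ij[r] with r >= 0
   maps p_k into J.  For r = 0 and 1 this follows from the relations for the
   powers of T, at the critical level only.  Higher r are reached by
   [L_1, e[r]] = - r e[r+1] with L_1 = - t^2 d/dt, since L_1 p_k is, modulo J, a
   combination of p_(k-1) and of the p_a p_(k-1-a).  The operators L_1 and tau,
   and the uniqueness of expansions in tau, come from an action on sequences in
   U(aff), where tau acts as d + z. *)
Require Import Defs.
From HB Require Import structures.
From mathcomp Require Import all_boot all_order all_algebra all_fingroup.
From mathcomp Require Import ring_quotient generic_quotient.
From mathcomp Require Import boolp reals complex ring.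

Set Implicit Arguments.
Unset Strict Implicit.
Unset Printing Implicit Defensive.

Import Order.TTheory GRing.Theory Num.Theory.
Local Open Scope ring_scope.

(** * Signed column determinants and their Newton identities *)

(** The obstacle is the signs. In a super Manin relation they mix row and column parities, so
    exchanging two columns is not a plain sign rule. Putting a power of eps in front of each row
    removes the mixture: what is left is [manin_rel], with signs depending only on the pair of rows
    and on the pair of columns. One calculus of words, with a switch [c], then serves both A_k and
    H_k. The symmetric case uses the transposed matrix over the opposite ring, which is why p_j
    stands on the left in the identity for h_k and on the right in the one for sigma_k.

    The elements e_ij[0] and e_ij[1] do not generate gl[t]: supercommutators in gl have supertrace
    zero, so brackets never reach, say, e_ii[2]. The operator L_1 does reach it, but it is not in
    the enveloping algebra. The computation therefore takes place in an algebra of linear operators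
    that contains U, tau, L_0 and L_1 and preserves J coefficientwise. No basis theorem for U
    enters: uniqueness of expansions in tau is read off from the action on the constant series 1. *)

Section Words.
Variables (B : nzRingType) (I : finType) (p : I -> bool) (c : bool).
Implicit Types (i j k l x y z : I) (u v w : seq I) (F : seq I -> B).

(** The exponent of the sign for exchanging two adjacent letters; [c] is true in the antisymmetric
    case (A_k) and false in the symmetric one (H_k). *)
Definition qx i j : bool := c (+) (p i && p j).
Definition qw i w : bool := foldr (fun j b => qx i j (+) b) false w.

Lemma qxC i j : qx i j = qx j i.
Proof. by rewrite /qx andbC. Qed.

(* Sum over the letters z of w of g (w with z deleted) z, with the sign of
   moving z to the end of w. *)
Fixpoint dsum (g : seq I -> I -> B) w : B :=
  if w is i :: w' then (-1) ^+ qw i w' * g w' i + dsum (fun u z => g (i :: u) z) w'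
  else 0.

Fixpoint usum (g : seq I -> I -> B) w : B :=
  if w is i :: w' then g w' i + usum (fun u z => g (i :: u) z) w' else 0.

Fixpoint wsum n (f : seq I -> B) : B :=
  if n is n'.+1 then \sum_i wsum n' (fun w => f (i :: w)) else f [::].

Lemma eq_dsum g h w : (forall u z, g u z = h u z) -> dsum g w = dsum h w.
Proof.
elim: w g h => //= i w IH g h gh; rewrite gh; congr (_ + _).
by apply: IH.
Qed.

Lemma eq_dsum_in g h w : (forall u z, z \in w -> g u z = h u z) ->
  dsum g w = dsum h w.
Proof.
elim: w g h => //= i w IH g h gh; rewrite gh ?mem_head //; congr (_ + _).
by apply: IH => u z zw; apply: gh; rewrite inE zw orbT.
Qed.

Lemma dsum0 w : dsum (fun _ _ => 0) w = 0.
Proof. by elim: w => //= i w ->; rewrite mulr0 addr0. Qed.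

Lemma dsumD g h w : dsum (fun u z => g u z + h u z) w = dsum g w + dsum h w.
Proof.
elim: w g h => /= [|i w IH] g h; first by rewrite addr0.
by rewrite IH mulrDr addrACA.
Qed.

Lemma dsum_mulr g b w : dsum (fun u z => g u z * b) w = dsum g w * b.
Proof.
elim: w g => /= [|i w IH] g; first by rewrite mul0r.
by rewrite IH mulrDl mulrA.
Qed.

Lemma dsum_sign (b : bool) g w :
  dsum (fun u z => (-1) ^+ b * g u z) w = (-1) ^+ b * dsum g w.
Proof.
elim: w g => /= [|i w IH] g; first by rewrite mulr0.
by rewrite IH mulrDr !mulrA -!signr_addb addbC.
Qed.

Lemma dsum_sum (r : seq I) g w :
  dsum (fun u z => \sum_(b <- r) g b u z) w = \sum_(b <- r) dsum (g b) w.
Proof.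
elim: r => [|b r IH].
  by rewrite big_nil -[RHS](dsum0 w); apply: eq_dsum => u z; rewrite big_nil.
rewrite big_cons -IH -dsumD; apply: eq_dsum => u z; by rewrite big_cons.
Qed.

(** Passing [i] through [w] amounts to passing it through the deleted letter [z] and through the
    rest [u], so the two exponents differ by [qx i z]. *)
Lemma dsum_qw i g w : dsum (fun u z => (-1) ^+ qw i u * g u z) w =
  (-1) ^+ qw i w * dsum (fun u z => (-1) ^+ qx i z * g u z) w.
Proof.
elim: w g => /= [|j w IH] g; first by rewrite mulr0.
rewrite [in RHS]mulrDr; congr (_ + _).
  rewrite !mulrA -!signr_addb; congr ((-1) ^+ nat_of_bool _ * _).
  by rewrite addbC; case: (qx i j); case: (qw i w); case: (qw j w).
under eq_dsum => u z do rewrite signr_addb -mulrA.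
by rewrite dsum_sign IH signr_addb mulrA.
Qed.

Lemma qw_cat i u v : qw i (u ++ v) = qw i u (+) qw i v.
Proof. by elim: u => //= j u ->; rewrite addbA. Qed.

Lemma qw_rcons i u z : qw i (rcons u z) = qw i u (+) qx i z.
Proof. by rewrite -cats1 qw_cat /= addbF. Qed.

Lemma dsum_rcons g w y : dsum g (rcons w y) =
  g w y + dsum (fun u z => (-1) ^+ qx z y * g (rcons u y) z) w.
Proof.
elim: w g => /= [|j w IH] g; first by rewrite mul1r.
rewrite IH addrCA; congr (_ + (_ + _)).
rewrite mulrA -signr_addb; congr ((-1) ^+ nat_of_bool _ * _).
exact: qw_rcons.
Qed.

(** The sign of moving the row letter [z] to the end cancels against the sign that the column word
    acquires when the same letter is moved to its end. Simultaneous deletion from rows and columns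
    is thus unsigned. *)
Lemma dsum_usum (h : seq I -> seq I -> I -> B) w :
    (forall a z v u t, h (a ++ z :: v) u t =
       (-1) ^+ qw z v * h (a ++ rcons v z) u t) ->
  dsum (h w) w = usum (fun u z => h (rcons u z) u z) w.
Proof.
elim: w h => //= i w IH h hP.
rewrite (hP [::] i w) mulrA -signr_addb addbb mul1r; congr (_ + _).
by rewrite (IH (fun col u z => h (i :: col) (i :: u) z)) // => a z v u t; apply: (hP (i :: a)).
Qed.

Lemma eq_wsum n f g : (forall w, size w = n -> f w = g w) -> wsum n f = wsum n g.
Proof.
elim: n f g => /= [|n IH] f g fg; first exact: fg.
by apply: eq_bigr => i _; apply: IH => w sw; apply: fg; rewrite /= sw.
Qed.

Lemma wsumD n f g : wsum n (fun w => f w + g w) = wsum n f + wsum n g.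
Proof.
by elim: n f g => //= n IH f g; rewrite -big_split; apply: eq_bigr => i _; rewrite IH.
Qed.

Lemma wsum_mulr n f b : wsum n (fun w => f w * b) = wsum n f * b.
Proof. by elim: n f => //= n IH f; rewrite mulr_suml; apply: eq_bigr. Qed.

Lemma wsum_mull n f b : wsum n (fun w => b * f w) = b * wsum n f.
Proof. by elim: n f => //= n IH f; rewrite mulr_sumr; apply: eq_bigr. Qed.

Lemma wsum_sum n (f : I -> seq I -> B) :
  wsum n (fun w => \sum_z f z w) = \sum_z wsum n (f z).
Proof.
elim: n f => //= n IH f; rewrite exchange_big /=.
by apply: eq_bigr => i _; apply: IH.
Qed.

Lemma wsum_rcons n f : wsum n.+1 f = \sum_z wsum n (fun w => f (rcons w z)).
Proof.
elim: n f => // n IH f; rewrite [LHS]/=.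
under eq_bigr => i _ do rewrite -/(wsum n.+1 (fun w => f (i :: w))) IH.
by rewrite exchange_big.
Qed.

Lemma wsum_usum n g : wsum n.+1 (usum g) = wsum n (fun u => \sum_z g u z) *+ n.+1.
Proof.
elim: n g => [|n IH] g.
  by rewrite /= mulr1n; apply: eq_bigr => i _; rewrite addr0.
rewrite -[LHS]/(\sum_i wsum n.+1 (fun w => g w i + usum (fun u z => g (i :: u) z) w)).
under eq_bigr => i _ do rewrite wsumD IH.
rewrite big_split /= exchange_big -big_split -sumrMnl.
by apply: eq_bigr => i _; rewrite wsum_sum mulrS.
Qed.

Section Columns.
Variable X : I -> I -> B.

Definition chi F y w := dsum (fun u z => F u * X z y) w.

Definition wdelta w : B := (w == [::])%:R.

(* wdet J w is the sum, over the bijections between the letters of w and those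
   of J, of the products of the entries X, taken in the order of J. *)
Definition wdet (J : seq I) : seq I -> B := foldl chi wdelta J.

Lemma eq_chi F F' y w : (forall u, F u = F' u) -> chi F y w = chi F' y w.
Proof. by move=> FF; apply: eq_dsum => u z; rewrite FF. Qed.

Lemma chi_sign (b : bool) F y w :
  chi (fun u => (-1) ^+ b * F u) y w = (-1) ^+ b * chi F y w.
Proof. by rewrite -dsum_sign; apply: eq_dsum => u z; rewrite mulrA. Qed.

Lemma eq_foldl_chi F F' J w : (forall u, F u = F' u) ->
  foldl chi F J w = foldl chi F' J w.
Proof.
by elim: J F F' => [|y J IH] F F' FF //=; apply: IH => u; apply: eq_chi.
Qed.

Lemma foldl_chi_sign (b : bool) F J w :
  foldl chi (fun u => (-1) ^+ b * F u) J w = (-1) ^+ b * foldl chi F J w.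
Proof.
elim: J F => [|y J IH] F //=; rewrite -IH; apply: eq_foldl_chi => u.
exact: chi_sign.
Qed.

Lemma wdet_rcons J y w : wdet (rcons J y) w = chi (wdet J) y w.
Proof. by rewrite /wdet -cats1 foldl_cat. Qed.

(** The exchange rule for the two columns of signed 2 x 2 minors. For [p] zero and [c] true it reads
    [X_ik, X_jl] = [X_jk, X_il], the relation of an ordinary Manin matrix. *)
Definition manin_rel := forall i j k l,
  X i l * X j k + (-1) ^+ qx i j * (X j l * X i k) =
  (-1) ^+ qx k l * (X i k * X j l + (-1) ^+ qx i j * (X j k * X i l)).
Hypothesis XP : manin_rel.

Lemma chi_cons F y i w : chi F y (i :: w) =
  (-1) ^+ qw i w * (F w * X i y) + chi (fun u => F (i :: u)) y w.
Proof. by []. Qed.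

(** Induction on the first letter [i] of the word. Terms in which neither column takes row [i]
    follow from the induction hypothesis; the others pair [i] with a second row [t] and are matched
    by [XP]. *)
Lemma chiC F y z w : chi (chi F y) z w = (-1) ^+ qx y z * chi (chi F z) y w.
Proof.
elim: w F => [|i w IH] F; first by rewrite /chi /= mulr0.
rewrite !chi_cons.
have E a b : chi (fun u => chi F a (i :: u)) b w =
    (-1) ^+ qw i w * dsum (fun u t => (-1) ^+ qx i t * (F u * X i a * X t b)) w +
    chi (chi (fun u => F (i :: u)) a) b w.
  rewrite -dsum_qw -dsumD; apply: eq_dsum => u t; rewrite chi_cons mulrDl.
  by rewrite !mulrA.
rewrite !E IH !addrA [RHS]mulrDr; congr (_ + _); rewrite -!mulrDr.
rewrite -!dsum_mulr -!dsumD mulrA -signr_addb addbC signr_addb -mulrA.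
congr (_ * _); rewrite -dsum_sign; apply: eq_dsum => u t.
have sC (b : bool) (e : B) : F u * ((-1) ^+ b * e) = (-1) ^+ b * (F u * e).
  by rewrite !mulrA; congr (_ * _); apply: commr_sign.
have := congr1 (fun b => F u * b) (XP t i z y).
rewrite mulrDr !sC !mulrDr !sC !mulrA (qxC t i) (qxC z y) => XP'.
exact: XP'.
Qed.

Lemma foldl_chiC F y z J w :
  foldl chi F [:: y, z & J] w = (-1) ^+ qx y z * foldl chi F [:: z, y & J] w.
Proof.
rewrite /= -foldl_chi_sign; apply: eq_foldl_chi => u; exact: chiC.
Qed.

Lemma wdet_rot a z v w :
  wdet (a ++ z :: v) w = (-1) ^+ qw z v * wdet (a ++ rcons v z) w.
Proof.
elim: v a => [|y v IH] a; first by rewrite mul1r.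
rewrite {1}/wdet foldl_cat foldl_chiC.
have -> : (-1) ^+ qw z (y :: v) = (-1) ^+ qx z y * (-1) ^+ qw z v :> B.
  by rewrite -signr_addb.
rewrite -mulrA; congr (_ * _).
have -> : foldl chi (foldl chi wdelta a) [:: y, z & v] w = wdet (rcons a y ++ z :: v) w.
  by rewrite cat_rcons /wdet foldl_cat.
by rewrite IH cat_rcons.
Qed.

(** Once the two equal columns are adjacent, exchanging them changes the sign, so twice the value is
    0. *)
Lemma wdet_dup a x v w : (forall b : B, b *+ 2 = 0 -> b = 0) -> qx x x ->
  wdet (rcons (a ++ x :: v) x) w = 0.
Proof.
move=> reg2 qxx.
have -> : wdet (rcons (a ++ x :: v) x) w =
    (-1) ^+ qw x v * chi (chi (wdet (a ++ v)) x) x w.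
  rewrite wdet_rcons -chi_sign; apply: eq_chi => u.
  by rewrite wdet_rot -rcons_cat wdet_rcons.
set G := chi _ x w; suff -> : G = 0 by rewrite mulr0.
by apply: reg2; rewrite mulr2n {1}/G chiC qxx mulN1r addNr.
Qed.

(** Replacing the last column by the combination of all columns with coefficients [b] adds only
    determinants with a repeated column. The new last column is [g] times a unit vector, so a single
    minor survives its expansion. *)
Lemma wdet_cramer (l : seq I) x (b : I -> B) g :
    (forall e : B, e *+ 2 = 0 -> e = 0) -> (forall i, qx i i) ->
    uniq (rcons l x) ->
    (forall z, z \in rcons l x ->
      \sum_(y <- rcons l x) X z y * b y = (z == x)%:R * g) ->
  wdet (rcons l x) (rcons l x) * b x = wdet l l * g.
Proof.
move=> reg2 qxx; rewrite rcons_uniq => /andP[xl _] bP.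
have -> : wdet (rcons l x) (rcons l x) * b x =
    \sum_(y <- rcons l x) wdet (rcons l y) (rcons l x) * b y.
  rewrite (perm_big (x :: l)) ?perm_rcons // big_cons /= big1_seq ?addr0 // => y /= yl.
  case/splitPr: yl => l1 l2.
  by rewrite wdet_dup ?mul0r.
under eq_bigr => y _ do rewrite wdet_rcons -dsum_mulr.
rewrite -dsum_sum (eq_dsum_in (h := fun u z => wdet l u * ((z == x)%:R * g))); last first.
  move=> u z zl; rewrite -bP // mulr_sumr; apply: eq_bigr => y _.
  by rewrite mulrA.
rewrite dsum_rcons eqxx mul1r (eq_dsum_in (h := fun _ _ => 0)) ?dsum0 ?addr0 //.
move=> u z zl; case: eqP => [zx|_]; first by rewrite -zx zl in xl.
by rewrite mul0r !mulr0.
Qed.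

Definition wtr n := wsum n (fun w => wdet w w).

(** Up to signs, an entry of the power X^(n+1). The sign at each step is the cost of moving the row
    letter [z] past [x], which stays fixed along the path. *)
Fixpoint wpath n x y : B :=
  if n is n'.+1 then \sum_z (-1) ^+ qx z x * (wpath n' x z * X z y) else X x y.

(** The trace of order n+1 with its last row and column left open; the Newton recursion closes on
    this quantity. *)
Let wphi n x y := wsum n (fun w => wdet (rcons w y) (rcons w x)).

Lemma wtrS n : wtr n.+1 = \sum_x wphi n x x.
Proof. exact: wsum_rcons. Qed.

(** Expansion along the last column [y]: it takes either row [x], or the row of a letter [z] of [w].
    By [wdet_rot] the [n] positions of [z] contribute equally, and deleting [z] leaves an open trace
    of lower order whose open column is [z]. *)
Let wphi_rec n x y : wphi n x y = wtr n * X x y +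
  (\sum_z (-1) ^+ qx z x * (wphi n.-1 x z * X z y)) *+ n.
Proof.
rewrite /wphi.
under eq_wsum => w _ do rewrite wdet_rcons /chi dsum_rcons.
rewrite wsumD wsum_mulr; congr (_ + _).
pose h col u z := (-1) ^+ qx z x * (wdet col (rcons u x) * X z y).
rewrite (@eq_wsum _ _ (usum (fun u z => h (rcons u z) u z))) => [|w _].
  case: n => [|n]; first by rewrite mulr0n.
  rewrite wsum_usum wsum_sum; congr (_ *+ _); apply: eq_bigr => z _ /=.
  by rewrite /h wsum_mull wsum_mulr.
rewrite -dsum_usum // => a z v u t.
by rewrite /h wdet_rot -mulrA !mulrA -!signr_addb addbC.
Qed.

(** The falling factorials come from the missing normalisation: [wtr n] plays the part of n! times a
    supertrace. *)
Lemma wtr_newton n : wtr n.+1 =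
  \sum_(j < n.+1) (wtr (n - j) * \sum_x wpath j x x) *+ (n ^_ j).
Proof.
suff E x y : wphi n x y = \sum_(j < n.+1) (wtr (n - j) * wpath j x y) *+ (n ^_ j).
  rewrite wtrS; under eq_bigr => x _ do rewrite E.
  rewrite exchange_big /=; apply: eq_bigr => j _.
  by rewrite mulr_sumr sumrMnl.
elim: n y => [|n IH] y; first by rewrite wphi_rec big_ord1 addr0.
rewrite wphi_rec /= big_ord_recl subn0 ffactn0; congr (_ + _).
under eq_bigr => z _ do rewrite IH mulr_suml mulr_sumr.
rewrite exchange_big -sumrMnl; apply: eq_bigr => j _ /=.
rewrite subSS ffactSS mulnC mulrnA; congr (_ *+ _).
rewrite mulr_sumr -sumrMnl; apply: eq_bigr => z _.
rewrite mulrnAl mulrnAr; congr (_ *+ _).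
by rewrite !mulrA; congr (_ * _ * _); apply/esym/commr_sign.
Qed.

End Columns.
End Words.

(** * Word determinants as sums over permutations *)

Section WordsPerm.
Variables (B : nzRingType) (I : finType) (p : I -> bool) (c : bool).
Local Notation qx := (qx p c).
Local Notation qw := (qw p c).
Implicit Types (i j x y z : I).

Lemma qw_map (T : Type) (M : T -> I) i (r : seq T) :
  qw i (map M r) = \big[addb/false]_(a <- r) qx i (M a).
Proof. by elim: r => [|a r IH] /=; rewrite ?big_nil // big_cons -IH. Qed.

Lemma dsum_map k (M : 'I_k.+1 -> I) (g : seq I -> I -> B) :
  dsum p c g (map M (enum 'I_k.+1)) =
  \sum_(a < k.+1) (-1) ^+ (\big[addb/false]_(b < k.+1 | (a < b)%N) qx (M a) (M b)) *
         g (map (fun b => M (lift a b)) (enum 'I_k)) (M a).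
Proof.
elim: k M g => [|k IH] M g.
  rewrite enum_ordSl enum_ord0 /= big_ord1 big_pred0 ?addr0; last first.
    by move=> b; rewrite (ord1 b).
  by congr (_ * g _ _); rewrite -[RHS]cats0 enum_ord0.
rewrite enum_ordSl /= -map_comp (IH (M \o lift ord0)) [RHS]big_ord_recl.
congr (_ + _).
  congr ((-1) ^+ nat_of_bool _ * _).
  rewrite qw_map [in RHS]big_mkcond big_ord_recl /= big_enum /=.
  by apply: eq_bigr.
apply: eq_bigr => a _; congr ((-1) ^+ nat_of_bool _ * g _ _).
  rewrite [in RHS]big_mkcond big_ord_recl /= [in LHS]big_mkcond.
  by apply: eq_bigr => b _; rewrite /= /bump !add1n ltnS.
rewrite enum_ordSl map_cons -map_comp; congr cons; first by (congr M; apply: val_inj).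
apply: eq_map => b /=; congr M; apply: val_inj.
by rewrite /= /bump !add1n ltnS addnS.
Qed.

Definition permsgn k (s : 'S_k) (M : 'I_k -> I) : bool :=
  (c && odd_perm s) (+)
  \big[addb/false]_(a < k) \big[addb/false]_(b < k | (a < b)%N && (s b < s a)%N)
     (p (M a) && p (M b)).

Lemma ltn_lift k (i : 'I_k.+1) (a b : 'I_k) : (lift i a < lift i b)%N = (a < b)%N.
Proof. by rewrite !ltnNge leq_bump2. Qed.

Lemma big_addb_gt k (i : 'I_k.+1) (b : bool) :
  \big[addb/false]_(a < k.+1 | (i < a)%N) b = b && (odd k (+) odd i).
Proof.
have iterE n : iter n (addb b) false = b && odd n.
  by elim: n => [|n /= ->]; rewrite ?andbF //; case: b; case: (odd n).
rewrite -(big_geq_mkord i.+1 k.+1 xpredT (fun=> b)) big_const_nat iterE subSS.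
by rewrite oddB // -ltnS.
Qed.

(** The inversions involving the last position are those with the values exceeding [i]. Their number
    also accounts for the change of the signature, so both combine into the exponents [qx]. *)
Lemma permsgn_lift k (i : 'I_k.+1) (s : 'S_k) (M : 'I_k.+1 -> I) :
  permsgn (lift_perm ord_max i s) (fun a => M (lift_perm ord_max i s a)) =
  \big[addb/false]_(b < k.+1 | (i < b)%N) qx (M i) (M b) (+)
  permsgn s (fun a => M (lift i (s a))).
Proof.
set t := lift_perm _ _ _.
have wE (a : 'I_k) : widen_ord (leqnSn k) a = lift ord_max a.
  by apply: val_inj; rewrite /= /bump leqNgt ltn_ord.
have tL (a : 'I_k) : t (lift ord_max a) = lift i (s a) by rewrite /t lift_perm_lift.
have tM : t ord_max = i by rewrite /t lift_perm_id.
rewrite /permsgn big_ord_recr /= [X in _ (+) (_ (+) X)]big_pred0; last first.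
  by move=> b; rewrite ltnNge -ltnS ltn_ord.
rewrite addbF.
under eq_bigr => a _ do rewrite big_mkcond big_ord_recr /= wE tL tM.
rewrite big_split /=.
under eq_bigr => a _ do under eq_bigr => b _ do rewrite wE tL ltn_lift.
under eq_bigr => a _ do rewrite -big_mkcond /=.
set P := (X in _ (+) (X (+) _)); set Q := (X in _ (+) (_ (+) X)) => /=.
suff E : (c && odd_perm t) (+) Q =
    \big[addb/false]_(b < k.+1 | (i < b)%N) qx (M i) (M b) (+) (c && odd_perm s).
  by rewrite addbCA E [LHS]addbC -addbA.
have -> : \big[addb/false]_(b < k.+1 | (i < b)%N) qx (M i) (M b) =
    (c && (odd k (+) odd i)) (+) Q.
  rewrite big_split /= big_addb_gt; congr (_ (+) _).
  rewrite big_mkcond (bigD1_ord i) //= ltnn (reindex_inj (@perm_inj _ s)) /=.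
  rewrite /Q; apply: eq_bigr => b _; rewrite ltn_ord /=; case: ifP => // _.
  by rewrite andbC.
rewrite odd_lift_perm andb_addr; case: (c && (_ (+) _)); case: Q => /=.
- by case: (c && s).
- by rewrite addbF.
- by case: (c && s).
- by rewrite addbF.
Qed.

Lemma sum_lift_perm (V : nmodType) k (f : 'S_k.+1 -> V) :
  \sum_s f s = \sum_(i < k.+1) \sum_(s : 'S_k) f (lift_perm ord_max i s).
Proof.
rewrite (partition_big (fun s : 'S_k.+1 => s ord_max) predT) //=.
apply: eq_bigr => j0 _; rewrite (reindex (lift_perm ord_max j0)); last first.
  (* Deletes the position [i] and the value [s i] from [s]; this inverts [lift_perm]. *)
  pose ulsf (i : 'I_k.+1) (s : 'S_k.+1) a := odflt a (unlift (s i) (s (lift i a))).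
  have ulsfK (i : 'I_k.+1) (s : 'S_k.+1) a : lift (s i) (ulsf i s a) = s (lift i a).
    rewrite /ulsf; have := neq_lift i a.
    by rewrite -(can_eq (permK s)) => /unlift_some[] ? ? ->.
  have inj_ulsf : injective (ulsf ord_max _).
    move=> s; apply: can_inj (ulsf (s ord_max) s^-1%g) _ => a.
    by rewrite {1}/ulsf ulsfK !permK liftK.
  exists (fun s => perm (inj_ulsf s)) => [s _ | s].
    by apply/permP => a; rewrite permE /ulsf lift_perm_lift lift_perm_id liftK.
  move/(s _ =P _) => si0; apply/permP => a.
  case: (unliftP ord_max a) => [a'|] ->; rewrite ?lift_perm_id //.
  by rewrite lift_perm_lift -si0 permE ulsfK.
by apply: eq_bigl => s; rewrite lift_perm_id eqxx.
Qed.

Lemma wdet_perm (X : I -> I -> B) k (M J : 'I_k -> I) :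
  wdet p c X (map J (enum 'I_k)) (map M (enum 'I_k)) =
  \sum_(s : 'S_k) (-1) ^+ permsgn s (fun a => M (s a)) * \prod_(a < k) X (M (s a)) (J a).
Proof.
elim: k M J => [|k IH] M J.
  rewrite enum_ord0 (big_pred1 1%g) => [|s]; last by rewrite /= permS0 eqxx.
  by rewrite /permsgn !big_ord0 odd_perm1 andbF mulr1.
have wE (a : 'I_k) : widen_ord (leqnSn k) a = lift ord_max a.
  by apply: val_inj; rewrite /= /bump leqNgt ltn_ord.
rewrite {1}enum_ordSr map_rcons wdet_rcons /chi dsum_map sum_lift_perm.
apply: eq_bigr => i _; rewrite -map_comp IH mulr_suml mulr_sumr.
apply: eq_bigr => s _; rewrite permsgn_lift signr_addb big_ord_recr /= lift_perm_id.
rewrite !mulrA; congr (_ * _ * _); apply: eq_bigr => a _.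
by rewrite wE lift_perm_lift.
Qed.

End WordsPerm.

Section WordsFfun.
Variables (B : nzRingType) (I : finType).

Lemma wsum_ffun n (f : seq I -> B) :
  wsum n f = \sum_(M : {ffun 'I_n -> I}) f (map M (enum 'I_n)).
Proof.
elim: n f => [|n IH] f /=.
  by rewrite enum_ord0 /= sumr_const card_ffun card_ord.
under eq_bigr => i _ do rewrite IH.
rewrite pair_big /=.
pose h (iM : I * {ffun 'I_n -> I}) : {ffun 'I_n.+1 -> I} :=
  [ffun a => if unlift ord0 a is Some a' then iM.2 a' else iM.1].
rewrite [RHS](reindex h) /=.
  apply: eq_bigr => -[i M] _; rewrite enum_ordSl /= -map_comp /h /=.
  rewrite ffunE unlift_none; congr (f (_ :: _)); apply: eq_map => a /=.
  by rewrite ffunE liftK.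
exists (fun M : {ffun 'I_n.+1 -> I} => (M ord0, [ffun a => M (lift ord0 a)])).
  move=> [i M] _; rewrite /h ffunE unlift_none; congr (_, _).
  by apply/ffunP => a; rewrite !ffunE liftK.
move=> M _; apply/ffunP => a; rewrite ffunE.
by case: unliftP => [a' ->|->] //=; rewrite ffunE.
Qed.

End WordsFfun.

Lemma prodr_converse (B : nzRingType) k (F : 'I_k -> B) :
  \prod_(a < k) (F a : B^c) = \prod_(a < k) F (rev_ord a) :> B.
Proof.
elim: k F => [|k IH] F; first by rewrite !big_ord0.
rewrite big_ord_recr [RHS]big_ord_recl.
have -> : rev_ord ord0 = ord_max :> 'I_k.+1 by apply: val_inj; rewrite /= subn1.
congr (F _ * _); rewrite IH; apply: eq_bigr => a _; congr F.
by apply: val_inj; rewrite /= /bump add1n subSS.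
Qed.

(** * Powers of two operators exchanged by an involution *)

Section TwoFold.
Variables (Q : pzRingType) (t1 t2 P : Q).
Hypotheses (reg2 : forall x : Q, x *+ 2 = 0 -> x = 0) (PP : P * P = 1).
Hypotheses (Pt1 : P * t1 = t2 * P) (t12 : (t1 * t2 - t2 * t1) * (1 + P) = 0).

Let S n := \sum_(a < n.+1) t2 ^+ (n - a) * t1 ^+ a.
Let e := 1 + P.

Let Pt2 : P * t2 = t1 * P.
Proof. by rewrite -[t2]mulr1 -PP [t2 * (P * P)]mulrA -Pt1 !mulrA PP mul1r. Qed.

Let Pe : P * e = e. Proof. by rewrite mulrDr PP mulr1 addrC. Qed.

Let S_S n : S n.+1 = t2 * S n + t1 ^+ n.+1.
Proof.
rewrite /S big_ord_recr /= subnn mul1r; congr (_ + _).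
rewrite mulr_sumr; apply: eq_bigr => a _.
by rewrite subSn ?exprS ?mulrA // -ltnS.
Qed.

(** This holds although [t1] and [t2] do not commute, because in each term of [S] all [t2] stand
    left of all [t1]. It expresses every [S n] through t1 + t2 and t1 t2. *)
Let S_rec n : S n.+2 = (t1 + t2) * S n.+1 - t1 * t2 * S n.
Proof.
rewrite mulrDl [in t1 * _]S_S mulrDr -exprS [t1 * _]mulrA.
by rewrite [RHS]addrC -[X in _ + X]addrA addKr addrC -S_S.
Qed.

(** Says that [x] maps the image of [e] into the vectors fixed by [P]. As e y = 2 y on such vectors,
    the property passes to products. *)
Let good x := P * (x * e) = x * e.

Let good_mul x y : good x -> good y -> good (x * y).
Proof.
move=> gx gy; have ey : e * (y * e) = y * e *+ 2.
  by rewrite {1}/e mulrDl mul1r gy mulr2n.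
apply/eqP; rewrite -subr_eq0; apply/eqP/reg2.
rewrite mulrnBl -mulrnAr.
have -> : (x * y * e) *+ 2 = x * e * (y * e).
  by rewrite -!mulrA ey mulrnAr.
by rewrite [P * _]mulrA gx subrr.
Qed.

Let goodD x y : good x -> good y -> good (x + y).
Proof. by rewrite /good => gx gy; rewrite mulrDl mulrDr gx gy. Qed.

Let goodN x : good x -> good (- x).
Proof. by rewrite /good => gx; rewrite mulNr mulrN gx. Qed.

Let good_t12 : good (t1 * t2).
Proof.
rewrite /good !mulrA Pt1 -[t2 * P * t2]mulrA Pt2 -!mulrA Pe !mulrA.
by apply/esym/eqP; rewrite -subr_eq0 -mulrBl t12.
Qed.

Let good_t1t2 : good (t1 + t2).
Proof. by rewrite /good mulrA [P * (t1 + t2)]mulrDr Pt1 Pt2 -mulrDl -mulrA Pe addrC. Qed.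

Let good_S n : good (S n).
Proof.
have g1 : good 1 by rewrite /good mul1r Pe.
have S0 : S 0 = 1 by rewrite /S big_ord1 mul1r.
have S1 : S 1 = t1 + t2 by rewrite S_S S0 mulr1 expr1 addrC.
suff: good (S n) /\ good (S n.+1) by case.
elim: n => [|n [g0 gS]]; first by rewrite S0 S1.
split=> //; rewrite S_rec; apply: goodD; first exact: good_mul.
by apply: goodN; apply: good_mul.
Qed.

(** The sum is P S P - S. Multiplied by [e] on the right it becomes P S e - S e, which vanishes
    because [S n] is [good]. *)
Lemma twofold_powers n :
  (\sum_(a < n.+1) (t1 ^+ a * t2 ^+ (n - a) - t2 ^+ (n - a) * t1 ^+ a)) * (1 + P) = 0.
Proof.
have PX1 a : P * t1 ^+ a = t2 ^+ a * P.
  by elim: a => [|a IH]; rewrite ?mulr1 ?mul1r // !exprS mulrA Pt1 -!mulrA IH.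
have PX2 a : P * t2 ^+ a = t1 ^+ a * P.
  by elim: a => [|a IH]; rewrite ?mulr1 ?mul1r // !exprS mulrA Pt2 -!mulrA IH.
have -> : \sum_(a < n.+1) (t1 ^+ a * t2 ^+ (n - a) - t2 ^+ (n - a) * t1 ^+ a) =
    P * S n * P - S n.
  rewrite sumrB; congr (_ - _); rewrite mulr_sumr mulr_suml.
  rewrite (reindex_inj rev_ord_inj); apply: eq_bigr => a _ /=.
  rewrite subSS subKn -1?ltnS // -[RHS]mulrA -[_ * _ * P]mulrA -PX2.
  by rewrite !mulrA PX2 -[_ * P * P]mulrA PP mulr1.
rewrite mulrBl -mulrA -/e Pe -mulrA.
by rewrite [P * _]good_S subrr.
Qed.

End TwoFold.

(** * Super Manin matrices *)

Section SuperManin.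
Variables (R : pzRingType) (N : nat) (p : 'I_N -> bool).
Implicit Types (A C T : 'M[R]_N).

(* The ((i, j), (k, l)) entry of [A_1, C_2] (1 + P_12), acting on
   C^(m|n) (x) C^(m|n) (x) R. *)
Definition mrel A C i j k l : R :=
  (-1) ^+ ((p i (+) p k) && p j) * (A i k * C j l)
  - (-1) ^+ ((p i (+) p k) && p l) * (C j l * A i k)
  + (-1) ^+ (p k && p l) *
    ((-1) ^+ ((p i (+) p l) && p j) * (A i l * C j k)
     - (-1) ^+ ((p i (+) p l) && p k) * (C j k * A i l)).

Definition super_manin T := forall i j k l, mrel T T i j k l = 0.

Local Notation Q := 'M['M[R]_N]_N.

Let mx2 (f : 'I_N -> 'I_N -> 'I_N -> 'I_N -> R) : Q :=
  \matrix_(i, k) \matrix_(j, l) f i j k l.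

Let mx2E f i j k l : mx2 f i k j l = f i j k l.
Proof. by rewrite !mxE. Qed.

Let mul2E (X Y : Q) i j k l : (X * Y) i k j l = \sum_a \sum_b X i a j b * Y a k b l.
Proof. by rewrite mxE summxE; apply: eq_bigr => a _; rewrite mxE. Qed.

Let eq2 (X Y : Q) : (forall i j k l, X i k j l = Y i k j l) -> X = Y.
Proof. by move=> XY; apply/matrixP => i k; apply/matrixP => j l. Qed.

(** With this sign [inj1] and [inj2] are both multiplicative and [flip] exchanges them. *)
Let inj1 A := mx2 (fun i j k l => (-1) ^+ ((p i (+) p k) && p j) * A i k * (j == l)%:R).
Let inj2 A := mx2 (fun i j k l => (i == k)%:R * A j l).
Let flip := mx2 (fun i j k l => (-1) ^+ (p k && p l) * ((i == l) && (j == k))%:R).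

Let sum_delta (i : 'I_N) (f : 'I_N -> R) : \sum_a (i == a)%:R * f a = f i.
Proof.
rewrite (bigD1 i) //= eqxx mul1r big1 ?addr0 // => a.
by rewrite eq_sym => /negbTE ->; rewrite mul0r.
Qed.

Let sum_delta' (i : 'I_N) (f : 'I_N -> R) : \sum_a (a == i)%:R * f a = f i.
Proof. by rewrite -[RHS]sum_delta; apply: eq_bigr => a _; rewrite eq_sym. Qed.

Let mul1E A (X : Q) i j k l : (inj1 A * X) i k j l =
  \sum_a (-1) ^+ ((p i (+) p a) && p j) * A i a * X a k j l.
Proof.
rewrite mul2E; apply: eq_bigr => a _.
under eq_bigr => b _ do rewrite mx2E -[_ * (j == b)%:R * _]mulrA.
by rewrite -mulr_sumr sum_delta.
Qed.

Let mul2E' A (X : Q) i j k l : (inj2 A * X) i k j l = \sum_b A j b * X i k b l.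
Proof.
rewrite mul2E exchange_big; apply: eq_bigr => b _ /=.
by under eq_bigr => a _ do rewrite mx2E -[_ * A j b * _]mulrA; rewrite sum_delta.
Qed.

Let flipE (X : Q) i j k l : (flip * X) i k j l = (-1) ^+ (p i && p j) * X j k i l.
Proof.
rewrite mul2E (bigD1 j) //= [X in _ + X]big1 ?addr0 => [|a aj]; last first.
  by apply: big1 => b _; rewrite mx2E [j == a]eq_sym (negbTE aj) andbF mulr0 mul0r.
rewrite (bigD1 i) //= big1 ?addr0 => [|b bi]; last first.
  by rewrite mx2E [i == b]eq_sym (negbTE bi) mulr0 mul0r.
by rewrite mx2E !eqxx mulr1 andbC.
Qed.

Let Xflip (X : Q) i j k l : (X * flip) i k j l = (-1) ^+ (p k && p l) * X i l j k.
Proof.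
rewrite mul2E (bigD1 l) //= [X in _ + X]big1 ?addr0 => [|a al]; last first.
  by apply: big1 => b _; rewrite mx2E (negbTE al) !mulr0.
rewrite (bigD1 k) //= big1 ?addr0 => [|b bk]; last first.
  by rewrite mx2E (negbTE bk) andbF !mulr0.
by rewrite mx2E !eqxx mulr1; apply: commr_sign.
Qed.

Let inj1_mul A C : inj1 A * inj1 C = inj1 (A * C).
Proof.
apply: eq2 => i j k l; rewrite mul1E mx2E mxE mulr_sumr mulr_suml.
apply: eq_bigr => a _; rewrite mx2E !mulrA; congr (_ * _ * _).
rewrite -[LHS]mulrA commr_sign mulrA -signr_addb; congr ((-1) ^+ nat_of_bool _ * _).
by case: (p i); case: (p a); case: (p k); case: (p j).
Qed.

Let inj2_mul A C : inj2 A * inj2 C = inj2 (A * C).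
Proof.
apply: eq2 => i j k l; rewrite mul2E' [in RHS]mx2E [in RHS]mxE mulr_sumr.
apply: eq_bigr => a _; rewrite mx2E !mulrA; congr (_ * _).
by case: (i == k); rewrite ?mulr0 ?mul0r // mulr1 mul1r.
Qed.

Let inj1_1 : inj1 1 = 1.
Proof.
apply: eq2 => i j k l; rewrite mx2E !mxE; case: (eqVneq i k) => [->|ik].
  by rewrite addbb mul1r mul1r mxE.
by rewrite mxE mulr0 mul0r.
Qed.

Let inj2_1 : inj2 1 = 1.
Proof.
apply: eq2 => i j k l; rewrite mx2E !mxE; case: (eqVneq i k) => [_|ik].
  by rewrite mul1r mxE.
by rewrite mxE mul0r.
Qed.

Let inj1X A n : inj1 A ^+ n = inj1 (A ^+ n).
Proof. by elim: n => [|n IH]; rewrite ?inj1_1 // !exprS IH inj1_mul. Qed.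

Let inj2X A n : inj2 A ^+ n = inj2 (A ^+ n).
Proof. by elim: n => [|n IH]; rewrite ?inj2_1 // !exprS IH inj2_mul. Qed.

Let mul12E A C i j k l : (inj1 A * inj2 C) i k j l =
  (-1) ^+ ((p i (+) p k) && p j) * (A i k * C j l).
Proof.
rewrite mul1E (bigD1 k) //= mx2E eqxx mul1r big1 ?addr0 ?mulrA // => a ak.
by rewrite mx2E (negbTE ak) mul0r mulr0.
Qed.

Let mul21E A C i j k l : (inj2 C * inj1 A) i k j l =
  (-1) ^+ ((p i (+) p k) && p l) * (C j l * A i k).
Proof.
rewrite mul2E' (bigD1 l) //= mx2E eqxx mulr1 big1 ?addr0 => [|b bl]; last first.
  by rewrite mx2E (negbTE bl) !mulr0.
by rewrite !mulrA; congr (_ * _); apply: commr_sign.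
Qed.

Let sub2E (X Y : Q) i j k l : (X - Y) i k j l = X i k j l - Y i k j l.
Proof. by rewrite !mxE. Qed.

Let mrel_comm A C i j k l :
  ((inj1 A * inj2 C - inj2 C * inj1 A) * (1 + flip)) i k j l = mrel A C i j k l.
Proof.
rewrite mulrDr mulr1; have addE (X Y : Q) : (X + Y) i k j l = X i k j l + Y i k j l.
  by rewrite !mxE.
by rewrite addE sub2E Xflip sub2E !mul12E !mul21E.
Qed.

Lemma super_manin_powers T n : (forall x : R, x *+ 2 = 0 -> x = 0) ->
  super_manin T ->
  forall i j k l, \sum_(a < n.+1) mrel (T ^+ a) (T ^+ (n - a)) i j k l = 0.
Proof.
move=> reg2 TM i j k l.
have sumE (F : 'I_n.+1 -> Q) : (\sum_a F a) i k j l = \sum_a F a i k j l.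
  by rewrite summxE summxE.
have E := @twofold_powers Q (inj1 T) (inj2 T) flip _ _ _ _ n.
under eq_bigr => a _ do rewrite -mrel_comm -!inj1X -!inj2X.
rewrite -sumE -mulr_suml E ?mxE //.
- move=> X X2; apply: eq2 => i' j' k' l'; rewrite !mxE; apply: reg2.
  by have := congr1 (fun Y : Q => Y i' k' j' l') X2; rewrite !mulr2n !mxE.
- apply: eq2 => i' j' k' l'; rewrite flipE mx2E !mxE.
  case: (eqVneq i' k') => [->|ik]; last by rewrite andbF mulr0 mulr0 mxE.
  rewrite andbT mxE; case: (eqVneq j' l') => [->|_]; last by rewrite !mulr0.
  by rewrite mulr1 -signr_addb andbC addbb.
- apply: eq2 => i' j' k' l'; rewrite flipE Xflip !mx2E.
  case: (eqVneq i' l') => [->|_]; last by rewrite !(mulr0, mul0r).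
  rewrite mulr1 mul1r mulrA -signr_addb; congr ((-1) ^+ nat_of_bool _ * _).
  by case: (p l'); case: (p j'); case: (p k').
by apply: eq2 => i' j' k' l'; rewrite mrel_comm TM !mxE.
Qed.

End SuperManin.

(** * The logarithmic derivative of the Berezinian *)

Section FpsDerivation.
Variable U : nzRingType.
Implicit Types f g h : fps U.

Lemma fcoefD f g k : fcoef (f + g) k = fcoef f k + fcoef g k. Proof. by []. Qed.
Lemma fcoefN f k : fcoef (- f) k = - fcoef f k. Proof. by []. Qed.
Lemma fcoefM f g k : fcoef (f * g) k = \sum_(i < k.+1) fcoef f i * fcoef g (k - i).
Proof. by []. Qed.
Lemma fcoef1 k : fcoef (1 : fps U) k = (k == 0%N)%:R.
Proof. by rewrite /=; case: eqP. Qed.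
Lemma fcoef0 k : fcoef (0 : fps U) k = 0.
Proof. by rewrite /= if_same. Qed.

Lemma fcoef_sign (b : bool) f k : fcoef ((-1) ^+ b * f) k = (-1) ^+ b * fcoef f k.
Proof. by case: b; rewrite ?mul1r // !mulN1r. Qed.

Lemma fcoefMn f n k : fcoef (f *+ n) k = fcoef f k *+ n.
Proof. by elim: n => [|n IH]; rewrite ?fcoef0 // !mulrS fcoefD IH. Qed.

Lemma fpsXC f : fpsX U * f = f * fpsX U.
Proof.
apply: fpsP => k; rewrite !fcoefM (reindex_inj rev_ord_inj).
apply: eq_bigr => i _ /=; rewrite subSS subKn -1?ltnS //.
by case: eqP; rewrite ?mul1r ?mulr1 ?mul0r ?mulr0.
Qed.

Lemma fpsCM (a b : U) : fpsC (a * b) = fpsC a * fpsC b.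
Proof.
apply: fpsP => k; rewrite fcoefM big_ord_recl /= subn0 big1 ?addr0 => [|i _].
  by case: eqP => _; rewrite ?mulr0.
by rewrite mul0r.
Qed.

Lemma fpsCD (a b : U) : fpsC (a + b) = fpsC a + fpsC b.
Proof. by apply: fpsP => k /=; case: eqP; rewrite ?addr0. Qed.

Definition theta f : fps U := FPS (fun k => fcoef f k *+ k).

Lemma thetaM f g : theta (f * g) = theta f * g + f * theta g.
Proof.
apply: fpsP => k; rewrite fcoefD !fcoefM /= -sumrMnl -big_split.
apply: eq_bigr => i _; have ik : (i <= k)%N by rewrite -ltnS.
by rewrite /= mulrnAl mulrnAr -mulrnDr subnKC.
Qed.

Lemma theta1 : theta 1 = 0.
Proof. by apply: fpsP => -[|k]; rewrite fcoef0 //= mul0rn. Qed.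

Lemma fps_cancel f g : fcoef g 0 = 1 -> f * g = 0 -> f = 0.
Proof.
move=> g0 fg; apply: fpsP => k; elim/ltn_ind: k => k IH.
have := congr1 (fun h => fcoef h k) fg.
rewrite fcoefM big_ord_recr /= subnn g0 mulr1 big1 ?add0r // => i _.
by rewrite IH // fcoef0 mul0r.
Qed.

(** As [h] has no constant term, the coefficient of order k+1 in theta f = f h involves only earlier
    coefficients of [f] on the right. *)
Lemma theta_unique f g h : (forall n (x : U), x *+ n.+1 = 0 -> x = 0) ->
  fcoef h 0 = 0 -> fcoef f 0 = fcoef g 0 ->
  theta f = f * h -> theta g = g * h -> f = g.
Proof.
move=> reg h0 fg0 fh gh; apply: fpsP => k; elim/ltn_ind: k => -[//|k] IH.
apply/eqP; rewrite -subr_eq0; apply/eqP/(reg k); rewrite mulrnBl.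
have E f' : theta f' = f' * h ->
    fcoef f' k.+1 *+ k.+1 = \sum_(i < k.+1) fcoef f' i * fcoef h (k.+1 - i).
  move=> /(congr1 (fun f => fcoef f k.+1)) /= ->.
  by rewrite big_ord_recr /= subnn h0 mulr0 addr0.
apply/eqP; rewrite (E f) // (E g) // subr_eq0; apply/eqP/eq_bigr => i _.
by rewrite IH.
Qed.

End FpsDerivation.

Section BerSteps.
Variables (U : nzRingType) (m n : nat).
Hypothesis reg : forall k (x : U), x *+ k.+1 = 0 -> x = 0.
Local Notation p := (@par m n).
Implicit Types (T : 'M[U]_(m + n)) (S : pred 'I_(m + n)).
Local Notation Y T := (inv_one_uT T).
Local Notation M T := (one_uT T).

(** Rows and columns are zeroed instead of deleted: the index type stays the same, and 1 + uT
    becomes the identity outside [S]. *)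
Definition restr S T : 'M[U]_(m + n) :=
  \matrix_(i, j) if S i && S j then T i j else 0.

Lemma restr_manin S T : super_manin p T -> super_manin p (restr S T).
Proof.
move=> TM i j k l; have := TM i j k l; rewrite /mrel !mxE.
case: (S i); case: (S j); case: (S k); case: (S l);
  by rewrite //= ?mulr0 ?mul0r ?mulr0 ?subr0 ?mulr0 ?addr0.
Qed.

Lemma restrI S S' T : restr S (restr S' T) = restr (predI S S') T.
Proof.
by apply/matrixP => i j; rewrite !mxE /=; case: (S i); case: (S j); case: (S' i); case: (S' j).
Qed.

Lemma one_uTE T i k : M T i k = (i == k)%:R + fpsX U * fpsC (T i k).
Proof. by rewrite !mxE. Qed.

Lemma inv_one_uT0 T i j : fcoef (Y T i j) 0 = (i == j)%:R.
Proof. by rewrite mxE /= expr0 mxE. Qed.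

Lemma one_uT_restr S T i k : S i -> S k -> M (restr S T) i k = M T i k.
Proof. by move=> Si Sk; rewrite !one_uTE mxE Si Sk. Qed.

Lemma one_uT_off S T i k : ~~ (S i && S k) -> M (restr S T) i k = (i == k)%:R.
Proof.
move=> /negbTE Sik; rewrite one_uTE mxE Sik.
by have -> : fpsC (0 : U) = 0 by []; rewrite mulr0 addr0.
Qed.

Let MY T i k : \sum_j M T i j * Y T j k = (i == k)%:R.
Proof. by have /matrixP/(_ i k) := (one_uT_inv T).1; rewrite !mxE. Qed.

Let YM T i k : \sum_j Y T i j * M T j k = (i == k)%:R.
Proof. by have /matrixP/(_ i k) := (one_uT_inv T).2; rewrite !mxE. Qed.

Lemma inv_one_uT_offl S T i k : ~~ S i -> Y (restr S T) i k = (i == k)%:R.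
Proof.
move=> Si; rewrite -(MY (restr S T)) (bigD1 i) //= one_uT_off ?(negbTE Si) // eqxx mul1r.
by rewrite big1 ?addr0 // => j ji; rewrite one_uT_off ?(negbTE Si) // eq_sym (negbTE ji) mul0r.
Qed.

Lemma inv_one_uT_offr S T i k : ~~ S k -> Y (restr S T) i k = (i == k)%:R.
Proof.
move=> Sk; rewrite -(YM (restr S T)) (bigD1 k) //= one_uT_off ?(negbTE Sk) ?andbF // eqxx mulr1.
by rewrite big1 ?addr0 // => j ji; rewrite one_uT_off ?(negbTE Sk) ?andbF // (negbTE ji) mulr0.
Qed.

(** Formally theta Y = - Y (uT) Y with uT = Y^(-1) - 1. On coefficients, the power of order [r]
    splits as a product of two powers in r+1 ways. *)
Lemma theta_inv_one_uT T i k : theta (Y T i k) = \sum_j Y T i j * Y T j k - Y T i k.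
Proof.
apply: fpsP => r; rewrite fcoefD fcoefN fcoef_sum !mxE /=.
transitivity (\sum_(a < r.+1) ((- T) ^+ r) i k - ((- T) ^+ r) i k).
  by rewrite sumr_const card_ord mulrSr addrK.
congr (_ - _); rewrite [RHS]exchange_big.
apply: eq_bigr => a _; have ar : (a <= r)%N by rewrite -ltnS.
by rewrite -{1}(subnKC ar) exprD mxE; apply: eq_bigr => j _; rewrite !mxE.
Qed.

(** The coefficient of u^r of the relation for the inverse is exactly the sum over a + b = r treated
    by [super_manin_powers], with - T in place of [T]. *)
Lemma inv_one_uT_manin T : super_manin p T -> super_manin p (Y T).
Proof.
move=> TM i j k l; apply: fpsP => r; rewrite fcoef0.
have NM : super_manin p (- T).
  by move=> i' j' k' l'; have := TM i' j' k' l'; rewrite /mrel !mxE !mulrNN.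
have reg2 (x : U) : x *+ 2 = 0 -> x = 0 by apply: reg.
have := super_manin_powers r reg2 NM i j k l; rewrite /mrel => <-.
rewrite !(fcoefD, fcoefN, fcoef_sign) !fcoefM !mxE /=.
rewrite big_split sumrB -!mulr_sumr sumrB -!mulr_sumr.
congr (_ * _ - _ * _ + _ * (_ * _ - _ * _)).
  by rewrite [LHS](reindex_inj rev_ord_inj); apply: eq_bigr => a _; rewrite /= subSS subKn -1?ltnS.
by rewrite [LHS](reindex_inj rev_ord_inj); apply: eq_bigr => a _; rewrite /= subSS subKn -1?ltnS.
Qed.

(** The supertrace of 1 - (1 + uT)^(-1), which is the series sum_j (-1)^(j-1) p_j u^j. *)
Definition dlog T : fps U := \sum_a (-1) ^+ p a * (1 - Y T a a).

Let reg2 (f : fps U) : f *+ 2 = 0 -> f = 0.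
Proof.
move=> f2; apply: fpsP => k; rewrite fcoef0; apply: (reg (k := 1)).
by rewrite -fcoefMn f2 fcoef0.
Qed.

Section Step.
Variables (T : 'M[U]_(m + n)) (j : 'I_(m + n)).
Hypothesis TM : super_manin p T.
Local Notation T' := (restr (predC1 j) T).
Local Notation y := (Y T).

Let YR := inv_one_uT_manin TM.

Let MT' a b : a != j -> b != j -> M T' a b = M T a b.
Proof. by move=> aj bj; apply: one_uT_restr. Qed.

(** With two equal even columns the super Manin relation is twice a commutator. *)
Lemma even_comm a : ~~ p j -> y a j * y j j = y j j * y a j.
Proof.
move=> /negbTE pj; apply/eqP; rewrite -subr_eq0; apply/eqP/reg2.
have := YR a j j j; rewrite /mrel pj ?andbF /= !mul1r.
by rewrite mulr2n.
Qed.

(** The mirror image for two equal rows of odd index. *)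
Lemma odd_comm a : p j -> y j a * y j j = y j j * y j a.
Proof.
move=> pj; apply/eqP; rewrite -subr_eq0; apply/eqP/reg2.
have := YR j j a j; rewrite /mrel pj addbb /= !andbT !mul1r.
case: (p a); rewrite /= ?expr0 ?expr1 ?mul1r ?mulN1r.
  by rewrite opprB mulr2n.
rewrite opprK [- _ + _]addrC => /(congr1 -%R); rewrite oppr0 opprD opprB.
by rewrite mulr2n.
Qed.

(** Removing row and column [j] from 1 + uT turns its inverse into the Schur complement y_ab - y_aj
    y_jj^(-1) y_jb. Here it is cleared of the inverse by multiplying by y_jj on the left, which
    commutes with y_aj. *)
Lemma schur_even a b : ~~ p j -> a != j ->
  y j j * Y T' a b = if b == j then 0 else y j j * y a b - y a j * y j b.
Proof.
move=> pj aj; pose z c := y j j * y a c - y a j * y j c.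
have zj : z j = 0 by rewrite /z -even_comm // subrr.
have zM c : \sum_b z b * M T' b c = if c == j then 0 else y j j * (a == c)%:R.
  case: (eqVneq c j) => [->|cj].
    rewrite (bigD1 j) //= zj mul0r add0r big1 // => d dj.
    by rewrite one_uT_off ?(negbTE dj) ?mulr0 //= eqxx andbF.
  transitivity (\sum_b z b * M T b c).
    apply: eq_bigr => d _; case: (eqVneq d j) => [->|dj]; first by rewrite zj !mul0r.
    by rewrite MT'.
  under eq_bigr => d _ do rewrite mulrBl -!mulrA.
  by rewrite sumrB -!mulr_sumr !YM [j == c]eq_sym (negbTE cj) mulr0 subr0.
transitivity (z b); last by case: (eqVneq b j) => [->|].
transitivity (\sum_c (\sum_d z d * M T' d c) * Y T' c b).
  rewrite (bigD1 a) //= zM (negbTE aj) eqxx mulr1 big1 ?addr0 // => c ca.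
  by rewrite zM [a == c]eq_sym (negbTE ca) mulr0 if_same mul0r.
under eq_bigr => c _ do rewrite mulr_suml.
rewrite exchange_big /= (bigD1 b) //= [X in _ + X]big1 ?addr0 => [|d db].
  under eq_bigr => c _ do rewrite -mulrA.
  by rewrite -mulr_sumr MY eqxx mulr1.
under eq_bigr => c _ do rewrite -mulrA.
by rewrite -mulr_sumr MY (negbTE db) mulr0.
Qed.

Lemma schur_odd a b : p j -> b != j ->
  Y T' a b * y j j = if a == j then 0 else y a b * y j j - y a j * y j b.
Proof.
move=> pj bj; pose z c := y c b * y j j - y c j * y j b.
have zj : z j = 0 by rewrite /z odd_comm // subrr.
have zM c : \sum_a M T' c a * z a = if c == j then 0 else (c == b)%:R * y j j.
  case: (eqVneq c j) => [->|cj].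
    rewrite (bigD1 j) //= zj mulr0 add0r big1 // => d dj.
    by rewrite one_uT_off /= ?eqxx // eq_sym (negbTE dj) mul0r.
  transitivity (\sum_a M T c a * z a).
    apply: eq_bigr => d _; case: (eqVneq d j) => [->|dj]; first by rewrite zj !mulr0.
    by rewrite MT'.
  under eq_bigr => d _ do rewrite mulrBr !mulrA.
  by rewrite sumrB -!mulr_suml !MY (negbTE cj) mul0r subr0.
transitivity (z a); last by case: (eqVneq a j) => [->|].
transitivity (\sum_c Y T' a c * (\sum_d M T' c d * z d)).
  rewrite (bigD1 b) //= zM (negbTE bj) eqxx mul1r big1 ?addr0 // => c cb.
  by rewrite zM (negbTE cb) mul0r if_same mulr0.
under eq_bigr => c _ do rewrite mulr_sumr.
rewrite exchange_big /= (bigD1 a) //= [X in _ + X]big1 ?addr0 => [|d da].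
  under eq_bigr => c _ do rewrite mulrA.
  by rewrite -mulr_suml YM eqxx mul1r.
under eq_bigr => c _ do rewrite mulrA.
by rewrite -mulr_suml YM eq_sym (negbTE da) mul0r.
Qed.

Let sgK (b : bool) (f : fps U) : (-1) ^+ b * ((-1) ^+ b * f) = f.
Proof. by rewrite mulrA -signr_addb addbb mul1r. Qed.

Let Y'jj : Y T' j j = 1.
Proof. by rewrite inv_one_uT_offl /= ?eqxx. Qed.

Let cancel4 (f g A S : fps U) : f - g + A + (g + S - f) = A + S.
Proof.
rewrite [f - g + A]addrC -addrA; congr (A + _).
by rewrite addrA addrA subrK addrAC subrr add0r.
Qed.

(** If f has logarithmic derivative [dlog T], then f y_jj has logarithmic derivative [dlog T']:
    removing an even index multiplies the Berezinian by y_jj. In [dlog_odd] the roles of [T] and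
    [T'] are exchanged. *)
Lemma dlog_even : ~~ p j ->
  dlog T * y j j + theta (y j j) = y j j * dlog T'.
Proof.
move=> pj; rewrite theta_inv_one_uT /dlog mulr_suml mulr_sumr.
rewrite (bigD1 j) //= [X in _ + (X - _)](bigD1 j) //= [in RHS](bigD1 j) //=.
rewrite Y'jj subrr !mulr0 add0r (negbTE pj) mul1r mulrBl mul1r cancel4 -big_split.
apply: eq_bigr => a aj /=; rewrite mulrA commr_sign -!mulrA; apply: (can_inj (sgK (p a))).
rewrite mulrDr !sgK mulrBl mulrBr mul1r mulr1 schur_even // (negbTE aj).
rewrite opprB -addrA; congr (_ + _).
have := YR j a j a; rewrite /mrel addbb (negbTE pj) /= andbb andbF !mul1r => E.
by apply/eqP; rewrite -subr_eq0 opprB addrACA [- _ + _]addrC E.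
Qed.

Lemma dlog_odd : p j ->
  dlog T' * y j j + theta (y j j) = y j j * dlog T.
Proof.
move=> pj; rewrite theta_inv_one_uT /dlog mulr_suml mulr_sumr.
rewrite (bigD1 j) //= [X in _ + (X - _)](bigD1 j) //= [in RHS](bigD1 j) //=.
rewrite Y'jj subrr !mulr0 mul0r add0r pj mulN1r opprB mulrBr mulr1.
rewrite [X in _ + X]addrAC addrCA; congr (_ + _); rewrite -big_split.
apply: eq_bigr => a aj /=; rewrite [in RHS]mulrA commr_sign -!mulrA.
apply: (can_inj (sgK (p a))).
rewrite mulrDr !sgK mulrBl mulrBr mul1r mulr1 schur_odd // (negbTE aj).
rewrite opprB -addrA; congr (_ + _).
have := YR j a j a; rewrite /mrel addbb pj /= andbT andNb !mul1r => E.
apply/eqP; rewrite -subr_eq0 opprK -E; apply/eqP.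
set X := (-1) ^+ p a * (_ - _).
have -> : X = (-1) ^+ p a * (y j a * y a j) + y a j * y j a.
  by rewrite /X; case: (p a); rewrite /= ?mul1r ?mulN1r ?opprB ?opprK // addrC.
by rewrite addrC -!addrA [- _ + _ in LHS]addrC [RHS]addrA [RHS]addrC -[RHS]addrA.
Qed.

End Step.

Lemma theta_dlog_unique (f g : fps U) T :
  fcoef f 0 = fcoef g 0 -> theta f = f * dlog T -> theta g = g * dlog T -> f = g.
Proof.
apply: theta_unique => //; rewrite fcoef_sum big1 // => a _.
by rewrite fcoef_sign fcoefD fcoefN fcoef1 inv_one_uT0 !eqxx subrr mulr0.
Qed.

(** * The two determinants in the Berezinian *)

Section BerFactors.
Variable T : 'M[U]_(m + n).
Hypothesis TM : super_manin p T.
Local Notation lsh := (@lshift m n).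
Local Notation rsh := (@rshift m n).

Let par_l i : p (lsh i) = false.
Proof. by rewrite /par /= leqNgt ltn_ord. Qed.

Let par_r i : p (rsh i) = true.
Proof. by rewrite /par /= leq_addr. Qed.

Let comm_one (b1 b2 : bool) (x y : U) :
  (b1%:R + fpsX U * fpsC x) * (b2%:R + fpsX U * fpsC y)
  - (b2%:R + fpsX U * fpsC y) * (b1%:R + fpsX U * fpsC x) =
  fpsX U * fpsX U * fpsC (x * y - y * x).
Proof.
have natC (b : bool) (f : fps U) : f * b%:R = b%:R * f by case: b; rewrite ?mulr1 ?mul1r ?mulr0 ?mul0r.
rewrite !mulrDl !mulrDr !(natC _ (fpsX U * _)) (natC b1).
rewrite [X in X - _]addrACA opprD [LHS]addrACA subrr add0r opprD [LHS]addrACA subrr add0r.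
have XX (z t : U) : fpsX U * fpsC z * (fpsX U * fpsC t) = fpsX U * fpsX U * fpsC (z * t).
  by rewrite fpsCM !mulrA; congr (_ * _); rewrite -!mulrA -fpsXC.
rewrite !XX -mulrBr; congr (_ * _).
by apply: fpsP => k; rewrite fcoefD fcoefN /=; case: eqP; rewrite ?subr0.
Qed.

Let XE (i k : 'I_m) : fps U := M T (lsh i) (lsh k).

Let XE_manin : manin_rel xpred0 true XE.
Proof.
move=> i j k l; rewrite /qx /= !mulN1r /XE !one_uTE.
have := TM (lsh i) (lsh j) (lsh k) (lsh l); rewrite /mrel !par_l /= !mul1r.
set a := T _ _; set b := T _ _; set c := T _ _; set d := T _ _ => E.
apply/eqP; rewrite -subr_eq0 opprK addrACA [X in _ + X]addrC addrACA !comm_one.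
by rewrite -mulrDr -fpsCD [c * d - d * c + _]addrC E -[fpsC 0]/(0 : fps U) mulr0.
Qed.

Let cdet (l : seq 'I_m) := wdet xpred0 true XE l l.

Let inl (l : seq 'I_m) : pred 'I_(m + n) := fun i => i \in map lsh l.

Let cdet_theta l : uniq l ->
  fcoef (cdet l) 0 = 1 /\ theta (cdet l) = cdet l * dlog (restr (inl l) T).
Proof.
elim/last_ind: l => [|l x IH].
  have -> : cdet [::] = 1 by [].
  rewrite fcoef1 theta1 mul1r; split=> //; rewrite /dlog big1 // => a _.
  by rewrite inv_one_uT_offl // eqxx subrr mulr0.
move=> ul; have [xl ul'] : x \notin l /\ uniq l by move: ul; rewrite rcons_uniq => /andP[].
pose TS := restr (inl (rcons l x)) T; pose y i := Y TS (lsh i) (lsh x).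
have lshP i r : inl r (lsh i) = (i \in r) by rewrite /inl mem_map //; apply: lshift_inj.
(* The column of the inverse with index [x] solves the linear system with right-hand side the unit
   vector at [x], so Cramer's rule applies with [g] equal to 1. *)
have crE : cdet (rcons l x) * y x = cdet l.
  rewrite /cdet (wdet_cramer XE_manin (g := 1)) ?mulr1 // => z zl.
  rewrite mulr1 -(inj_eq (@lshift_inj m n)) -(MY TS).
  rewrite (bigID (inl (rcons l x))) /= [X in _ = _ + X]big1 ?addr0; last first.
    by move=> b bl; rewrite one_uT_off ?(negbTE bl) ?andbF // eq_sym; case: eqP bl => [->|]; rewrite ?mul0r // lshP zl.
  rewrite -big_uniq ?map_inj_uniq ?big_map //; last exact: lshift_inj.
  by apply: eq_big_seq => b bl; rewrite /XE one_uT_restr ?lshP.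
have y0 : fcoef (y x) 0 = 1 by rewrite inv_one_uT0 eqxx.
have [c0 cT] := IH ul'; split.
  by rewrite -crE fcoefM big_ord1 subn0 y0 mulr1 in c0.
have TSM : super_manin p TS by apply: restr_manin.
have TE : restr (inl l) T = restr (predC1 (lsh x)) TS.
  rewrite restrI; congr restr; apply/funext => i; rewrite /inl /= map_rcons mem_rcons inE.
  by case: eqVneq => [->|] //=; rewrite mem_map ?(negbTE xl) //; apply: lshift_inj.
apply/eqP; rewrite -subr_eq0; apply/eqP/(fps_cancel y0).
have := dlog_even TSM (j := lsh x); rewrite par_l -TE => /(_ isT) E.
move: cT; rewrite -crE thetaM -mulrA -E mulrDr mulrA => /addIr cT.
by rewrite mulrBl cT subrr.
Qed.

Local Notation B' := (fps U)^c%type.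

(** The second determinant in [Ber] is ordered by rows. Transposition and passage to the opposite
    ring make it a column determinant, to which the calculus of words applies. *)
Let XO (i k : 'I_n) : B' := Y T (rsh k) (rsh i).

Let XO_manin : manin_rel xpred0 true XO.
Proof.
move=> i j k l; rewrite /qx /= !mulN1r /XO.
have := inv_one_uT_manin TM (rsh k) (rsh l) (rsh j) (rsh i).
rewrite /mrel !par_r /= !mul1r mulN1r.
set a := Y T (rsh k) (rsh j); set b := Y T (rsh l) (rsh i).
set c := Y T (rsh k) (rsh i); set d := Y T (rsh l) (rsh j) => E.
change (a * b - c * d = - (d * c - b * a)).
apply/eqP; rewrite -subr_eq0 opprK -[X in _ == X]E; apply/eqP.
by rewrite opprB addrACA [X in _ + X]addrC addrACA [RHS]addrA addrA.
Qed.

Let rdet (l : seq 'I_n) : fps U := wdet xpred0 true XO l l.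

Let outr (l : seq 'I_n) : pred 'I_(m + n) := fun i => i \notin map rsh l.

Let outrP i l : outr l (rsh i) = (i \notin l).
Proof. by rewrite /outr mem_map //; apply: rshift_inj. Qed.

Let rdet_rcons l x : uniq (rcons l x) ->
  rdet (rcons l x) = Y (restr (outr l) T) (rsh x) (rsh x) * rdet l.
Proof.
move=> ul; have [xl ul'] : x \notin l /\ uniq l by move: ul; rewrite rcons_uniq => /andP[].
pose y := Y (restr (outr l) T) (rsh x).
(* A row of the inverse of the restricted matrix times the full 1 + uT. Outside [l] it is the unit
   row at [x], and multiplying back by the full inverse gives [y], which vanishes on [l]: these are
   the hypotheses of Cramer's rule for the inverse matrix itself. *)
pose w b := \sum_a y a * M T a b.
have w_out b : outr l b -> w b = (rsh x == b)%:R.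
  move=> bl; rewrite -(YM (restr (outr l) T)) /w; apply: eq_bigr => a _.
  case: (boolP (outr l a)) => al; first by rewrite one_uT_restr.
  have xa : rsh x != a by apply: contraNneq al => <-; rewrite outrP.
  by rewrite /y inv_one_uT_offr // (negbTE xa) !mul0r.
have wY z : \sum_b w b * Y T b z = y z.
  under eq_bigr => b _ do rewrite mulr_suml.
  rewrite exchange_big /= (bigD1 z) //= [X in _ + X]big1 ?addr0 => [|a az].
    under eq_bigr => b _ do rewrite -mulrA.
    by rewrite -mulr_sumr MY eqxx mulr1.
  under eq_bigr => b _ do rewrite -mulrA.
  by rewrite -mulr_sumr MY (negbTE az) mulr0.
have C : _ -> w (rsh x) * rdet (rcons l x) = y (rsh x) * rdet l :=
  @wdet_cramer B' _ _ _ _ XO_manin l x (w \o rsh) (y (rsh x)) reg2 (fun=> isT) ul.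
rewrite -C ?w_out ?outrP ?eqxx ?mul1r // => z zl.
transitivity (\sum_(b <- rcons l x) w (rsh b) * Y T (rsh b) (rsh z)) => //.
rewrite -(big_map rsh xpredT (fun b => w b * Y T b (rsh z))) big_uniq; last first.
  by rewrite map_inj_uniq //; apply: rshift_inj.
transitivity (y (rsh z)).
  rewrite -wY [RHS](bigID (fun b => b \in map rsh (rcons l x))) /= [X in _ = _ + X]big1 ?addr0 //.
  move=> b; rewrite map_rcons mem_rcons inE negb_or => /andP[bx bl].
  by rewrite w_out // eq_sym (negbTE bx) mul0r.
case: (eqVneq z x) zl => [->|zx]; first by rewrite mul1r.
rewrite mem_rcons inE (negbTE zx) /= => zl.
rewrite /y inv_one_uT_offr ?outrP ?zl // (inj_eq (@rshift_inj m n)) eq_sym (negbTE zx).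
by rewrite mul0r.
Qed.

(** The factor [f] absorbs the diagonal entries split off so far: each one puts an odd index back,
    until no index is missing. *)
Let rdet_theta l f : uniq l ->
  fcoef f 0 = 1 -> theta f = f * dlog (restr (outr l) T) ->
  fcoef (f * rdet l) 0 = 1 /\ theta (f * rdet l) = f * rdet l * dlog T.
Proof.
elim/last_ind: l f => [|l x IH] f ul f0 fT.
  have -> : rdet [::] = 1 by [].
  rewrite mulr1 f0; split=> //; rewrite fT; congr (_ * dlog _).
  by apply/matrixP => i j; rewrite !mxE.
have [xl ul'] : x \notin l /\ uniq l by move: ul; rewrite rcons_uniq => /andP[].
rewrite rdet_rcons // mulrA; apply: IH => //.
  by rewrite fcoefM big_ord1 f0 mul1r inv_one_uT0 eqxx.
have TSM : super_manin p (restr (outr l) T) by apply: restr_manin.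
have := dlog_odd TSM (j := rsh x); rewrite par_r => /(_ isT).
have -> : restr (predC1 (rsh x)) (restr (outr l) T) = restr (outr (rcons l x)) T.
  rewrite restrI; congr restr; apply/funext => i.
  by rewrite /outr /= map_rcons mem_rcons inE negb_or.
by move=> E; rewrite thetaM fT -!mulrA -mulrDr E.
Qed.

(** Reversed, since products in the opposite ring are read backwards while [Ber] lists the odd rows
    in increasing order. *)
Let rl : seq 'I_n := map (@rev_ord n) (enum 'I_n).

Let rdet_perm : rdet rl =
  \sum_(s : 'S_n) (-1) ^+ s * \prod_(i < n) Y T (rsh i) (rsh (s i)).
Proof.
pose r := perm (@rev_ord_inj n).
have rE a : r a = rev_ord a by rewrite permE.
have rVE a : (r^-1)%g a = rev_ord a.
  by apply: (perm_inj (s := r)); rewrite permKV rE rev_ordK.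
rewrite [RHS](reindex_inj (conjg_inj r)) [LHS]wdet_perm.
apply: eq_bigr => s _.
have -> : permsgn xpred0 true s (fun a => rev_ord (s a)) = s :> bool.
  by rewrite /permsgn big1 ?addbF // => a _; rewrite big1.
rewrite odd_permJ (@prodr_converse (fps U)).
suff -> : \prod_(a < n) (XO (rev_ord (s (rev_ord a))) (rev_ord (rev_ord a)) : fps U) =
    \prod_(i < n) Y T (rsh i) (rsh ((s ^ r)%g i)).
  by case: (odd_perm s); rewrite ?mulN1r ?mul1r.
by apply: eq_bigr => a _; rewrite /XO rev_ordK conjgE !permM rVE rE.
Qed.

Lemma theta_Ber : fcoef (Ber_uT T) 0 = 1 /\ theta (Ber_uT T) = Ber_uT T * dlog T.
Proof.
have [c0 cT] := cdet_theta (enum_uniq 'I_m).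
have cE : cdet (enum 'I_m) =
    \sum_(s : 'S_m) (-1) ^+ s * \prod_(i < m) M T (lsh (s i)) (lsh i).
  rewrite /cdet -[in X in wdet _ _ _ X _](map_id (enum 'I_m)).
  rewrite -[in X in wdet _ _ _ _ X](map_id (enum 'I_m)) wdet_perm.
  apply: eq_bigr => s _; congr ((-1) ^+ nat_of_bool _ * _).
  by rewrite /permsgn big1 ?addbF // => a _; rewrite big1.
have rlu : uniq rl by rewrite map_inj_uniq ?enum_uniq //; apply: rev_ord_inj.
have := @rdet_theta rl (cdet (enum 'I_m)) rlu c0.
have -> : restr (outr rl) T = restr (inl (enum 'I_m)) T.
  congr restr; apply/funext => i; case: (split_ordP i) => [j|j] ->.
    rewrite /inl mem_map ?mem_enum; last exact: lshift_inj.
    by apply/mapP => -[k _ /eqP]; rewrite eq_lrshift.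
  rewrite outrP -[j in LHS]rev_ordK /rl mem_map ?mem_enum; last exact: rev_ord_inj.
  by apply/esym/mapP => -[k _ /eqP]; rewrite eq_rlshift.
by move=> /(_ cT); rewrite rdet_perm cE.
Qed.

End BerFactors.

End BerSteps.

(** * Newton identities for super Manin matrices *)

Section Bosonization.
Variables (U : nzRingType) (N : nat) (p : 'I_N -> bool) (T : 'M[U]_N).
Hypothesis TM : super_manin p T.

(* The crossed product of U by its parity automorphism, inside the 2 x 2
   matrices over U: t of parity h is diag (t, (-1)^h t), and [bz true] adds the
   factor eps = - antidiag (1, 1) on the left, so that eps t = (-1)^h t eps. *)
Definition bz (g h : bool) (t : U) : 'M[U]_2 := \matrix_(a, b)
  if ((a == b) == ~~ g) then (-1) ^+ (g (+) (h && (b != 0))) * t else 0.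

(** This is eps^(p i) T_ik. *)
Definition bzX i k : 'M[U]_2 := bz (p i) (p i (+) p k) (T i k).

(** The row (1, 1) is a left eigenvector of eps, with eigenvalue -1. Multiplying by it on the left
    therefore evaluates every eps as a sign and brings identities back from the crossed product to
    [U]; [e] records the parity accumulated so far. *)
Definition bzrow (e : bool) (y : U) : 'rV[U]_2 :=
  \row_b ((-1) ^+ (e && (b != 0)) * y).

Let signE m' n' (b : bool) (A : 'M[U]_(m', n')) i j :
  ((-1) ^+ b *: A) i j = (-1) ^+ b * A i j.
Proof. by rewrite mxE. Qed.

Let sign_mx (b : bool) (A : 'M[U]_2) i j : ((-1) ^+ b * A) i j = (-1) ^+ b * A i j.
Proof. by case: b; rewrite ?mul1r // !mulN1r mxE. Qed.

Let ord2 (P : 'I_2 -> Prop) : P 0 -> P 1 -> forall i, P i.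
Proof.
move=> P0 P1 [[|[|//]] i2]; first by rewrite (_ : Ordinal i2 = 0) //; apply: val_inj.
by rewrite (_ : Ordinal i2 = 1) //; apply: val_inj.
Qed.

Lemma bzM g h t g' h' t' :
  bz g h t * bz g' h' t' = (-1) ^+ (h && g') * bz (g (+) g') (h (+) h') (t * t').
Proof.
apply/matrixP; apply: ord2; apply: ord2;
  rewrite sign_mx !mxE !big_ord_recl big_ord0 !mxE /= addr0;
  by case: g; case: h; case: g'; case: h';
     rewrite /= ?mul0r ?mulr0 ?add0r ?addr0 ?mul1r ?mulN1r ?mulNr ?mulrN ?opprK.
Qed.

Lemma bzD g h t t' : bz g h (t + t') = bz g h t + bz g h t'.
Proof. by apply/matrixP => a b; rewrite !mxE; case: ifP; rewrite ?addr0 // mulrDr. Qed.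

Lemma bz_sign (c : bool) g h t : bz g h ((-1) ^+ c * t) = (-1) ^+ c * bz g h t.
Proof.
apply/matrixP => a b; rewrite sign_mx !mxE; case: ifP; rewrite ?mulr0 //.
by rewrite !mulrA -!signr_addb addbC.
Qed.

Lemma bzrow_mul e y g h t :
  bzrow e y *m bz g h t = (-1) ^+ (g && ~~ e) *: bzrow (e (+) h) (y * t).
Proof.
apply/matrixP; case; case=> // i0; apply: ord2;
  rewrite signE !mxE !big_ord_recl big_ord0 !mxE /= addr0;
  by case: g; case: h; case: e;
     rewrite /= ?mul0r ?mulr0 ?add0r ?addr0 ?mul1r ?mulN1r ?mulNr ?mulrN ?opprK.
Qed.

Lemma bzrow_sign (c : bool) e y : bzrow e ((-1) ^+ c * y) = (-1) ^+ c *: bzrow e y.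
Proof.
by apply/rowP => b; rewrite !mxE !mulrA -!signr_addb addbC.
Qed.

Lemma bzrow_sum (I : Type) (r : seq I) (P : pred I) e (f : I -> U) :
  bzrow e (\sum_(i <- r | P i) f i) = \sum_(i <- r | P i) bzrow e (f i).
Proof.
apply: (big_morph (bzrow e)) => [x y|]; apply/rowP => b; rewrite !mxE ?mulrDr //.
by rewrite mulr0.
Qed.

Lemma bzrow_even y : bzrow false y = y *: bzrow false 1.
Proof. by apply/rowP => b; rewrite !mxE /= !mul1r mulr1. Qed.

Let bz_manin i j k l :
  bzX i l * bzX j k + (-1) ^+ qx p true i j * (bzX j l * bzX i k) =
  (-1) ^+ qx p true k l * (bzX i k * bzX j l + (-1) ^+ qx p true i j * (bzX j k * bzX i l)).
Proof.
rewrite /bzX !bzM; set g := p i (+) p j; rewrite [p j (+) p i]addbC -/g.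
pose h := p i (+) p j (+) (p k (+) p l).
have -> : p i (+) p l (+) (p j (+) p k) = h by rewrite /h; case: (p i); case: (p j); case: (p k); case: (p l).
have -> : p j (+) p l (+) (p i (+) p k) = h by rewrite /h; case: (p i); case: (p j); case: (p k); case: (p l).
have -> : p i (+) p k (+) (p j (+) p l) = h by rewrite /h; case: (p i); case: (p j); case: (p k); case: (p l).
have -> : p j (+) p k (+) (p i (+) p l) = h by rewrite /h; case: (p i); case: (p j); case: (p k); case: (p l).
rewrite -!bz_sign -!bzD -!bz_sign; congr bz.
apply/eqP; rewrite -subr_eq0; apply/eqP.
rewrite -[RHS](mulr0 ((-1) ^+ (p k && p l))) -(TM i j k l) /mrel /qx.
rewrite !mulrDr !mulrN !mulrA -!signr_addb.
have perm4 (a b c d : U) : c - b + (a - d) = a - b - (- c + d).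
  by rewrite opprD opprK addrACA [c + a]addrC addrACA.
rewrite perm4; congr (_ + _ - (_ + _)).
- by case: (p i); case: (p j); case: (p k); case: (p l).
- by case: (p i); case: (p j); case: (p k); case: (p l); rewrite /= ?mul1r ?mulN1r ?mulNr ?opprK.
- by case: (p i); case: (p j); case: (p k); case: (p l); rewrite /= ?mul1r ?mulN1r ?mulNr ?opprK.
- by case: (p i); case: (p j); case: (p k); case: (p l); rewrite /= ?mul1r ?mulN1r ?mulNr ?opprK.
Qed.

Lemma bzX_manin : manin_rel p true bzX.
Proof. exact: bz_manin. Qed.

(** The quadratic relation of [bzX_manin], solved for the exchange of the two rows instead of the
    two columns. This turns the antisymmetric rule into a symmetric one. *)
Lemma bzX_manin_conv : manin_rel p false (fun i k => bzX k i : ('M[U]_2)^c%type).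
Proof.
move=> i j k l.
pose s : 'M[U]_2 := (-1) ^+ (p k && p l); pose t : 'M[U]_2 := (-1) ^+ (p i && p j).
pose a := bzX k j * bzX l i; pose b := bzX k i * bzX l j.
pose c := bzX l j * bzX k i; pose d := bzX l i * bzX k j.
have E : b - s * d = - (t * (a - s * c)).
  have := bzX_manin k l j i; rewrite /qx /= !signrN !mulNr [p j && _]andbC.
  by [].
have tt (x : 'M[U]_2) : t * (t * x) = x by rewrite mulrA -signr_addb addbb mul1r.
have {E} : a + t * b = s * (c + t * d).
  move/(congr1 ( *%R t)): E; rewrite mulrN tt mulrBr => /eqP.
  rewrite subr_eq => /eqP ->; rewrite addrA opprB addrCA subrr addr0 mulrDr; congr (_ + _).
  by rewrite /s /t !mulrA -!signr_addb addbC.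
rewrite /qx /= /s /t.
by case: (p k && p l); case: (p i && p j); rewrite /= ?mul1r ?mulN1r.
Qed.

(** The eps of the factor [a] is evaluated on a row whose parity is [e] plus the parities of the
    factors before it. *)
Definition bzsign k (M J : 'I_k -> 'I_N) (e : bool) : bool :=
  \big[addb/false]_(a < k)
    (p (M a) && ~~ (e (+) \big[addb/false]_(b < k | (b < a)%N) (p (M b) (+) p (J b)))).

Lemma bzrow_prod k (M J : 'I_k -> 'I_N) e y :
  bzrow e y *m \prod_(a < k) bzX (M a) (J a) =
  (-1) ^+ bzsign M J e *: bzrow (e (+) \big[addb/false]_(a < k) (p (M a) (+) p (J a)))
                                (y * \prod_(a < k) T (M a) (J a)).
Proof.
elim: k M J => [|k IH] M J.
  by rewrite /bzsign !big_ord0 mulmx1 addbF mulr1 scale1r.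
rewrite !big_ord_recr /= -mulmxE mulmxA IH -scalemxAl bzrow_mul scalerA -signr_addb.
rewrite addbA mulrA; congr ((-1) ^+ nat_of_bool _ *: _).
rewrite /bzsign big_ord_recr /=; congr (_ (+) _).
  apply: eq_bigr => a _; congr (_ && ~~ (_ (+) _)).
  rewrite [in RHS]big_mkcond big_ord_recr /= [X in _ = _ (+) X]ifN ?addbF; last first.
    by rewrite -leqNgt ltnW.
  by rewrite [in LHS]big_mkcond.
  congr (_ && ~~ (_ (+) _)).
  rewrite [in RHS]big_mkcond big_ord_recr /= ltnn addbF.
  by apply: eq_bigr => a _; rewrite ltn_ord.
by rewrite !addbA ?mulrA.
Qed.

Definition pstr j : U := \sum_x (-1) ^+ p x * (T ^+ j) x x.

Let row1 := bzrow false 1.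

(** After evaluation the signs along a path depend only on its end [x] and on its length, so the
    paths add up to an honest power of [T]. *)
Lemma bzrow_wpath c j x y :
  row1 *m wpath p c bzX j x y =
  (-1) ^+ (c && odd j (+) p x) *: bzrow (p x (+) p y) ((T ^+ j.+1) x y).
Proof.
elim: j y => [|j IH] y /=.
  by rewrite bzrow_mul /= andbT andbF mul1r expr1.
rewrite mulmx_sumr.
have -> : (T ^+ j.+2) x y = \sum_z (T ^+ j.+1) x z * T z y by rewrite exprSr mxE.
rewrite bzrow_sum scaler_sumr; apply: eq_bigr => z _.
have sgE (b : bool) (A C : 'M[U]_2) : row1 *m ((-1) ^+ b * (A * C)) = (-1) ^+ b *: (row1 *m A *m C).
  by case: b; rewrite ?mul1r ?scale1r ?mulN1r ?scaleN1r ?mulmxN mulmxA.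
rewrite sgE IH -scalemxAl bzrow_mul !scalerA -!signr_addb; congr ((-1) ^+ nat_of_bool _ *: bzrow _ _).
  by rewrite /qx; case: (c); case: (odd j); case: (p x); case: (p z).
by case: (p x); case: (p y); case: (p z).
Qed.

Lemma bzrow_wpath_conv c j x y (w : U) :
  bzrow (p x (+) p y) w *m (wpath p c (fun i k => bzX k i : ('M[U]_2)^c%type) j x y : 'M[U]_2) =
  (-1) ^+ (c && odd j (+) (p x && p y)) *: bzrow false (w * (T ^+ j.+1) y x).
Proof.
elim: j y w => [|j IH] y w.
  rewrite [LHS]bzrow_mul expr1; congr ((-1) ^+ nat_of_bool _ *: bzrow _ _).
    by case: (c); case: (p x); case: (p y).
  by case: (p x); case: (p y).
have -> : (T ^+ j.+2) y x = \sum_z T y z * (T ^+ j.+1) z x by rewrite exprS mxE.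
pose W z : 'M[U]_2 := wpath p c (fun i k => bzX k i : ('M[U]_2)^c%type) j x z.
have -> : wpath p c (fun i k => bzX k i : ('M[U]_2)^c%type) j.+1 x y =
    \sum_z (-1) ^+ qx p c z x *: (bzX y z *m W z) :> 'M[U]_2.
  apply: eq_bigr => z _; rewrite -/(W z).
  by case: (qx p c z x); rewrite ?mul1r ?scale1r ?mulN1r ?scaleN1r.
rewrite mulr_sumr bzrow_sum scaler_sumr mulmx_sumr; apply: eq_bigr => z _.
have sgE (b : bool) (A : 'rV[U]_2) (C : 'M[U]_2) : A *m ((-1) ^+ b *: C) = (-1) ^+ b *: (A *m C).
  by case: b; rewrite ?scale1r // !scaleN1r mulmxN.
rewrite sgE mulmxA bzrow_mul -scalemxAl.
have -> : p x (+) p y (+) (p y (+) p z) = p x (+) p z.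
  by case: (p x); case: (p y); case: (p z).
rewrite [X in _ *: (_ *: X)]IH !scalerA -!signr_addb mulrA.
congr ((-1) ^+ nat_of_bool _ *: _).
by rewrite /qx /=; case: (c); case: (odd j); case: (p x); case: (p y); case: (p z).
Qed.

Lemma wtr_perm (B : nzRingType) (X : 'I_N -> 'I_N -> B) c k :
  wtr p c X k = \sum_(I : {ffun 'I_k -> 'I_N}) \sum_(s : 'S_k)
    (-1) ^+ permsgn p c s (fun a => I (s a)) * \prod_(a < k) X (I (s a)) (I a).
Proof. by rewrite /wtr wsum_ffun; apply: eq_bigr => I _; rewrite wdet_perm. Qed.

(* k! times the supertrace of A_k T_1 .. T_k (if c) or of H_k T_1 .. T_k. *)
Definition zsum c k : U :=
  \sum_(I : {ffun 'I_k -> 'I_N}) \sum_(s : 'S_k)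
    (-1) ^+ (permsgn p c s (fun a => I (s a)) (+) bzsign (fun a => I (s a)) I false) *
    \prod_(a < k) T (I (s a)) (I a).

Let zsumE c k :
  row1 *m (\sum_(I : {ffun 'I_k -> 'I_N}) \sum_(s : 'S_k)
    (-1) ^+ permsgn p c s (fun a => I (s a)) * \prod_(a < k) bzX (I (s a)) (I a)) =
  zsum c k *: row1.
Proof.
rewrite -bzrow_even bzrow_sum mulmx_sumr; apply: eq_bigr => I _.
rewrite bzrow_sum mulmx_sumr; apply: eq_bigr => s _.
have sgE (b : bool) (A : 'M[U]_2) : row1 *m ((-1) ^+ b * A) = (-1) ^+ b *: (row1 *m A).
  by case: b; rewrite ?mul1r ?scale1r ?mulN1r ?scaleN1r ?mulmxN.
have E : \big[addb/false]_(a < k) (p (I (s a)) (+) p (I a)) = false.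
  by rewrite big_split /= [X in _ (+) X](reindex_inj (@perm_inj _ s)) addbb.
by rewrite sgE bzrow_prod bzrow_sign mul1r scalerA -signr_addb E.
Qed.

Let row1_pstr c j : row1 *m (\sum_x wpath p c bzX j x x) =
  (-1) ^+ (c && odd j) * pstr j.+1 *: row1.
Proof.
rewrite mulmx_sumr -bzrow_even /pstr mulr_sumr bzrow_sum; apply: eq_bigr => x _.
by rewrite bzrow_wpath addbb bzrow_sign bzrow_sign scalerA -signr_addb.
Qed.

Let row1_pstr_conv c j :
  row1 *m (\sum_x wpath p c (fun i k => bzX k i : ('M[U]_2)^c%type) j x x : 'M[U]_2) =
  (-1) ^+ (c && odd j) * pstr j.+1 *: row1.
Proof.
rewrite [LHS]mulmx_sumr -bzrow_even /pstr mulr_sumr bzrow_sum; apply: eq_bigr => x _.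
have := bzrow_wpath_conv c j x x 1; rewrite addbb => ->.
by rewrite mul1r andbb !bzrow_sign scalerA -signr_addb.
Qed.

Let row1_inj y z : y *: row1 = z *: row1 -> y = z.
Proof. by move/rowP/(_ 0); rewrite !mxE /= mul1r !mulr1. Qed.

Let mulmxMn (A : 'rV[U]_2) (C : 'M[U]_2) r : A *m (C *+ r) = (A *m C) *+ r.
Proof. by elim: r => [|r IH]; rewrite ?mulmx0 // !mulrS mulmxDr IH. Qed.

Lemma zsum_newtonA n : zsum true n.+1 =
  \sum_(j < n.+1) (zsum true (n - j) * ((-1) ^+ odd j * pstr j.+1)) *+ (n ^_ j).
Proof.
apply: row1_inj; rewrite -zsumE -wtr_perm (wtr_newton bzX_manin) mulmx_sumr scaler_suml.
apply: eq_bigr => j _; rewrite -scalerMnl -scalerA -(row1_pstr true) mulmxMn -mulmxE mulmxA.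
by rewrite wtr_perm zsumE scalemxAl.
Qed.

(** The opposite ring reverses the products and the transposition swaps rows with columns. Both are
    undone by inverting [s], conjugating it by the reversal of positions, and reading [I] along [s]
    backwards. *)
Let wtr_conv k :
  wtr p false (fun i l => bzX l i : ('M[U]_2)^c%type) k =
  \sum_(I : {ffun 'I_k -> 'I_N}) \sum_(s : 'S_k)
    (-1) ^+ permsgn p false s (fun a => I (s a)) * \prod_(a < k) bzX (I (s a)) (I a)
  :> 'M[U]_2.
Proof.
rewrite [LHS]wtr_perm.
pose r := perm (@rev_ord_inj k).
have rE a : r a = rev_ord a by rewrite permE.
have rVE a : (r^-1)%g a = rev_ord a.
  by apply: (perm_inj (s := r)); rewrite permKV rE rev_ordK.
rewrite [LHS]exchange_big [RHS]exchange_big /=.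
rewrite [RHS](reindex_inj (inj_comp (conjg_inj r) invg_inj)) /=.
apply: eq_bigr => s _; pose s' := ((s^-1) ^ r)%g; rewrite -/s'.
have s'E a : s' a = rev_ord ((s^-1)%g (rev_ord a)) by rewrite /s' conjgE !permM rVE rE.
pose h (I : {ffun 'I_k -> 'I_N}) : {ffun 'I_k -> 'I_N} := [ffun a => I (s (rev_ord a))].
have hI : injective h.
  move=> I1 I2 /ffunP I12; apply/ffunP => a.
  by have := I12 (rev_ord ((s^-1)%g a)); rewrite !ffunE rev_ordK permKV.
rewrite [RHS](reindex_inj hI) /=; apply: eq_bigr => I _.
have hs' a : h I (s' a) = I (rev_ord a) by rewrite ffunE s'E rev_ordK permKV.
have -> : permsgn p false s' (fun a => h I (s' a)) = permsgn p false s (fun a => I (s a)).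
  rewrite /permsgn /=.
  pose t := inj_comp rev_ord_inj (@perm_inj _ s).
  rewrite (reindex_inj t) /=; apply: eq_bigr => a _.
  rewrite (reindex_inj t) /=; apply: eq_big => b.
    have revlt (x y : 'I_k) : (rev_ord x < rev_ord y)%N = (y < x)%N.
      by rewrite /= !ltnNge leq_sub2lE.
    by rewrite !s'E !rev_ordK !permK andbC -![(k - _ < _)%N]/(rev_ord _ < rev_ord _)%N !revlt.
  by rewrite !hs' !rev_ordK.
rewrite (@prodr_converse 'M[U]_2).
have -> : \prod_(a < k) bzX (h I (s' a)) (h I a) =
    \prod_(a < k) bzX (I (rev_ord a)) (I (s (rev_ord a))).
  by apply: eq_bigr => a _; rewrite hs' ffunE.
by case: (permsgn _ _ _ _); rewrite ?mul1r ?mulN1r.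
Qed.

Lemma zsum_newtonH n : zsum false n.+1 =
  \sum_(j < n.+1) (pstr j.+1 * zsum false (n - j)) *+ (n ^_ j).
Proof.
apply: row1_inj; rewrite -zsumE -wtr_conv (wtr_newton bzX_manin_conv).
rewrite [LHS]mulmx_sumr scaler_suml; apply: eq_bigr => j _.
rewrite -scalerMnl -scalerA -zsumE -wtr_conv [LHS]mulmxMn; congr (_ *+ _).
rewrite [LHS]mulmxA (row1_pstr_conv false) /= mul1r.
by rewrite -scalemxAl.
Qed.

End Bosonization.

(** * Supertraces of symmetrisers *)

Section TensorTrace.
Variables (m n : nat) (F : fieldType) (L : superLie F).
Local Notation U := (Uenv L).
Local Notation p := (@par m n).
Local Notation multi := (multi m n).
Local Notation tens := (tens m n L).
Variable T : 'M[U]_(m + n).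
Hypothesis T_par : forall i k, upar (T i k) = (-1) ^+ (p i (+) p k) * T i k.

Let upar_sign (b : bool) (x : U) : upar ((-1) ^+ b * x) = (-1) ^+ b * upar x.
Proof.
have [uD uM uZ u1] := upar_hom L.
have uN y : upar (- y : U) = - upar y by rewrite -scaleN1r uZ scaleN1r.
by case: b; rewrite ?mul1r // !mulN1r uN.
Qed.

Let upar0 r : iter r (@upar F L) 0 = 0.
Proof.
have [_ _ uZ _] := upar_hom L.
by elim: r => //= r ->; rewrite -[X in upar X](scale0r (0 : U)) uZ scale0r.
Qed.

Let iter_upar r (b : bool) i k : iter r (@upar F L) ((-1) ^+ b * T i k) =
  (-1) ^+ (odd r && (p i (+) p k)) * ((-1) ^+ b * T i k).
Proof.
elim: r => [|r IH]; first by rewrite mul1r.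
rewrite iterS IH !upar_sign T_par !mulrA -!signr_addb; congr ((-1) ^+ nat_of_bool _ * _).
by rewrite /=; case: (odd r); case: (b); case: (p i); case: (p k).
Qed.

Let odd_sum (I : finType) (P : pred I) (f : I -> nat) :
  odd (\sum_(i | P i) f i)%N = \big[addb/false]_(i | P i) odd (f i).
Proof. by apply: (big_morph odd) => // x y; rewrite oddD. Qed.

(** The first sum collects the signs in the definition of T_a; the second is the cost of moving the
    matrix units of later factors past the entries of [T] in earlier ones. *)
Definition tsign k j (f : 'I_j -> 'I_k) (I J : multi k) : bool :=
  \big[addb/false]_(a < j) ((p (I (f a)) && p (J (f a))) (+) p (J (f a))) (+)
  \big[addb/false]_(a < j) \big[addb/false]_(b < j | (b < a)%N)
    ((p (I (f a)) (+) p (J (f a))) && (p (I (f b)) (+) p (J (f b)))).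

Let Tbig k j (f : 'I_j -> 'I_k) : tens k :=
  \big[@tens_mul m n F L k/tens_one m n L k]_(a < j) Tfactor T (f a).

(** Stated for products over an increasing choice of tensor factors so that the first factor can be
    split off. As it lies to the left of all the others, the matrix units multiply without sign. *)
Lemma TbigE k j (f : 'I_j -> 'I_k) (I J : multi k) :
  (forall a b : 'I_j, (a < b)%N -> (f a < f b)%N) ->
  Tbig f (I, J) =
  if [forall (c | c \notin codom f), I c == J c] then
    (-1) ^+ tsign f I J * \prod_(a < j) T (I (f a)) (J (f a))
  else 0.
Proof.
elim: j f I => [|j IH] f I fI.
  rewrite /Tbig big_ord0 ffunE /= /tsign !big_ord0 mul1r.
  have -> : [forall (c | c \notin codom f), I c == J c] = (I == J).
    apply/forall_inP/eqP => [IJ|-> //]; apply/ffunP => c; apply/eqP/IJ.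
    by apply/codomP => -[[]].
  by case: eqP.
pose f' (a : 'I_j) := f (lift ord0 a).
have f'I (a b : 'I_j) : (a < b)%N -> (f' a < f' b)%N by move=> ab; apply: fI; rewrite ltn_lift.
rewrite /Tbig big_ord_recl -/(Tbig f').
(* The only intermediate index that contributes: the first factor changes only the slot [f ord0],
   which the remaining factors leave alone. *)
pose M0 : multi k := [ffun b => if b == f ord0 then J b else I b].
have M0f : M0 (f ord0) = J (f ord0) by rewrite ffunE eqxx.
have M0N b : b != f ord0 -> M0 b = I b by move=> bf; rewrite ffunE (negbTE bf).
have f0f' a : f' a != f ord0 by rewrite -val_eqE neq_ltn [X in _ || X]fI ?orbT.
rewrite ffunE /= (bigD1 M0) //= [X in _ + X]big1 ?addr0; last first.
  move=> M MM0; rewrite !ffunE /=; case: ifP => [/forall_inP MI|_]; last first.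
    by rewrite upar0 mulr0 mul0r.
  rewrite IH //; case: ifP => [/forall_inP MJ|_]; last by rewrite mulr0.
  case/eqP: MM0; apply/ffunP => b; case: (eqVneq b (f ord0)) => [->|bf].
    rewrite M0f; apply/eqP/MJ; apply/codomP => -[a /eqP]; rewrite eq_sym.
    by rewrite (negbTE (f0f' a)).
  by rewrite M0N //; apply/esym/eqP/MI.
rewrite IH //.
have f'inj : injective f'.
  by move=> a b ab; case: (ltngtP a b) => [/f'I|/f'I|/val_inj //]; rewrite ab ltnn.
have codomf c : (c \in codom f) = (c == f ord0) || (c \in codom f').
  apply/codomP/idP => [[a ->]|/orP[/eqP ->|/codomP[a ->]]]; last 2 first.
  - by exists ord0.
  - by exists (lift ord0 a).
  case: (unliftP ord0 a) => [a'|] ->; last by rewrite eqxx.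
  by rewrite (codom_f f' a') orbT.
have -> : [forall (c | c \notin codom f'), M0 c == J c] =
    [forall (c | c \notin codom f), I c == J c].
  apply/forall_inP/forall_inP => H c cf.
    have := H c; rewrite codomf negb_or in cf; case/andP: cf => c0 cf'.
    by rewrite M0N //; apply.
  case: (eqVneq c (f ord0)) => [->|c0]; first by rewrite M0f.
  by rewrite M0N //; apply: H; rewrite codomf negb_or c0.
case: ifP => [/forall_inP IJ|_]; last by rewrite mulr0.
have M0J c : c \notin codom f' -> M0 c = J c.
  move=> cf; case: (eqVneq c (f ord0)) => [->//|c0].
  by rewrite M0N //; apply/eqP/IJ; rewrite codomf negb_or c0.
rewrite -signr_odd.
have -> : odd (ksign (epar I M0) (epar M0 J)) = false.
  rewrite odd_sum big1 // => a _; rewrite odd_sum big1 // => b ba.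
  rewrite oddM !oddb; case: (eqVneq a (f ord0)) => [af|a0]; last first.
    by rewrite /epar M0N // addbb.
  rewrite [epar M0 J b]/epar M0J ?addbb ?andbF //; apply/codomP => -[b' bE].
  by have := fI ord0 (lift ord0 b') isT; rewrite -/(f' b') -bE -af ltnNge ltnW.
rewrite mul1r ffunE /= ifT; last by apply/forall_inP => b bf; rewrite M0N.
rewrite -signr_odd iter_upar M0f.
have -> : odd (\sum_(a < k) epar M0 J a) =
    \big[addb/false]_(a < j) (p (I (f' a)) (+) p (J (f' a))).
  rewrite odd_sum (bigID [in codom f']) /= [X in _ (+) X]big1 ?addbF; last first.
    by move=> c cf; rewrite oddb /epar M0J // addbb.
  rewrite -big_uniq /=; last by rewrite codomE map_inj_uniq ?enum_uniq.
  rewrite codomE big_map big_enum /=; apply: eq_bigr => a _.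
  by rewrite oddb /epar M0N.
have -> : \prod_(a < j) T (M0 (f' a)) (J (f' a)) = \prod_(a < j) T (I (f' a)) (J (f' a)).
  by apply: eq_bigr => a _; rewrite M0N.
have -> : tsign f' M0 J = tsign f' I J.
  have E a : p (M0 (f' a)) = p (I (f' a)) by rewrite M0N.
  congr (_ (+) _); first by apply: eq_bigr => a _; rewrite E.
  by apply: eq_bigr => a _; apply: eq_bigr => b _; rewrite !E.
set S := \big[addb/false]_(a < j) _; set z := p (I (f ord0)) (+) p (J (f ord0)).
have -> : tsign f I J =
    (S && z) (+) (p (I (f ord0)) && p (J (f ord0)) (+) p (J (f ord0))) (+) tsign f' I J.
  rewrite /tsign !big_ord_recl /= [X in _ (+) (X (+) _)]big_pred0 //.
  have -> : \big[addb/false]_(a < j) \big[addb/false]_(b < j.+1 | (b < lift ord0 a)%N)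
      ((p (I (f (lift ord0 a))) (+) p (J (f (lift ord0 a)))) &&
       (p (I (f b)) (+) p (J (f b)))) =
      (S && z) (+) \big[addb/false]_(a < j) \big[addb/false]_(b < j | (b < a)%N)
      ((p (I (f' a)) (+) p (J (f' a))) && (p (I (f' b)) (+) p (J (f' b)))).
    rewrite big_distrl -big_split /=; apply: eq_bigr => a _.
    rewrite big_mkcond big_ord_recl /=; congr (_ (+) _).
    rewrite [RHS]big_mkcond; apply: eq_bigr => b _.
    by rewrite -[(bump 0 b < bump 0 a)%N]/(lift ord0 b < lift ord0 a)%N ltn_lift.
  set A := \big[addb/false]_(_ < _) _; set A' := \big[addb/false]_(_ < _) _.
  by case: (S && z); case: (p (I _)); case: (p (J _)); case: A; case: A'.
rewrite big_ord_recl oddD oddM !oddb; move: (tsign f' I J) => t.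
rewrite !signr_addb !mulrA; congr (_ * _).
by rewrite -!mulrA; congr (_ * (_ * (_ * _))); apply: commr_sign.
Qed.

Lemma TprodE k (I J : multi k) : Tprod T k (I, J) =
  (-1) ^+ tsign id I J * \prod_(a < k) T (I a) (J a).
Proof.
have -> : Tprod T k = Tbig id by [].
rewrite TbigE // ifT //; apply/forall_inP => c /negP[].
by apply/codomP; exists c.
Qed.

Let str_perm k (s : 'S_k) : str (tens_mul (@Pperm m n F L k s) (Tprod T k)) =
  \sum_(I : multi k) (-1) ^+ (permsgn p false s (fun a => I (s a)) (+)
     bzsign p (fun a => I (s a)) I false) * \prod_(a < k) T (I (s a)) (I a).
Proof.
apply: eq_bigr => I _; pose M : multi k := [ffun a => I (s a)].
have upar1 r (b : nat) : iter r (@upar F L) ((-1) ^+ b) = (-1) ^+ b.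
  have [_ _ uZ u1] := upar_hom L; rewrite -[b in LHS]/b -signr_odd.
  elim: r => [|r IH] //=; rewrite IH -[X in upar X]mulr1 upar_sign u1 mulr1 //.
rewrite ffunE /= (bigD1 M) //= [X in _ + X]big1 ?addr0; last first.
  move=> M' M'M; rewrite ffunE /= ifN ?upar0 ?mulr0 ?mul0r //.
  apply: contraNN M'M => /forallP H; apply/eqP/ffunP => a; rewrite ffunE.
  by apply/esym/eqP/H.
rewrite [@Pperm m n F L k s _]ffunE /= ifT; last by apply/forallP => a; rewrite ffunE.
rewrite upar1 TprodE.
have -> : \prod_(a < k) T (M a) (I a) = \prod_(a < k) T (I (s a)) (I a).
  by apply: eq_bigr => a _; rewrite ffunE.
rewrite -signr_odd -[(-1) ^+ ksign _ _]signr_odd -[(-1) ^+ (inv_sign _ _ + _)]signr_odd.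
rewrite !mulrA -!signr_addb; congr ((-1) ^+ nat_of_bool _ * _).
rewrite oddD /ksign /inv_sign !odd_sum.
(* All signs are now linear in the parities [x] and [y] or quadratic of the form [Qd], apart from
   [permsgn], which occurs on both sides. They match by [QdC], as [x] and [y] have the same total
   parity. *)
pose x a := p (I a); pose y a := p (I (s a)).
pose Qd (f g : 'I_k -> bool) :=
  \big[addb/false]_(a < k) \big[addb/false]_(b < k | (b < a)%N) (f a && g b).
have QdDl f f' g : Qd (fun a => f a (+) f' a) g = Qd f g (+) Qd f' g.
  rewrite -big_split; apply: eq_bigr => a _; rewrite -big_split.
  by apply: eq_bigr => b _; rewrite andb_addl.
have QdDr f g g' : Qd f (fun a => g a (+) g' a) = Qd f g (+) Qd f g'.
  rewrite -big_split; apply: eq_bigr => a _; rewrite -big_split.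
  by apply: eq_bigr => b _; rewrite andb_addr.
have QdE (f g : 'I_k -> bool) :
    \big[addb/false]_(a < k) odd (\sum_(b < k | (b < a)%N) f a * g b) = Qd f g.
  apply: eq_bigr => a _; rewrite odd_sum; apply: eq_bigr => b _.
  by rewrite oddM !oddb.
have QdC f g : Qd f g (+) Qd g f (+) \big[addb/false]_a (f a && g a) =
    (\big[addb/false]_a f a) && (\big[addb/false]_a g a).
  have -> : Qd g f = \big[addb/false]_(a < k) \big[addb/false]_(b < k | (a < b)%N) (f a && g b).
    rewrite /Qd (exchange_big_dep xpredT) //=; apply: eq_bigr => a _.
    by apply: eq_bigr => b _; rewrite andbC.
  rewrite -!big_split big_distrl /=; apply: eq_bigr => a _.
  rewrite big_distrr /= [RHS](bigD1 a) //= [RHS]addbC; congr (_ (+) _).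
  rewrite [RHS](bigID (fun b : 'I_k => (b < a)%N)) /=; congr (_ (+) _).
    by apply: eq_bigl => b; rewrite -val_eqE; case: ltngtP.
  by apply: eq_bigl => b; rewrite -val_eqE; case: ltngtP.
rewrite !QdE.
have -> : epar I M = (fun a => x a (+) y a) by apply/funext => a; rewrite /epar ffunE.
have -> : epar M I = (fun a => x a (+) y a).
  by apply/funext => a; rewrite /epar ffunE addbC.
have -> : (fun b => p (M b) : bool) = y by apply/funext => a; rewrite ffunE.
have -> : \big[addb/false]_i odd (p (I i)) = \big[addb/false]_i x i.
  by apply: eq_bigr => a _; rewrite oddb.
have -> : \big[addb/false]_(a < k)
    odd (\sum_(b < k | (a < b)%N && (s b < s a)%N) p (M a) * p (M b)) =
    permsgn p false s (fun a => I (s a)).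
  apply: eq_bigr => a _; rewrite odd_sum; apply: eq_bigr => b _.
  by rewrite oddM !oddb !ffunE.
have -> : tsign id M I = \big[addb/false]_a (x a && y a) (+) \big[addb/false]_a x a
    (+) Qd (fun a => x a (+) y a) (fun a => x a (+) y a).
  rewrite /tsign big_split /=; congr (_ (+) _ (+) _).
    by apply: eq_bigr => a _; rewrite ffunE andbC.
  by apply: eq_bigr => a _; apply: eq_bigr => b _; rewrite !ffunE !(addbC (p (I (s _)))).
have -> : bzsign p (fun a => I (s a)) I false =
    \big[addb/false]_a y a (+) Qd y (fun a => x a (+) y a).
  rewrite -big_split; apply: eq_bigr => a _.
  rewrite /= -/(y a); set S := \big[addb/false]_(_ < _ | _) _.
  have -> : \big[addb/false]_(b < k | (b < a)%N) (y a && (x b (+) y b)) = y a && S.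
    by rewrite big_distrr /=; apply: eq_bigr => b _; rewrite addbC.
  by case: (y a); case: S.
have xy : \big[addb/false]_a x a = \big[addb/false]_a y a.
  by rewrite (reindex_inj (@perm_inj _ s)).
have := QdC x y; rewrite -xy andbb !QdDr !QdDl.
set X := \big[addb/false]_a x a; set Z := \big[addb/false]_a (x a && y a).
case: X; case: Z; case: (permsgn _ _ _ _); case: (Qd x x); case: (Qd y y);
  by case: (Qd x y); case: (Qd y x).
Qed.

Lemma tens_mul_sum (I : finType) k (c : I -> F) (X : I -> tens k) (Y : tens k) (d : F) :
  tens_mul (d *: \sum_i c i *: X i) Y = d *: \sum_i c i *: tens_mul (X i) Y.
Proof.
have [uD _ uZ _] := upar_hom L.
have iD r (x y : U) : iter r (@upar F L) (x + y) = iter r (@upar F L) x + iter r (@upar F L) y.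
  by elim: r => //= r ->; rewrite uD.
have iZ r a (x : U) : iter r (@upar F L) (a *: x) = a *: iter r (@upar F L) x.
  by elim: r => //= r ->; rewrite uZ.
have i_sum r (f : I -> U) : iter r (@upar F L) (\sum_i f i) = \sum_i iter r (@upar F L) (f i).
  exact: (big_morph _ (iD r) (upar0 r)).
apply/ffunP => IJ; rewrite !ffunE sum_ffunE scaler_sumr.
under eq_bigr => M _ do rewrite sum_ffunE i_sum mulr_sumr mulr_suml.
rewrite scaler_sumr exchange_big; apply: eq_bigr => i _ /=.
rewrite !ffunE /= !scaler_sumr; apply: eq_bigr => M _.
by rewrite !ffunE !iZ -!scalerAr -!scalerAl.
Qed.

Lemma str_sum (I : finType) k (c : I -> F) (X : I -> tens k) (d : F) :
  str (d *: \sum_i c i *: X i) = d *: \sum_i c i *: str (X i).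
Proof.
rewrite /str scaler_sumr; under eq_bigr => J _ do rewrite sum_ffunE mulr_sumr.
rewrite exchange_big scaler_sumr; apply: eq_bigr => i _ /=; rewrite !scaler_sumr.
by apply: eq_bigr => J _; rewrite !ffunE -!scalerAr.
Qed.

Lemma str_Asym k : str (tens_mul (Asym k) (Tprod T k)) =
  (k`!%:R : F)^-1 *: zsum p T true k.
Proof.
rewrite tens_mul_sum str_sum; congr (_ *: _).
under eq_bigr => s _ do rewrite str_perm scaler_sumr.
rewrite exchange_big; apply: eq_bigr => I _; apply: eq_bigr => s _ /=.
have -> : permsgn p true s (fun a => I (s a)) = odd_perm s (+) permsgn p false s (fun a => I (s a)) by [].
rewrite -[in RHS]addbA; move: (_ (+) bzsign _ _ _ _) => b.
by case: (odd_perm s); rewrite ?scale1r ?scaleN1r //= signrN mulNr.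
Qed.

Lemma str_Hsym k : str (tens_mul (Hsym k) (Tprod T k)) =
  (k`!%:R : F)^-1 *: zsum p T false k.
Proof.
have -> : @Hsym m n F L k = (k`!%:R : F)^-1 *: \sum_s 1 *: Pperm m n L s.
  by congr (_ *: _); apply: eq_bigr => s _; rewrite scale1r.
rewrite tens_mul_sum str_sum; congr (_ *: _).
under eq_bigr => s _ do rewrite str_perm scale1r.
by rewrite exchange_big.
Qed.

End TensorTrace.

(** * Action of the current algebra on traces of powers *)

Section VacuumComputation.
Variables (A : nzRingType) (M : lmodType A) (v0 : M) (N : nat) (p : 'I_N -> bool).
Variables (T : 'M[A]_N) (E0 E1 : 'I_N -> 'I_N -> A) (K L0 L1 : A).
Hypothesis reg2 : forall x : A, x *+ 2 = 0 -> x = 0.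
Hypothesis TM : super_manin p T.
Local Notation sg b := ((-1) ^+ nat_of_bool b).
Let sdim : A := \sum_x sg (p x).

Hypothesis hE0 : forall i j k l, E0 i j * T k l =
  sg ((p i (+) p j) && (p k (+) p l)) * (T k l * E0 i j)
  + (k == j)%:R * (sg (p i (+) p j) * T i l)
  - (i == l)%:R * (sg ((p i (+) p j) && (p k (+) p i)) * T k j).
Hypothesis hE1 : forall i j k l, E1 i j * T k l =
  sg ((p i (+) p j) && (p k (+) p l)) * (T k l * E1 i j)
  + (k == l)%:R * E0 i j
  + (k == j)%:R * (sg (p k) * E0 i l)
  - (i == l)%:R * (sg (p k (+) ((p i (+) p j) && (p k (+) p i))) * E0 k j)
  - (i == l)%:R * ((k == j)%:R * (sg (p k (+) p i) * sdim)) * K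
  + (k == l)%:R * ((i == j)%:R * sg (p i)) * K.
Hypothesis hK : forall k l, K * T k l = T k l * K.
Hypothesis hL1 : forall k l, L1 * T k l = T k l * L1 + sg (p k) * E0 k l + (k == l)%:R * (L0 *+ 2).
Hypothesis hL0 : forall k l, L0 * T k l = T k l * L0 + T k l.
Hypotheses (E0v : forall i j, E0 i j *: v0 = 0) (E1v : forall i j, E1 i j *: v0 = 0).
Hypotheses (Kv : K *: v0 = v0) (L0v : L0 *: v0 = 0) (L1v : L1 *: v0 = 0).

Let sum_delta (V : lmodType A) (i : 'I_N) (f : 'I_N -> V) :
  \sum_a (a == i)%:R *: f a = f i.
Proof.
rewrite (bigD1 i) //= eqxx scale1r big1 ?addr0 // => a /negbTE ->.
by rewrite scale0r.
Qed.

Let sum_delta' (V : lmodType A) (i : 'I_N) (f : 'I_N -> V) :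
  \sum_a (i == a)%:R *: f a = f i.
Proof. by rewrite -[RHS]sum_delta; apply: eq_bigr => a _; rewrite eq_sym. Qed.

Let natC (b : bool) (x : A) : x * b%:R = b%:R * x.
Proof. by case: b; rewrite ?mulr1 ?mul1r ?mulr0 ?mul0r. Qed.

Let sgC (b : bool) (x : A) : x * sg b = sg b * x.
Proof. exact: commr_sign. Qed.

Let Tv s k l : M := (T ^+ s) k l *: v0.

Let TvS s k l : Tv s.+1 k l = \sum_a T k a *: Tv s a l.
Proof.
rewrite /Tv exprS mxE scaler_suml; apply: eq_bigr => a _.
by rewrite -scalerA.
Qed.

Let Tv0 k l : Tv 0 k l = (k == l)%:R *: v0.
Proof. by rewrite /Tv expr0 mxE. Qed.

Let natsC (b : bool) (x : A) (v : M) : x *: (b%:R *: v) = b%:R *: (x *: v).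
Proof. by rewrite !scalerA natC. Qed.

Let sgsC (b : bool) (x : A) (v : M) : x *: (sg b *: v) = sg b *: (x *: v).
Proof. by rewrite !scalerA sgC. Qed.

Let sgsgK (b c : bool) (v : M) : sg b *: (sg c *: v) = sg (b (+) c) *: v.
Proof. by rewrite scalerA signr_addb. Qed.

(** Powers of [T] transform under gl as [T] does: the terms [X1] and [X4], coming from adjacent
    factors, cancel. *)
Lemma E0_power i j s k l : E0 i j *: Tv s k l =
  (k == j)%:R *: (sg (p i (+) p j) *: Tv s i l)
  - (i == l)%:R *: (sg ((p i (+) p j) && (p k (+) p i)) *: Tv s k j).
Proof.
elim: s k => [|s IH] k.
  rewrite !Tv0 natsC E0v scaler0; apply/esym/eqP; rewrite subr_eq0; apply/eqP.
  case: (eqVneq k j) => [->|_]; last by rewrite !scale0r !scaler0.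
  by rewrite !scale1r natsC [p j (+) p i]addbC andbb.
rewrite !TvS scaler_sumr.
pose X1 a := (a == j)%:R *: (sg ((p i (+) p j) && (p k (+) p a) (+) (p i (+) p j)) *: (T k a *: Tv s i l)).
pose X2 a := (i == l)%:R *: (sg ((p i (+) p j) && (p k (+) p i)) *: (T k a *: Tv s a j)).
pose X3 a := (k == j)%:R *: (sg (p i (+) p j) *: (T i a *: Tv s a l)).
pose X4 a := (i == a)%:R *: (sg ((p i (+) p j) && (p k (+) p i)) *: (T k j *: Tv s a l)).
have E a : E0 i j *: (T k a *: Tv s a l) = X1 a - X2 a + X3 a - X4 a.
  rewrite scalerA hE0 scalerBl scalerDl -!scalerA IH scalerBr scalerBr.
  congr (_ - _ + _ - _).
    by rewrite !natsC sgsC sgsgK.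
  rewrite !natsC sgsC sgsgK; congr (_ *: (sg _ *: _)).
  by case: (p i); case: (p j); case: (p k); case: (p a).
under eq_bigr => a _ do rewrite E.
rewrite sumrB big_split /= sumrB /X1 /X2 /X3 /X4 sum_delta sum_delta' -!scaler_sumr.
have -> : (p i (+) p j) && (p k (+) p j) (+) (p i (+) p j) = (p i (+) p j) && (p k (+) p i).
  by case: (p i); case: (p j); case: (p k).
by rewrite addrAC [X in X + _]addrAC subrr add0r addrC.
Qed.

Let pT s : A := \sum_x sg (p x) * (T ^+ s) x x.

Let pTv s : pT s *: v0 = \sum_x sg (p x) *: Tv s x x.
Proof. by rewrite scaler_suml; apply: eq_bigr => x _; rewrite -scalerA. Qed.

Let KTv s k l : K *: Tv s k l = Tv s k l.
Proof.
elim: s k => [|s IH] k; first by rewrite Tv0 natsC Kv.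
by rewrite TvS scaler_sumr; apply: eq_bigr => a _; rewrite scalerA hK -scalerA IH.
Qed.

Let L0Tv s k l : L0 *: Tv s k l = Tv s k l *+ s.
Proof.
elim: s k => [|s IH] k; first by rewrite Tv0 natsC L0v scaler0.
rewrite TvS scaler_sumr -sumrMnl; apply: eq_bigr => a _.
by rewrite scalerA hL0 scalerDl -scalerA IH mulrSr -scalerMnr.
Qed.

Lemma E0_pT i j s : E0 i j *: (pT s *: v0) = 0.
Proof.
rewrite pTv scaler_sumr.
under eq_bigr => x _ do rewrite sgsC E0_power scalerBr natsC [X in _ - X]natsC.
rewrite sumrB !(sum_delta, sum_delta') !sgsgK; apply/eqP; rewrite subr_eq0; apply/eqP.
by congr (sg _ *: _); case: (p i); case: (p j).
Qed.

(** The contraction over [y] produces the superdimension, which the critical level has to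
    compensate. *)
Let E0_row i s z :
  \sum_y E0 i y *: Tv s y z = sg (p i) *: (sdim *: Tv s i z - (i == z)%:R *: (pT s *: v0)).
Proof.
under eq_bigr => y _ do rewrite E0_power eqxx scale1r [p y (+) p i]addbC andbb.
rewrite sumrB -scaler_sumr -scaler_suml scalerBr pTv.
have -> : \sum_y sg (p i (+) p y) = sg (p i) * sdim.
  by rewrite mulr_sumr; apply: eq_bigr => y _; rewrite signr_addb.
rewrite -scalerA natsC; congr (_ - _ *: _).
by rewrite scaler_sumr; apply: eq_bigr => y _; rewrite sgsgK.
Qed.

Let unroll (D : A) (h : bool) (W : 'I_N -> 'I_N -> A) :
    (forall k l, D * T k l = sg (h && (p k (+) p l)) * (T k l * D) + W k l) ->
    D *: v0 = 0 ->
  forall s x z, D *: Tv s x z = \sum_(a < s) \sum_y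
    sg (h && (p x (+) p y)) *: ((T ^+ a) x y *: \sum_b W y b *: Tv (s.-1 - a) b z).
Proof.
move=> DT Dv s x z; elim: s x => [|s IH] x; first by rewrite Tv0 natsC Dv scaler0 big_ord0.
rewrite TvS scaler_sumr.
under eq_bigr => b _ do rewrite scalerA DT scalerDl -!scalerA IH.
rewrite big_split /= addrC big_ord_recl; congr (_ + _).
  rewrite [RHS](bigD1 x) //= addbb andbF scale1r expr0 mxE eqxx scale1r subn0.
  rewrite [X in _ = _ + X]big1 ?addr0 // => y yx.
  by rewrite mxE eq_sym (negbTE yx) scale0r scaler0.
under eq_bigr => b _ do rewrite !scaler_sumr.
rewrite exchange_big; apply: eq_bigr => a _ /=.
under eq_bigr => b _ do rewrite !scaler_sumr.
rewrite exchange_big; apply: eq_bigr => y _ /=.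
rewrite -predn_sub subnS.
rewrite exprS mxE scaler_suml scaler_sumr; apply: eq_bigr => b _.
rewrite sgsC sgsgK -scalerA; congr (sg _ *: (_ *: (_ *: _))).
by case: (h); case: (p x); case: (p b); case: (p y).
Qed.

Let sdimsC (x : A) (v : M) : x *: (sdim *: v) = sdim *: (x *: v).
Proof.
by rewrite !scaler_suml scaler_sumr; apply: eq_bigr => y _; rewrite sgsC.
Qed.

Let TvM a b k l : \sum_y (T ^+ a) k y *: Tv b y l = Tv (a + b) k l.
Proof.
rewrite /Tv exprD mxE scaler_suml; apply: eq_bigr => y _.
by rewrite -scalerA.
Qed.

Lemma L1_pT s : L1 *: (pT s *: v0) = \sum_(a < s)
  (sdim *: (pT s.-1 *: v0) + (pT s.-1 *: v0) *+ (2 * (s.-1 - a))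
   - pT a *: (pT (s.-1 - a) *: v0)).
Proof.
pose W k l := sg (p k) * E0 k l + (k == l)%:R * (L0 *+ 2).
have W_T k l : L1 * T k l = sg (false && (p k (+) p l)) * (T k l * L1) + W k l.
  by rewrite mul1r hL1 addrA.
have WE r y z : \sum_b W y b *: Tv r b z =
    sdim *: Tv r y z - (y == z)%:R *: (pT r *: v0) + Tv r y z *+ (2 * r).
  under eq_bigr => b _ do rewrite scalerDl -!scalerA.
  rewrite big_split /= -scaler_sumr E0_row sgsgK addbb scale1r sum_delta'; congr (_ + _).
  have -> : (L0 *+ 2) *: Tv r y z = (L0 *: Tv r y z) *+ 2 by rewrite scalerMnl.
  by rewrite L0Tv -mulrnA mulnC.
rewrite pTv scaler_sumr.
under eq_bigr => x _ do rewrite sgsC. under eq_bigr => x _ do rewrite (unroll W_T L1v) scaler_sumr.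
rewrite exchange_big; apply: eq_bigr => a _ /=.
have as1 : (a + (s.-1 - a) = s.-1)%N by rewrite subnKC // -ltnS (ltn_predK (ltn_ord a)).
under eq_bigr => x _ do under eq_bigr => y _ do rewrite scale1r WE scalerDr scalerBr.
have xE x : \sum_y ((T ^+ a) x y *: (sdim *: Tv (s.-1 - a) y x)
      - (T ^+ a) x y *: ((y == x)%:R *: (pT (s.-1 - a) *: v0))
      + (T ^+ a) x y *: (Tv (s.-1 - a) y x *+ (2 * (s.-1 - a)))) =
    sdim *: Tv s.-1 x x - (T ^+ a) x x *: (pT (s.-1 - a) *: v0)
    + Tv s.-1 x x *+ (2 * (s.-1 - a)).
  rewrite big_split sumrB /=; congr (_ - _ + _).
  - by under eq_bigr => y _ do rewrite sdimsC; rewrite -scaler_sumr TvM as1.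
  - by under eq_bigr => y _ do rewrite natsC; rewrite sum_delta.
  - by under eq_bigr => y _ do rewrite -scalerMnr; rewrite sumrMnl TvM as1.
under eq_bigr => x _ do rewrite xE scalerDr scalerBr sdimsC -scalerMnr.
rewrite big_split sumrB /= -scaler_sumr sumrMnl -pTv addrAC; congr (_ + _ - _).
by rewrite [RHS]scaler_suml; apply: eq_bigr => x _; rewrite -[RHS]scalerA.
Qed.

Lemma E1_pT i j s : E1 i j *: (pT s *: v0) = 0.
Proof.
pose h := p i (+) p j.
pose W k l := (k == l)%:R * E0 i j
  + (k == j)%:R * (sg (p k) * E0 i l)
  - (i == l)%:R * (sg (p k (+) (h && (p k (+) p i))) * E0 k j)
  - (i == l)%:R * ((k == j)%:R * (sg (p k (+) p i) * sdim)) * K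
  + (k == l)%:R * ((i == j)%:R * sg (p i)) * K.
have W_T k l : E1 i j * T k l = sg (h && (p k (+) p l)) * (T k l * E1 i j) + W k l.
  by rewrite hE1 !addrA.
(* The level enters here. As [K] acts as 1, its two terms cancel the superdimension coming from
   [E0_row] and the term in which [i] equals [j] coming from [E0_power]. *)
have WE r y z : \sum_b W y b *: Tv r b z =
    (y == j)%:R *: (sg h *: (Tv r i z - (i == z)%:R *: (pT r *: v0)))
    + (y == z)%:R *: (sg (p i) *: Tv r i j)
    - (i == z)%:R *: (sg (h && (p y (+) p i)) *: Tv r y j).
  under eq_bigr => b _ do rewrite !(scalerDl, scalerBl) -!scalerA KTv.
  rewrite !(big_split, sumrB) /= !sum_delta' -!scaler_sumr E0_row !E0_power.
  rewrite (_ : \sum_b - ((i == b)%:R * (sg (p y (+) h && (p y (+) p i)) * E0 y j)) *: Tv r b z =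
      - ((i == j)%:R *: (sg (p i) *: Tv r y z) - (y == z)%:R *: (sg (p i) *: Tv r i j))); last first.
    under eq_bigr => b _ do rewrite scaleNr -!scalerA.
    rewrite sumrN sum_delta' E0_power scalerBr natsC natsC !sgsgK.
    congr (- (_ - _)); last first.
      by congr (_ *: (sg _ *: _)); rewrite /h; case: (p y); case: (p i); case: (p j).
    rewrite /h; case: (eqVneq i j) => [->|]; last by rewrite !scale0r.
    by rewrite !scale1r addbb; case: (p y); case: (p j).
  rewrite (_ : \sum_b - ((i == b)%:R * ((y == j)%:R * (sg (p y (+) p i) * sdim)) * K) *: Tv r b z =
      - ((y == j)%:R *: (sg h *: (sdim *: Tv r i z)))); last first.
    under eq_bigr => b _ do rewrite scaleNr -!scalerA KTv.
    rewrite sumrN sum_delta'; congr (- _).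
    by rewrite /h; case: (eqVneq y j) => [->|]; rewrite ?scale0r // addbC.
  have -> : (y == j)%:R *: (sg (p y) *: (sg (p i) *:
        (sdim *: Tv r i z - (i == z)%:R *: (pT r *: v0)))) =
      (y == j)%:R *: (sg h *: (sdim *: Tv r i z)) - (y == j)%:R *: (sg h *: ((i == z)%:R *: (pT r *: v0))).
    rewrite sgsgK -!scalerBr /h; case: (eqVneq y j) => [->|]; last by rewrite !scale0r.
    by rewrite addbC.
  rewrite -/h !scalerBr.
  have abel (a b c d e f : M) : a - b + (c - d) - (e - f) - c + e = a - d + f - b.
    rewrite opprB addrAC -[_ + (f - e) + e]addrA subrK addrAC.
    by rewrite -[a - b + (c - d) - c]addrA [c - d - c]addrAC subrr sub0r [a - b - d]addrAC addrAC.
  by rewrite abel.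
rewrite pTv scaler_sumr.
under eq_bigr => x _ do rewrite sgsC (unroll W_T (E1v i j)) scaler_sumr.
rewrite exchange_big /=; case: s => [|s]; first by rewrite big_ord0.
pose g1 a := \sum_x sg (p x (+) p i (+) (p x && p j) (+) ((p x (+) p j) && p i)) *:
  ((T ^+ a) x j *: Tv (s - a) i x).
pose g2 a := sg (p i) *: ((T ^+ a) i j *: (pT (s - a) *: v0)).
pose g3 a := \sum_x sg (p x (+) p i) *: ((T ^+ a) x x *: Tv (s - a) i j).
pose g4 := sg (p i) *: Tv s i j.
have GE (a : 'I_s.+1) : \sum_x sg (p x) *: (\sum_y sg (h && (p x (+) p y)) *:
      ((T ^+ a) x y *: \sum_b W y b *: Tv (s - a) b x)) = g1 a - g2 a + g3 a - g4.
  have as1 : (a + (s - a) = s)%N by rewrite subnKC // -ltnS.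
  have xE x : \sum_y sg (h && (p x (+) p y)) *: ((T ^+ a) x y *: \sum_b W y b *: Tv (s - a) b x) =
      sg (h && (p x (+) p j) (+) h) *: ((T ^+ a) x j *: Tv (s - a) i x)
      - (i == x)%:R *: (sg (h && (p x (+) p j) (+) h) *: ((T ^+ a) x j *: (pT (s - a) *: v0)))
      + sg (p i) *: ((T ^+ a) x x *: Tv (s - a) i j)
      - (i == x)%:R *: Tv s x j.
    under eq_bigr => y _ do rewrite WE !(scalerDr, scalerN).
    rewrite !(big_split, sumrN) /=; congr (_ - _ + _ - _).
    - under eq_bigr => y _ do rewrite [X in sg _ *: X]natsC natsC.
      by rewrite sum_delta sgsC sgsgK.
    - under eq_bigr => y _ do rewrite [X in sg _ *: X]natsC natsC.
      by rewrite sum_delta sgsC sgsgK !natsC.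
    - under eq_bigr => y _ do rewrite [X in sg _ *: X]natsC natsC.
      by rewrite sum_delta addbb andbF scale1r sgsC.
    case: (eqVneq i x) => [->|_]; last first.
      by rewrite scale0r big1 // => y _; rewrite scale0r !scaler0.
    have -> : Tv s x j = \sum_y (T ^+ a) x y *: Tv (s - a) y j by rewrite TvM as1.
    rewrite scale1r; apply: eq_bigr => y _.
    by rewrite scale1r sgsC sgsgK [p y (+) p x]addbC addbb scale1r.
  under eq_bigr => x _ do rewrite xE !(scalerDr, scalerN).
  rewrite !(big_split, sumrN) /=; congr (_ - _ + _ - _).
  - apply: eq_bigr => x _; rewrite sgsgK; congr (sg _ *: _).
    by rewrite /h; case: (p x); case: (p i); case: (p j).
  - under eq_bigr => x _ do rewrite natsC.
    rewrite sum_delta' sgsgK /g2; congr (sg _ *: _).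
    by rewrite /h; case: (p i); case: (p j).
  - by apply: eq_bigr => x _; rewrite sgsgK.
  by under eq_bigr => x _ do rewrite natsC; rewrite sum_delta'.
rewrite (eq_bigr _ (fun a _ => GE a)) !(big_split, sumrN) /=.
(* What survives is, after replacing [a] by s - a in the second sum, a supertrace over the first
   tensor factor of the relation for powers of [T]. Only the sum over [a] is known to vanish. *)
have mE : \sum_(a < s.+1) \sum_x (sg (p x (+) p i) * mrel p (T ^+ a) (T ^+ (s - a)) x i x j) *: v0 = 0.
  rewrite exchange_big big1 // => x _; rewrite -scaler_suml -mulr_sumr.
  by rewrite super_manin_powers // mulr0 scale0r.
have ME (a : 'I_s.+1) : \sum_x (sg (p x (+) p i) * mrel p (T ^+ a) (T ^+ (s - a)) x i x j) *: v0 =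
    g1 a - g2 (s - a)%N + g3 a - g4.
  have as1 : (s - a + a = s)%N by rewrite subnK // -ltnS.
  have xE x : (sg (p x (+) p i) * mrel p (T ^+ a) (T ^+ (s - a)) x i x j) *: v0 =
     sg (p x (+) p i (+) (p x && p j) (+) ((p x (+) p j) && p i)) *: ((T ^+ a) x j *: Tv (s - a) i x)
     - sg (p i) *: ((T ^+ (s - a)) i j *: (sg (p x) *: Tv a x x))
     + sg (p x (+) p i) *: ((T ^+ a) x x *: Tv (s - a) i j)
     - sg (p i) *: ((T ^+ (s - a)) i x *: Tv a x j).
    rewrite /mrel addbb /= !mul1r.
    rewrite -scalerA !(scalerDl, scalerBl) -!scalerA !(scalerDl, scalerBl) -!scalerA.
    rewrite !scaleNr -!scalerA -/(Tv a x x) -/(Tv a x j) !(scalerDr, scalerN) !sgsgK.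
    rewrite [(T ^+ (s - a)) i j *: (sg _ *: _)]sgsC !sgsgK.
    have abel4 (b c d e : M) : d - c + (b - e) = b - c + d - e.
      by rewrite addrACA [d + b]addrC addrA [X in _ = X - e]addrAC.
    rewrite abel4; congr (sg _ *: _ - sg _ *: _ + _ - sg _ *: _).
    - by case: (p x); case: (p i); case: (p j).
    by case: (p x); case: (p i); case: (p j).
  rewrite (eq_bigr _ (fun x _ => xE x)) !(big_split, sumrN) /=; congr (_ - _ + _ - _).
    rewrite -!scaler_sumr /g2 -pTv; congr (_ *: (_ *: (pT _ *: _))).
    by rewrite subKn // -ltnS.
  by rewrite -scaler_sumr TvM as1.
rewrite -[RHS]mE (eq_bigr _ (fun a _ => ME a)) !(big_split, sumrN) /=.
congr (_ - _ + _ - _); rewrite (reindex_inj rev_ord_inj) /=.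
by apply: eq_bigr => a _; rewrite subSS.
Qed.

End VacuumComputation.

(** * Endomorphism algebras and derivations *)

Section UenvInduction.
Variables (F : fieldType) (L : superLie F).

Lemma Uenv_ind (P : Uenv L -> Prop) :
  (forall x, P (ugen x)) -> (forall c : F, P c%:A) ->
  (forall u v, P u -> P v -> P (u + v)) -> (forall u v, P u -> P v -> P (u * v)) ->
  forall u, P u.
Proof.
move=> Pg Pc PD PM; elim/quotW; elim=> [x|c|x Px y Py|x Px y Py].
- exact: Pg.
- by have := Pc c; rewrite -uscE.
- by have := PD _ _ Px Py; rewrite [_ + _]pi_uadd.
by have := PM _ _ Px Py; rewrite [_ * _]pi_umul.
Qed.

End UenvInduction.

Section LinearEndo.
Variables (F : fieldType) (V : lmodType F) (J : V -> Prop).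

Record lendo := Lendo {
  lendo_fun :> V -> V;
  lendo_add : forall x y, lendo_fun (x + y) = lendo_fun x + lendo_fun y;
  lendo_scale : forall c x, lendo_fun (c *: x) = c *: lendo_fun x;
  lendo_stable : forall x, J x -> J (lendo_fun x)
}.
End LinearEndo.

Section LinearEndoAlg.
Variables (F : fieldType) (V : lmodType F) (J : V -> Prop).
Variables (v0 : V) (v0_neq0 : v0 <> 0).
Hypotheses (J0 : J 0) (JD : forall x y, J x -> J y -> J (x + y)).
Hypothesis (JZ : forall c x, J x -> J (c *: x)).

Lemma lendoP (f g : lendo J) : (forall x, f x = g x) -> f = g.
Proof.
case: f g => [f f1 f2 f3] [g g1 g2 g3] /= fg; have E : f = g by apply/funext.
move: E f1 f2 f3 g1 g2 g3 => -> *; congr Lendo; exact: Prop_irrelevance.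
Qed.

(** The hypotheses are arguments of the type, so that the ring structure, which uses them for its
    operations and for 1 != 0, can be attached to it. *)
Definition lendoA (_ : v0 <> 0) (_ : J 0) (_ : forall x y, J x -> J y -> J (x + y))
  (_ : forall c x, J x -> J (c *: x)) := lendo J.
Local Notation E := (lendoA v0_neq0 J0 JD JZ).

HB.instance Definition _ := gen_eqMixin E.
HB.instance Definition _ := gen_choiceMixin E.

Local Obligation Tactic := idtac.
Program Definition le_zero : E := @Lendo F V J (fun _ => 0) _ _ _.
Next Obligation. by move=> * /=; rewrite addr0. Qed.
Next Obligation. by move=> * /=; rewrite scaler0. Qed.
Next Obligation. by move=> *; apply: J0. Qed.
Definition le_one : E := @Lendo F V J id (fun _ _ => erefl) (fun _ _ => erefl) (fun _ => id).
Program Definition le_add (f g : E) : E := @Lendo F V J (fun x => f x + g x) _ _ _.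
Next Obligation. by move=> * /=; rewrite !lendo_add addrACA. Qed.
Next Obligation. by move=> * /=; rewrite !lendo_scale scalerDr. Qed.
Next Obligation. by move=> f g x Jx; apply: JD; apply: lendo_stable. Qed.
Program Definition le_scale (c : F) (f : E) : E := @Lendo F V J (fun x => c *: f x) _ _ _.
Next Obligation. by move=> * /=; rewrite !lendo_add scalerDr. Qed.
Next Obligation. by move=> * /=; rewrite !lendo_scale !scalerA mulrC. Qed.
Next Obligation. by move=> c f x Jx; apply: JZ; apply: lendo_stable. Qed.
Definition le_opp (f : E) : E := le_scale (-1) f.
Program Definition le_mul (f g : E) : E := @Lendo F V J (fun x => f (g x)) _ _ _.
Next Obligation. by move=> * /=; rewrite !lendo_add. Qed.
Next Obligation. by move=> * /=; rewrite !lendo_scale. Qed.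
Next Obligation. by move=> f g x Jx; do 2! apply: lendo_stable. Qed.

Lemma le_addA : associative le_add.
Proof. by move=> f g h; apply: lendoP => x /=; rewrite addrA. Qed.
Lemma le_addC : commutative le_add.
Proof. by move=> f g; apply: lendoP => x /=; rewrite addrC. Qed.
Lemma le_add0 : left_id le_zero le_add.
Proof. by move=> f; apply: lendoP => x /=; rewrite add0r. Qed.
Lemma le_addN : left_inverse le_zero le_opp le_add.
Proof. by move=> f; apply: lendoP => x /=; rewrite scaleN1r addNr. Qed.
HB.instance Definition _ := GRing.isZmodule.Build E le_addA le_addC le_add0 le_addN.

Lemma le_mulA : associative le_mul. Proof. by move=> f g h; apply: lendoP. Qed.
Lemma le_mul1l : left_id le_one le_mul. Proof. by move=> f; apply: lendoP. Qed.
Lemma le_mul1r : right_id le_one le_mul. Proof. by move=> f; apply: lendoP. Qed.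
Lemma le_mulDl : left_distributive le_mul le_add. Proof. by move=> f g h; apply: lendoP. Qed.
Lemma le_mulDr : right_distributive le_mul le_add.
Proof. by move=> f g h; apply: lendoP => x /=; rewrite lendo_add. Qed.
Lemma le_1neq0 : le_one != 0 :> E.
Proof. by apply/eqP => /(congr1 (fun f : E => f v0)) /= /v0_neq0. Qed.
HB.instance Definition _ := GRing.Zmodule_isNzRing.Build E
  le_mulA le_mul1l le_mul1r le_mulDl le_mulDr le_1neq0.

Lemma le_scaleA a b (f : E) : le_scale a (le_scale b f) = le_scale (a * b) f.
Proof. by apply: lendoP => x /=; rewrite scalerA. Qed.
Lemma le_scale1 : left_id 1 le_scale.
Proof. by move=> f; apply: lendoP => x /=; rewrite scale1r. Qed.
Lemma le_scaleDr : right_distributive le_scale +%R.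
Proof. by move=> a f g; apply: lendoP => x /=; rewrite scalerDr. Qed.
Lemma le_scaleDl (f : E) : {morph le_scale^~ f : a b / a + b}.
Proof. by move=> a b; apply: lendoP => x /=; rewrite scalerDl. Qed.
HB.instance Definition _ := GRing.Zmodule_isLmodule.Build F E
  le_scaleA le_scale1 le_scaleDr le_scaleDl.

Lemma le_scaleAl (a : F) (f g : E) : a *: (f * g) = (a *: f) * g.
Proof. exact: lendoP. Qed.
HB.instance Definition _ := GRing.Lmodule_isLalgebra.Build F E le_scaleAl.
Lemma le_scaleAr (a : F) (f g : E) : a *: (f * g) = f * (a *: g).
Proof. by apply: lendoP => x /=; rewrite lendo_scale. Qed.
HB.instance Definition _ := GRing.Lalgebra_isAlgebra.Build F E le_scaleAr.

Lemma lendoDE (f g : E) x : (f + g) x = f x + g x. Proof. by []. Qed.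
Lemma lendoME (f g : E) x : (f * g) x = f (g x). Proof. by []. Qed.
Lemma lendoZE c (f : E) x : (c *: f) x = c *: f x. Proof. by []. Qed.
Lemma lendo1E x : (1 : E) x = x. Proof. by []. Qed.

End LinearEndoAlg.

(** * Derivations of the affine algebra induced by vector fields in t *)

Section Derivation.
Variables (F : fieldType) (m n : nat).
Local Notation L := (aff F m n).
Local Notation U := (Uenv L).
Local Notation e_ := (@e_ F m n).
Local Notation K' := (@K' F m n).

Definition der_gen (s : int) (x : L) : U :=
  if x is Aff_e i j r then - r%:~R *: e_ i j (r + s) else 0.

Lemma der_genP s (x y : L) :
  der_gen s x * ugen y + ugen x * der_gen s y =
  (-1) ^+ (sl_par x && sl_par y) *: (der_gen s y * ugen x + ugen y * der_gen s x)
  + \sum_(q <- sl_br x y) q.1 *: der_gen s q.2.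
Proof.
case: x y => [i j r|] [k l t|] /=; last 3 first.
- rewrite andbF mulr0 mul0r !addr0 add0r big_nil scale1r ?addr0 -scalerAl -scalerAr.
  by rewrite [ugen (L := L) (Aff_e _ _ _) * _]ugen_br /= andbF big_nil addr0 scale1r.
- rewrite mul0r mulr0 big_nil !addr0 add0r scale1r -scalerAr -scalerAl.
  by rewrite [ugen (L := L) (Aff_K _ _) * _]ugen_br /= big_nil addr0 scale1r.
- by rewrite !(mul0r, mulr0) addr0 scaler0 big_nil addr0.
set sg := (-1) ^+ _.
have E1 := @ugen_br F L (Aff_e i j (r + s)) (Aff_e k l t).
have E2 := @ugen_br F L (Aff_e i j r) (Aff_e k l (t + s)).
rewrite /e_ -!scalerAl -!scalerAr {}E1 {}E2 /= -/sg !scalerDr.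
rewrite addrACA; congr (_ + _).
  by rewrite addrC; congr (_ + _); rewrite !scalerA mulrC.
rewrite !big_cons !big_nil /= scaler0 !addr0.
rewrite !scalerDr addrACA.
have -> : r + s + t = r + t + s by rewrite addrAC.
have -> : r + (t + s) = r + t + s by rewrite addrA.
set c := _ + _ * (-1) ^+ _.
have -> : (r + s == - t) = (r + t + s == 0) by rewrite -addr_eq0 addrAC.
have -> : (r == - (t + s)) = (r + t + s == 0) by rewrite -addr_eq0 addrA.
rewrite [X in _ + X]addrACA !scalerA -!scalerDl.
(* Invariance of the cocycle: both terms are supported on r + s + t = 0, where they cancel. *)
have -> : - r%:~R * (c * (r + s)%:~R * (r + t + s == 0)%:R)
    + - t%:~R * (c * r%:~R * (r + t + s == 0)%:R) = 0 :> F.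
  case: eqP => [E|_]; last by rewrite !mulr0 addr0.
  have -> : t = - (r + s) by apply/eqP; rewrite -addr_eq0 addrC addrAC E.
  by rewrite rmorphN /=; ring.
rewrite scale0r addr0; congr (_ *: _ + _ *: _); rewrite rmorphD /=; ring.
Qed.

Definition pairJ (_ : U * U) : Prop := True.
Let one_neq0 : ((1, 0) : U * U) <> 0.
Proof. by case=> /eqP; rewrite oner_eq0. Qed.
Local Notation E2 := (lendoA one_neq0 (J := pairJ) I (fun _ _ _ _ => I) (fun _ _ _ => I)).

Local Obligation Tactic := idtac.
(** A derivation is a homomorphism into triangular 2 x 2 matrices with the element itself on the
    diagonal. The universal property then produces it from its values on generators. *)
Program Definition der_op (s : int) (x : L) : E2 :=
  @Lendo F _ pairJ (fun w : U * U => (ugen x * w.1, ugen x * w.2 + der_gen s x * w.1)) _ _ _.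
Next Obligation.
by move=> s x [a b] [a' b'] /=; congr (_, _); rewrite /= !mulrDr // addrACA.
Qed.
Next Obligation.
by move=> s x c [a b] /=; congr (_, _); rewrite /= -!scalerAr // -scalerDr.
Qed.
Next Obligation. by []. Qed.

Lemma der_opP s (x y : L) : der_op s x * der_op s y =
  (-1) ^+ (sl_par x && sl_par y) *: (der_op s y * der_op s x)
  + \sum_(q <- sl_br x y) q.1 *: der_op s q.2.
Proof.
apply: lendoP => -[a b].
have sumE (r : seq (F * L)) : (\sum_(q <- r) q.1 *: der_op s q.2 : E2) (a, b) =
    ((\sum_(q <- r) q.1 *: ugen q.2) * a,
     (\sum_(q <- r) q.1 *: ugen q.2) * b + (\sum_(q <- r) q.1 *: der_gen s q.2) * a).
  elim: r => [|q r IH]; first by rewrite !big_nil !mul0r addr0.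
  rewrite !big_cons lendoDE IH lendoZE /=; congr (_, _).
    by rewrite mulrDl -scalerAl.
  by rewrite /= !mulrDl scalerDr -!scalerAl addrACA.
rewrite lendoDE sumE lendoZE !lendoME /=; congr (_, _) => /=.
  by rewrite !mulrA scalerAl -mulrDl -ugen_br.
rewrite mulrDr -addrA !mulrA -mulrDl [ugen x * der_gen s y + _]addrC der_genP.
rewrite [ugen x * ugen y]ugen_br !mulrDl addrACA; congr (_ + _).
rewrite -!scalerAl -!scalerDr; congr (_ *: _).
by rewrite mulrDl mulrDr !mulrA -addrA; congr (_ + _); rewrite addrC.
Qed.

Definition der (s : int) (u : U) : U := (ulift (der_op s) u (1, 0)).2.

Lemma der_hom s (u a b : U) : ulift (der_op s) u (a, b) = (u * a, u * b + der s u * a).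
Proof.
have hM := uliftM (der_opP s); have hD := uliftD (der_opP s).
elim/Uenv_ind: u a b => [x|c|u v IHu IHv|u v IHu IHv] a b.
- by rewrite /der (ulift_gen (der_opP s)) /= mulr0 add0r mulr1.
- rewrite /der (uliftZ (der_opP s)) (ulift1 (der_opP s)) !lendoZE !lendo1E /= scaler0 mul0r addr0.
  by rewrite !mulr_algl.
- have -> : der s (u + v) = der s u + der s v by rewrite /der hD lendoDE.
  rewrite hD lendoDE IHu IHv; congr (_, _); rewrite /= !mulrDl //.
  by rewrite addrACA.
have -> : der s (u * v) = u * der s v + der s u * v.
  by rewrite {1}/der hM lendoME IHv IHu /= !mulr1 mulr0 add0r.
rewrite hM lendoME IHv IHu; congr (_, _); rewrite /= ?mulrA //.
by rewrite mulrDr mulrDl !mulrA addrA.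
Qed.

Lemma der_ugen s x : der s (ugen x) = der_gen s x.
Proof. by rewrite /der (ulift_gen (der_opP s)) /= mulr0 add0r mulr1. Qed.

Lemma derD s u v : der s (u + v) = der s u + der s v.
Proof. by rewrite /der (uliftD (der_opP s)) lendoDE. Qed.

Lemma derM s u v : der s (u * v) = der s u * v + u * der s v.
Proof.
by rewrite {1}/der (uliftM (der_opP s)) lendoME der_hom der_hom /= !mulr1 mulr0 add0r addrC.
Qed.

Lemma derZ s c u : der s (c *: u) = c *: der s u.
Proof. by rewrite /der (uliftZ (der_opP s)) lendoZE. Qed.

Lemma derC s c : der s c%:A = 0.
Proof.
by rewrite derZ /der (ulift1 (der_opP s)) lendo1E /= scaler0.
Qed.

Lemma der0 s : der s 0 = 0.
Proof. by rewrite -[X in der s X](scale0r 1) derC. Qed.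

Lemma der_e s i j r : der s (e_ i j r) = - r%:~R *: e_ i j (r + s).
Proof. exact: der_ugen. Qed.

Lemma der_K s : der s K' = 0.
Proof. exact: der_ugen. Qed.

(* [L_s, L_t] = (s - t) L_(s + t) for L_s = - t^(s + 1) d/dt. *)
Lemma der_comm s t u : der s (der t u) - der t (der s u) = (s - t)%:~R *: der (s + t) u.
Proof.
elim/Uenv_ind: u => [[i j r|]|c|u v IHu IHv|u v IHu IHv].
- rewrite !der_ugen /= !derZ !der_e !scalerA.
  have -> : r + t + s = r + (s + t) by rewrite -addrA [t + s]addrC.
  rewrite -[r + s + t]addrA -scalerBl; congr (_ *: _).
  by rewrite !rmorphD rmorphN /=; ring.
- by rewrite !der_ugen /= !der0 subrr scaler0.
- by rewrite !derC !der0 subrr scaler0.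
- by rewrite !derD opprD addrACA IHu IHv -scalerDr.
have abel (a a' b c d d' : U) : a + b + (c + d) - (a' + c + (b + d')) = a - a' + (d - d').
  rewrite [a' + c + _]addrACA opprD addrACA; congr (_ + _).
    by rewrite opprD addrACA subrr addr0.
  by rewrite opprD addrACA subrr add0r.
by rewrite !derM !derD !derM abel scalerDr scalerAl scalerAr -IHu -IHv mulrBl mulrBr.
Qed.

Local Notation J := (lideal (@vac_rel F m n)).

Lemma lideal_scale c x : J x -> J (c *: x).
Proof. by move=> Jx; rewrite -mulr_algl; apply: lideal_mul. Qed.

Lemma vac_e i j r : 0 <= r -> J (e_ i j r).
Proof.
move=> r0; rewrite -[e_ i j r]mul1r -[_ * _]addr0; apply: lidealD; last exact: lideal0.
by left; exists i, j, r.
Qed.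

Lemma vac_K : J (K' - 1).
Proof.
by rewrite -[K' - 1]mul1r -[_ * _]addr0; apply: lidealD; [right | apply: lideal0].
Qed.

(** The bound on [s] suffices because e_ij[0] is killed, while e_ij[r] with r >= 1 goes to a
    multiple of e_ij[r+s], where r + s >= 0. *)
Lemma der_lideal s x : -1 <= s -> J x -> J (der s x).
Proof.
move=> s1; elim=> [|u y z Sy Jz IH]; first by rewrite der0; apply: lideal0.
rewrite derD derM; apply: lideal_add => //; apply: lideal_add.
  by rewrite -[_ * y]addr0; apply: lidealD => //; apply: lideal0.
apply: lideal_mul; case: Sy => [[i [j [r [r0 ->]]]]|->]; last first.
  by rewrite derD der_K -scaleN1r derC addr0; apply: lideal0.
rewrite der_e; case: (eqVneq r 0) => [->|rn0].
  by rewrite oppr0 scale0r; apply: lideal0.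
apply: lideal_scale; apply: vac_e.
have : 0 < r by rewrite lt_def rn0.
by move=> r_gt0; rewrite -(subrr 1) lerD // -gtz0_ge1.
Qed.

End Derivation.

(** * The extension by tau *)

Section FunSeq.
Variables (F : fieldType) (W : lmodType F).

Definition fseq := nat -> W.
HB.instance Definition _ := gen_eqMixin fseq.
HB.instance Definition _ := gen_choiceMixin fseq.
Implicit Types f g h : fseq.

Lemma fseqP f g : (forall j, f j = g j) -> f = g.
Proof. by move=> fg; apply/funext. Qed.

Definition fseq_add f g : fseq := fun j => f j + g j.
Definition fseq_opp f : fseq := fun j => - f j.
Definition fseq_zero : fseq := fun _ => 0.
Definition fseq_scale (c : F) f : fseq := fun j => c *: f j.
Lemma fseq_addA : associative fseq_add.
Proof. by move=> f g h; apply: fseqP => j; apply: addrA. Qed.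
Lemma fseq_addC : commutative fseq_add.
Proof. by move=> f g; apply: fseqP => j; apply: addrC. Qed.
Lemma fseq_add0 : left_id fseq_zero fseq_add.
Proof. by move=> f; apply: fseqP => j; apply: add0r. Qed.
Lemma fseq_addN : left_inverse fseq_zero fseq_opp fseq_add.
Proof. by move=> f; apply: fseqP => j; apply: addNr. Qed.
HB.instance Definition _ :=
  GRing.isZmodule.Build fseq fseq_addA fseq_addC fseq_add0 fseq_addN.
Lemma fseq_scaleA a b f : fseq_scale a (fseq_scale b f) = fseq_scale (a * b) f.
Proof. by apply: fseqP => j; apply: scalerA. Qed.
Lemma fseq_scale1 : left_id 1 fseq_scale.
Proof. by move=> f; apply: fseqP => j; apply: scale1r. Qed.
Lemma fseq_scaleDr : right_distributive fseq_scale +%R.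
Proof. by move=> a f g; apply: fseqP => j; apply: scalerDr. Qed.
Lemma fseq_scaleDl f : {morph fseq_scale^~ f : a b / a + b}.
Proof. by move=> a b; apply: fseqP => j; apply: scalerDl. Qed.
HB.instance Definition _ := GRing.Zmodule_isLmodule.Build F fseq
  fseq_scaleA fseq_scale1 fseq_scaleDr fseq_scaleDl.

Lemma fseqDE f g j : (f + g) j = f j + g j. Proof. by []. Qed.
Lemma fseqZE c f j : (c *: f) j = c *: f j. Proof. by []. Qed.
End FunSeq.

Section TauModule.
Variables (F : fieldType) (m n : nat).
Local Notation L := (aff F m n).
Local Notation U := (Uenv L).
Local Notation J := (lideal (@vac_rel F m n)).
Local Notation V := (fseq U).
Local Notation der := (@der F m n).

Let veq := @fseqP F U.

(* A sequence f stands for the series sum_j f_j z^j, on which tau acts as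
   der (-1) + z: the series of x . 1 lists the coefficients of the expansion of
   x in powers of tau. *)
Definition fJ (f : V) : Prop := forall j, J (f j).
Definition fone : V := fun j => (j == 0%N)%:R.

Lemma fone_neq0 : fone <> 0.
Proof. by move=> /(congr1 (fun f : V => f 0%N)) /= /eqP; rewrite oner_eq0. Qed.
Lemma fJ0 : fJ 0. Proof. by move=> j; apply: lideal0. Qed.
Lemma fJD f g : fJ f -> fJ g -> fJ (f + g).
Proof. by move=> Jf Jg j; apply: lideal_add. Qed.
Lemma fJZ c f : fJ f -> fJ (c *: f).
Proof. by move=> Jf j; apply: lideal_scale. Qed.
Local Notation E := (lendoA fone_neq0 fJ0 fJD fJZ).

Local Obligation Tactic := idtac.
Program Definition op_mul (u : U) : E := @Lendo F V fJ (fun f : V => (fun j => u * f j) : V) _ _ _.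
Next Obligation. by move=> u f g; apply: veq => j; apply: mulrDr. Qed.
Next Obligation. by move=> u c f; apply: veq => j /=; rewrite !fseqZE scalerAr. Qed.
Next Obligation. by move=> u f Jf j; apply: lideal_mul. Qed.

Definition fshift (f : V) : V := fun j => if j is j'.+1 then f j' else 0.

Program Definition op_tau : E := @Lendo F V fJ
  (fun f : V => (fun j => der (-1) (f j) + fshift f j) : V) _ _ _.
Next Obligation.
move=> f g; apply: veq => -[|j]; rewrite !fseqDE derD; last by rewrite addrACA.
by rewrite !addr0.
Qed.
Next Obligation.
move=> c f; apply: veq => -[|j]; rewrite !fseqZE derZ scalerDr //.
by rewrite scaler0.
Qed.
Next Obligation.
by move=> f Jf [|j]; apply: lideal_add; [apply: der_lideal | apply: lideal0 | apply: der_lideal | apply: Jf].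
Qed.

(** The second summand is z d/dz. *)
Program Definition op_L0 : E := @Lendo F V fJ 
  (fun f : V => (fun j => der 0 (f j) + f j *+ j) : V) _ _ _.
Next Obligation.
by move=> f g; apply: veq => j; rewrite !fseqDE derD mulrnDl addrACA.
Qed.
Next Obligation.
by move=> c f; apply: veq => j; rewrite !fseqZE derZ scalerDr scalerMnr.
Qed.
Next Obligation.
move=> f Jf j; apply: lideal_add; first by apply: der_lideal.
by rewrite -scaler_nat; apply: lideal_scale.
Qed.

(** The second summand is z (d/dz)^2. Its commutator with z is 2 z d/dz, and [z d/dz, z] = z;
    together with [der_comm] this gives [L_1, tau] = 2 L_0 and [L_0, tau] = tau. *)
Program Definition op_L1 : E := @Lendo F V fJ
  (fun f : V => (fun j => der 1 (f j) + f j.+1 *+ (j.+1 * j)) : V) _ _ _.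
Next Obligation.
by move=> f g; apply: veq => j; rewrite !fseqDE derD mulrnDl addrACA.
Qed.
Next Obligation.
by move=> c f; apply: veq => j; rewrite !fseqZE derZ scalerDr scalerMnr.
Qed.
Next Obligation.
move=> f Jf j; apply: lideal_add; first by apply: der_lideal.
by rewrite -scaler_nat; apply: lideal_scale.
Qed.

Lemma op_mulM u v : op_mul (u * v) = op_mul u * op_mul v.
Proof. by apply: lendoP => f; apply: veq => j; apply/esym/mulrA. Qed.
Lemma op_mulD u v : op_mul (u + v) = op_mul u + op_mul v.
Proof. by apply: lendoP => f; apply: veq => j; apply: mulrDl. Qed.
Lemma op_mulZ c u : op_mul (c *: u) = c *: op_mul u.
Proof. by apply: lendoP => f; apply: veq => j; apply/esym/scalerAl. Qed.

Lemma op_tau_mul u : op_tau * op_mul u = op_mul u * op_tau + op_mul (der (-1) u).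
Proof.
apply: lendoP => f; apply: veq => -[|j]; rewrite lendoDE !lendoME fseqDE /= derM.
  by rewrite !addr0 addrC.
by rewrite mulrDr -addrA addrC -!addrA addrC.
Qed.

Lemma op_L0_mul u : op_L0 * op_mul u = op_mul u * op_L0 + op_mul (der 0 u).
Proof.
apply: lendoP => f; apply: veq => j; rewrite lendoDE !lendoME fseqDE /= derM.
by rewrite mulrDr -mulrnAr -addrA addrC.
Qed.

Lemma op_L1_mul u : op_L1 * op_mul u = op_mul u * op_L1 + op_mul (der 1 u).
Proof.
apply: lendoP => f; apply: veq => j; rewrite lendoDE !lendoME fseqDE /= derM.
by rewrite mulrDr -mulrnAr -addrA addrC.
Qed.

Let derMn s (u : U) k : der s (u *+ k) = der s u *+ k.
Proof. by rewrite -!scaler_nat derZ. Qed.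

Lemma op_L0_tau : op_L0 * op_tau = op_tau * op_L0 + op_tau.
Proof.
apply: lendoP => f; apply: veq => j; rewrite lendoDE !lendoME fseqDE /=.
have E0 g : der 0 (der (-1) g) = der (-1) g + der (-1) (der 0 g).
  by have /eqP := @der_comm F m n 0 (-1) g; rewrite subr_eq scale1r => /eqP.
case: j => [|j]; rewrite !derD ?der0 E0 /= ?addr0 ?mulr0n ?addr0.
  by rewrite addrC.
rewrite derMn mulrnDl [f j *+ j.+1]mulrSr.
by rewrite !addrA [LHS](ACl (2*4*3*5*1*6))%AC.
Qed.

Lemma op_L1_tau : op_L1 * op_tau = op_tau * op_L1 + op_L0 *+ 2.
Proof.
apply: lendoP => f; apply: veq => j; rewrite mulr2n !lendoDE !lendoME fseqDE /=.
have E0 g : der 1 (der (-1) g) = der 0 g + der 0 g + der (-1) (der 1 g).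
  have /eqP := @der_comm F m n 1 (-1) g; rewrite subr_eq => /eqP ->.
  by rewrite (_ : (1 - -1)%:~R = 2%:R) // scaler_nat.
rewrite fseqDE !derD E0 derMn mulrnDl.
case: j => [|j]; first by rewrite !muln0 !mulr0n /= der0 !addr0 addrC.
have -> : f j.+1 *+ (j.+2 * j.+1) = f j.+1 *+ (j.+1 * j) + (f j.+1 *+ j.+1 + f j.+1 *+ j.+1).
  by rewrite -!mulrnDr addnn -muln2 -mulnDr addn2 mulnC.
rewrite [fshift f _]/fshift [fshift _ j.+1]/fshift /fshift.
move: (j.+2 * j.+1)%N (j.+1 * j)%N => c d; rewrite !addrA.
by rewrite [LHS](ACl (3*5*4*6*1*7*2*8))%AC.
Qed.

End TauModule.

(** * The super Manin property of tau + E[-1] *)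

Section LoopManin.
Variables (A : nzRingType) (N : nat) (p : 'I_N -> bool).
Variables (t : A) (x y : 'I_N -> 'I_N -> A).
Local Notation sg b := ((-1) ^+ nat_of_bool b).
Hypothesis tx : forall i j, t * x i j = x i j * t + y i j.
Hypothesis xx : forall i j k l, x i j * x k l =
  sg ((p i (+) p j) && (p k (+) p l)) * (x k l * x i j)
  + (k == j)%:R * y i l
  - (i == l)%:R * (sg ((p i (+) p j) && (p k (+) p l)) * y k j).

Let T : 'M[A]_N := \matrix_(i, j) ((i == j)%:R * t + sg (p i) * x i j).

Let sgC (b : bool) (a : A) : a * sg b = sg b * a.
Proof. exact: commr_sign. Qed.

Let sgA (b c : bool) (a : A) : sg b * (sg c * a) = sg (b (+) c) * a.
Proof. by rewrite mulrA signr_addb. Qed.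

Let natC (b : bool) (a : A) : a * b%:R = b%:R * a.
Proof. by case: b; rewrite ?mulr1 ?mul1r ?mulr0 ?mul0r. Qed.

Let natC' (b c : bool) : sg b * c%:R = c%:R * sg b :> A.
Proof. exact: esym (commr_sign _ _). Qed.

Let abel4 (a b c d a' b' c' d' : A) :
  a + b + (c + d) - (a' + c' + (b' + d')) = a - a' + (b - b') + (c - c') + (d - d').
Proof. by rewrite !opprD !addrA [LHS](ACl (1*5*2*7*3*6*4*8))%AC. Qed.

(** The quadratic terms cancel and only terms linear in [y], the commutator of [t] with [x], remain.
    The factor 1 + P_12 then cancels these in pairs, which is [loop_manin]. *)
Let T_comm i j k l :
  sg ((p i (+) p k) && p j) * (T i k * T j l) - sg ((p i (+) p k) && p l) * (T j l * T i k) =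
  (i == k)%:R * (sg (p j) * y j l)
  - (j == l)%:R * (sg (((p i (+) p k) && p j) (+) p i) * y i k)
  + (j == k)%:R * (sg (((p i (+) p k) && p j) (+) p i (+) p j) * y i l)
  - (i == l)%:R * (sg (((p i (+) p k) && p l) (+) p i (+) p j) * y j k).
Proof.
rewrite !mxE !mulrDl !mulrDr abel4 -[RHS]addrA; congr (_ + _ + _).
- case: (eqVneq i k) => [->|_]; last by rewrite !(mul0r, mulr0) !subrr addr0.
  rewrite addbb /= !mul1r [t * (_ * t)]mulrA natC subrr add0r.
  by rewrite mulrA sgC -!mulrA tx mulrDr addrAC subrr add0r.
- case: (eqVneq j l) => [->|_]; last by rewrite !(mul0r, mulr0) subrr oppr0.
  rewrite !mul1r [t * (_ * _)]mulrA sgC -!mulrA tx !mulrDr.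
  by rewrite opprD addrA subrr add0r sgA.
have sx b c d (u v : A) : sg b * (sg c * u * (sg d * v)) = sg (b (+) c (+) d) * (u * v).
  by rewrite [sg c * u * _]mulrA sgC !mulrA -!signr_addb addbAC.
rewrite !sx xx; set b := _ (+) p i (+) p j.
have -> : (p i (+) p k) && p l (+) p j (+) p i = b (+) ((p i (+) p k) && (p j (+) p l)).
  by rewrite /b; case: (p i); case: (p j); case: (p k); case: (p l).
have -> : (p i (+) p k) && p l (+) p i (+) p j = b (+) ((p i (+) p k) && (p j (+) p l)).
  by rewrite /b; case: (p i); case: (p j); case: (p k); case: (p l).
rewrite mulrBr mulrDr !sgA addrAC [X in X - _]addrAC subrr add0r.
by rewrite ![sg b * (_%:R * _)]mulrA !natC' -!mulrA sgA.
Qed.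

Lemma loop_manin : super_manin p T.
Proof.
move=> i j k l; rewrite /mrel !T_comm.
have D (b c c' : bool) (u : A) : (b -> c = c') ->
    b%:R * (sg c * u) - b%:R * (sg c' * u) = 0.
  by case: b => [->|_]; rewrite ?subrr // !mul0r subrr.
rewrite !mulrBr mulrDr mulrBr ![sg _ * (_%:R * _)]mulrA !natC' -!mulrA !sgA.
rewrite !addrA [LHS](ACl ((1*8)*(7*2)*(3*6)*(5*4)))%AC /= !D ?addr0 // => /eqP ->.
- by case: (p j); case: (p k); case: (p l).
- by case: (p i); case: (p k); case: (p l).
- by case: (p i); case: (p k); case: (p l).
by case: (p j); case: (p k); case: (p l).
Qed.

End LoopManin.

(** * The action on series and uniqueness of expansions *)

Section TauRepresentation.
Variables (F : fieldType) (m n : nat).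
Local Notation L := (aff F m n).
Local Notation U := (Uenv L).
Local Notation L' := (afft F m n).
Local Notation U' := (Uenv L').
Local Notation e_ := (@e_ F m n).
Local Notation tau := (@tau F m n).
Local Notation iota := (@iota_aff F m n).
Local Notation der := (@der F m n).
Local Notation fone := (@fone F m n).
Local Notation E := (lendoA (@fone_neq0 F m n) (@fJ0 F m n) (@fJD F m n) (@fJZ F m n)).
Local Notation op_mul := (@op_mul F m n).
Local Notation op_tau := (@op_tau F m n).

Lemma iotaD u v : iota (u + v) = iota u + iota v.
Proof. exact: (uliftD (@iota_genP F m n)). Qed.
Lemma iotaM u v : iota (u * v) = iota u * iota v.
Proof. exact: (uliftM (@iota_genP F m n)). Qed.
Lemma iotaZ c u : iota (c *: u) = c *: iota u.
Proof. exact: (uliftZ (@iota_genP F m n)). Qed.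
Lemma iota1 : iota 1 = 1.
Proof. exact: (ulift1 (@iota_genP F m n)). Qed.
Lemma iota0 : iota 0 = 0.
Proof. by rewrite -(scale0r 0) iotaZ scale0r. Qed.

Lemma tau_iota u : tau * iota u = iota u * tau + iota (der (-1) u).
Proof.
elim/Uenv_ind: u => [x|c|u v IHu IHv|u v IHu IHv].
- rewrite der_ugen iota_aff_gen /iota_gen [LHS]ugen_br /= scale1r; congr (_ + _).
  case: x => [i j r|]; last by rewrite big_nil iota0.
  by rewrite big_cons big_nil addr0 iotaZ iota_aff_gen.
- by rewrite derC iota0 addr0 iotaZ iota1 mulr_algl mulr_algr.
- by rewrite derD !iotaD mulrDr mulrDl IHu IHv addrACA.
by rewrite derM iotaD !iotaM mulrA IHu mulrDl -!mulrA IHv mulrDr -addrA [X in _ + X]addrC.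
Qed.

Definition rho_gen (x : L') : E := if x is Some y then op_mul (ugen (L := L) y) else op_tau.

Lemma op_mul0 : op_mul 0 = 0.
Proof. by rewrite -[X in op_mul X](scale0r 0) op_mulZ scale0r. Qed.

Lemma op_mul_sum (r : seq (F * L)) :
  op_mul (\sum_(q <- r) q.1 *: ugen q.2) = \sum_(q <- r) q.1 *: op_mul (ugen q.2).
Proof.
elim: r => [|q r IH]; first by rewrite !big_nil op_mul0.
by rewrite !big_cons op_mulD op_mulZ IH.
Qed.

Lemma rho_genP (x y : L') : rho_gen x * rho_gen y =
  (-1) ^+ (sl_par x && sl_par y) *: (rho_gen y * rho_gen x)
  + \sum_(q <- sl_br x y) q.1 *: rho_gen q.2.
Proof.
case: x y => [x|] [y|] /=.
- rewrite -op_mulM [ugen (L := L) x * _]ugen_br op_mulD op_mulZ op_mulM; congr (_ + _).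
  rewrite op_mul_sum.
  by case: x y => [i j r|] [k l s|]; rewrite /= !(big_cons, big_nil).
- rewrite andbF scale1r op_tau_mul der_ugen; case: x => [i j r|] /=.
    by rewrite big_cons big_nil addr0 /e_ op_mulZ -addrA scaleNr addNr addr0.
  by rewrite big_nil op_mul0 !addr0.
- rewrite scale1r op_tau_mul der_ugen; congr (_ + _); case: y => [i j r|] /=.
    by rewrite big_cons big_nil addr0 op_mulZ.
  by rewrite big_nil op_mul0.
by rewrite big_nil addr0 scale1r.
Qed.

Definition rho : U' -> E := ulift rho_gen.

Lemma rhoD x y : rho (x + y) = rho x + rho y.
Proof. exact: (uliftD rho_genP). Qed.
Lemma rhoM x y : rho (x * y) = rho x * rho y.
Proof. exact: (uliftM rho_genP). Qed.
Lemma rhoZ c x : rho (c *: x) = c *: rho x.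
Proof. exact: (uliftZ rho_genP). Qed.
Lemma rho1 : rho 1 = 1.
Proof. exact: (ulift1 rho_genP). Qed.

Lemma rhoB : zmod_morphism rho.
Proof. by move=> x y; rewrite -scaleN1r rhoD rhoZ scaleN1r. Qed.
HB.instance Definition _ := GRing.isZmodMorphism.Build U' E rho rhoB.
HB.instance Definition _ := GRing.isMonoidMorphism.Build U' E rho (conj rho1 rhoM).

Lemma rho_tau : rho tau = op_tau.
Proof. exact: (ulift_gen rho_genP). Qed.

Lemma rho_iota u : rho (iota u) = op_mul u.
Proof.
elim/Uenv_ind: u => [x|c|u v IHu IHv|u v IHu IHv].
- by rewrite iota_aff_gen; apply: (ulift_gen rho_genP).
- rewrite iotaZ rhoZ iota1 rho1 op_mulZ; congr (_ *: _).
  by apply: lendoP => f; apply: fseqP => j; apply/esym/mul1r.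
- by rewrite iotaD rhoD op_mulD IHu IHv.
by rewrite iotaM rhoM op_mulM IHu IHv.
Qed.

(** The derivation kills constants, so tau^k applied to 1 is exactly z^k. *)
Lemma rho_tauX k j : (rho (tau ^+ k) fone : fseq U) j = (j == k)%:R.
Proof.
elim: k j => [|k IH] j; first by rewrite rho1.
rewrite exprS rhoM rho_tau lendoME /= IH.
have -> : der (-1) (j == k)%:R = 0.
  by case: (j == k); rewrite ?der0 // -[1%:R]scale1r derC.
by case: j => [|j]; rewrite add0r //= IH.
Qed.

Lemma rho_term u k j : (rho (iota u * tau ^+ k) fone : fseq U) j = (j == k)%:R * u.
Proof.
rewrite rhoM rho_iota lendoME /= rho_tauX.
by case: (j == k); rewrite ?mulr1 ?mul1r ?mulr0 ?mul0r.
Qed.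

Lemma rho_sum_fone (I : finType) (f : I -> U') j :
  (rho (\sum_i f i) fone : fseq U) j = \sum_i (rho (f i) fone : fseq U) j.
Proof.
rewrite raddf_sum.
by elim/big_rec2: _ => // i y1 y2 _ <-; rewrite lendoDE.
Qed.

Lemma rho_expansion k (c : 'I_k.+1 -> U) (l : 'I_k.+1) :
  (rho (\sum_(l < k.+1) iota (c l) * tau ^+ (k - l)) fone : fseq U) (k - l)%N = c l.
Proof.
rewrite rho_sum_fone (bigD1 l) //= rho_term eqxx mul1r big1 ?addr0 // => i il.
rewrite rho_term; case: eqP => [/(congr1 (subn k))|]; last by rewrite mul0r.
by rewrite !subKn -1?ltnS // => /val_inj E'; rewrite E' eqxx in il.
Qed.

Lemma tau_expansion_uniq k (x : U') (c d : {ffun 'I_k.+1 -> U}) :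
  tau_expansion x c -> tau_expansion x d -> c = d.
Proof.
move=> [_ xc] [_ xd]; apply/ffunP => l.
by rewrite -(rho_expansion c l) -xc xd rho_expansion.
Qed.

End TauRepresentation.

(** * Polynomials in tau over a subalgebra *)

Section TauFiltration.
Variables (F : fieldType) (m n : nat).
Local Notation L := (aff F m n).
Local Notation U := (Uenv L).
Local Notation L' := (afft F m n).
Local Notation U' := (Uenv L').
Local Notation e_ := (@e_ F m n).
Local Notation K' := (@K' F m n).
Local Notation tau := (@tau F m n).
Local Notation iota := (@iota_aff F m n).
Local Notation J := (lideal (@vac_rel F m n)).
Local Notation der := (@der F m n).
Local Notation fone := (@fone F m n).
Local Notation coef x := (rho x fone : fseq U).

Record dsubalg (C : U -> Prop) : Prop := Dsubalg {
  dsub_sc : forall c, C c%:A;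
  dsubD : forall u v, C u -> C v -> C (u + v);
  dsubM : forall u v, C u -> C v -> C (u * v);
  dsub_der : forall u, C u -> C (der (-1) u)
}.

Inductive tpoly (C : U -> Prop) (k : nat) : U' -> Prop :=
| tpoly0 : tpoly C k 0
| tpolyT u j x : C u -> (j <= k)%N -> tpoly C k x -> tpoly C k (iota u * tau ^+ j + x).

Section Closed.
Variables (C : U -> Prop) (CP : dsubalg C).

Lemma tpolyD k x y : tpoly C k x -> tpoly C k y -> tpoly C k (x + y).
Proof.
move=> + Hy; elim=> [|u j z Cu jk _ IH]; first by rewrite add0r.
by rewrite -addrA; apply: tpolyT.
Qed.

Lemma tpoly_sum k (I : Type) (r : seq I) (P : pred I) (f : I -> U') :
  (forall i, P i -> tpoly C k (f i)) -> tpoly C k (\sum_(i <- r | P i) f i).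
Proof. by move=> H; apply: big_ind => //; [apply: tpoly0 | move=> x y; apply: tpolyD]. Qed.

Lemma tpoly_term k u j : C u -> (j <= k)%N -> tpoly C k (iota u * tau ^+ j).
Proof. by move=> Cu jk; rewrite -[_ * _]addr0; apply: tpolyT => //; apply: tpoly0. Qed.

Lemma tpoly_le k l x : (k <= l)%N -> tpoly C k x -> tpoly C l x.
Proof.
move=> kl; elim=> [|u j z Cu jk _ IH]; first exact: tpoly0.
by apply: tpolyT => //; apply: leq_trans kl.
Qed.

Lemma tpoly_iotaM k u x : C u -> tpoly C k x -> tpoly C k (iota u * x).
Proof.
move=> Cu; elim=> [|v j z Cv jk _ IH]; first by rewrite mulr0; apply: tpoly0.
by rewrite mulrDr mulrA -iotaM; apply: tpolyT => //; apply: dsubM.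
Qed.

Lemma tpolyZ k c x : tpoly C k x -> tpoly C k (c *: x).
Proof.
by rewrite -mulr_algl -(iota1 F m n) -iotaZ; apply: tpoly_iotaM; apply: dsub_sc.
Qed.

(** Moving tau to the right of a coefficient [u] adds a term with [der (-1) u] and one tau fewer, so
    closure under [der (-1)] is all that is required. *)
Lemma tpoly_tauXM k j x : tpoly C k x -> tpoly C (j + k) (tau ^+ j * x).
Proof.
move=> H; elim: j => [|j IH]; first by rewrite mul1r.
rewrite exprS -mulrA; elim: IH => [|u i z Cu ik Hz IH].
  by rewrite mulr0; apply: tpoly0.
rewrite mulrDr mulrA tau_iota mulrDl -mulrA -exprS -addrA.
apply: tpolyT => //; apply: tpolyT => //; first exact: dsub_der.
by rewrite (leq_trans ik).
Qed.

Lemma tpolyM k l x y : tpoly C k x -> tpoly C l y -> tpoly C (k + l) (x * y).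
Proof.
move=> Hx Hy; elim: Hx => [|u j z Cu jk _ IH]; first by rewrite mul0r; apply: tpoly0.
rewrite mulrDl; apply: tpolyD => //; rewrite -mulrA; apply: tpoly_iotaM => //.
apply: tpoly_le (tpoly_tauXM j Hy); by rewrite leq_add2r.
Qed.

Lemma tpoly_sc k (c : F) : tpoly C k c%:A.
Proof.
rewrite -(iota1 F m n) -iotaZ -[iota _]mulr1 -(expr0 tau).
by apply: tpoly_term => //; apply: dsub_sc.
Qed.

Lemma tpoly_coef k x j : tpoly C k x -> C (coef x j).
Proof.
have C0 : C 0 by rewrite -(scale0r 1); apply: dsub_sc.
elim=> [|u i z Cu _ _ IH]; first by rewrite raddf0.
rewrite raddfD lendoDE fseqDE /= rho_term; apply: dsubD => //.
by case: (j == i); rewrite ?mul1r ?mul0r.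
Qed.

End Closed.

Lemma tpoly_expansion C k x : tpoly C k x ->
  x = \sum_(l < k.+1) iota (coef x (k - l)%N) * tau ^+ (k - l).
Proof.
elim=> [|u i z _ ik _ {1}->].
  by rewrite big1 // => l _; rewrite raddf0 [X in iota X](_ : _ = 0) // iota0 mul0r.
under [RHS]eq_bigr => l _ do rewrite raddfD lendoDE fseqDE iotaD mulrDl.
rewrite big_split /=; congr (_ + _).
have ik' : (k - i < k.+1)%N by rewrite ltnS leq_subr.
rewrite (bigD1 (Ordinal ik')) //= subKn // rho_term eqxx mul1r big1 ?addr0 // => l lk.
rewrite rho_term; case: eqP => [E|]; last by rewrite mul0r iota0 mul0r.
by case/eqP: lk; apply: val_inj; rewrite /= -E subKn // -ltnS.
Qed.

Lemma Uneg_dsubalg : dsubalg (@Uneg F m n).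
Proof.
split; [exact: subalg_sc | exact: subalg_add | exact: subalg_mul |].
move=> u; elim=> [{}u [i [j [r [r0 ->]]]]|c|x y _ Dx _ Dy|x y Sx Dx Sy Dy].
- rewrite der_e -mulr_algl; apply: subalg_mul; first exact: subalg_sc.
  apply: subalg_gen; exists i, j, (r - 1); split=> //.
  by apply: lt_trans r0; rewrite ltrBlDr ltrDl.
- by rewrite derC -(scale0r 1); apply: subalg_sc.
- by rewrite derD; apply: subalg_add.
by rewrite derM; apply: subalg_add; apply: subalg_mul.
Qed.

(* Elements of Uneg whose image in the vacuum module is a Segal-Sugawara vector
   are those normalising the left ideal J; in this form they visibly make up an
   algebra. *)
Definition Usug (c : U) : Prop := Uneg c /\ forall x, J x -> J (x * c).

Lemma Usug_dsubalg : dsubalg Usug.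
Proof.
have [Nc ND NM Nd] := Uneg_dsubalg.
split=> [c|u v [Nu Ju] [Nv Jv]|u v [Nu Ju] [Nv Jv]|u [Nu Ju]]; split; auto.
- by move=> x Jx; rewrite mulr_algr; apply: lideal_scale.
- by move=> x Jx; rewrite mulrDr; apply: lideal_add; auto.
- by move=> x Jx; rewrite mulrA; auto.
(* The Leibniz rule solved for x der(u): both pieces lie in J because J is stable under
   [der (-1)]. *)
move=> x Jx; have -> : x * der (-1) u = der (-1) (x * u) + (-1) * (der (-1) x * u).
  by rewrite derM mulN1r addrAC subrr add0r.
apply: lideal_add; first by apply: der_lideal => //; apply: Ju.
by apply: lideal_mul; apply: Ju; apply: der_lideal.
Qed.

Lemma K'C u : K' * u = u * K'.
Proof.
elim/Uenv_ind: u => [x|c|u v IHu IHv|u v IHu IHv].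
- by case: x => [i j r|]; rewrite [LHS]ugen_br /= big_nil addr0 scale1r.
- by rewrite mulr_algl mulr_algr.
- by rewrite mulrDr mulrDl IHu IHv.
by rewrite mulrA IHu -mulrA IHv mulrA.
Qed.

(** The generator K' - 1 of J is central, hence moves to the right of [c]; the condition has to be
    tested on the e_ij[r] only. *)
Lemma UsugP c : Uneg c -> (forall i j r, 0 <= r -> J (e_ i j r * c)) <-> Usug c.
Proof.
move=> Nc; split=> [H|[_ H] i j r r0]; last by apply: H; apply: vac_e.
split=> // x; elim=> [|u y z Sy _ IH]; first by rewrite mul0r; apply: lideal0.
rewrite mulrDl; apply: lideal_add => //; rewrite -mulrA; apply: lideal_mul.
case: Sy => [[i [j [r [r0 ->]]]]|->]; first exact: H.
have -> : (K' - 1) * c = c * (K' - 1) by rewrite mulrBl mulrBr K'C mul1r mulr1.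
by apply: lideal_mul; apply: vac_K.
Qed.

Lemma tpoly_Usug k x : tpoly (@Uneg F m n) k x ->
  (forall i j r l, 0 <= r -> J (e_ i j r * coef x l)) -> tpoly Usug k x.
Proof.
move=> Nx H; rewrite (tpoly_expansion Nx); apply: tpoly_sum => l _.
apply: tpoly_term; last exact: leq_subr.
by apply/(UsugP (tpoly_coef Uneg_dsubalg (k - l) Nx)) => i j r; apply: H.
Qed.

End TauFiltration.

Section LmodReg.
Variables (F : fieldType) (F0 : forall k, k.+1%:R != 0 :> F) (V : lmodType F).

Lemma lmod_reg k (v : V) : v *+ k.+1 = 0 -> v = 0.
Proof. by move/eqP; rewrite -scaler_nat scaler_eq0 (negbTE (F0 k)) => /eqP. Qed.

End LmodReg.

Lemma mrel_map (A B : nzRingType) (f : {rmorphism A -> B}) N (p : 'I_N -> bool)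
  (X Y : 'M[A]_N) i j k l :
  mrel p (map_mx f X) (map_mx f Y) i j k l = f (mrel p X Y i j k l).
Proof. by rewrite /mrel !mxE !(rmorphD, rmorphN, rmorphM, rmorph_sign). Qed.

(** * The matrix T and its image among the operators *)

Section Tmatrix.
Variables (F : fieldType) (m n : nat).
Local Notation L := (aff F m n).
Local Notation L' := (afft F m n).
Local Notation U' := (Uenv L').
Local Notation e_ := (@e_ F m n).
Local Notation K' := (@K' F m n).
Local Notation tau := (@tau F m n).
Local Notation iota := (@iota_aff F m n).
Local Notation T := (Tmat F m n).
Local Notation p := (@par m n).
Local Notation sg b := ((-1) ^+ nat_of_bool b).
Local Notation E := (lendoA (@fone_neq0 F m n) (@fJ0 F m n) (@fJD F m n) (@fJZ F m n)).
Local Notation op_mul := (@op_mul F m n).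
Local Notation op_tau := (@op_tau F m n).

Lemma sgZ (A : algType F) (b : bool) (x : A) : sg b *: x = sg b * x.
Proof. by case: b; rewrite ?scale1r ?mul1r // scaleN1r mulN1r. Qed.

Lemma Tmat_par i k : upar (T i k) = sg (p i (+) p k) * T i k.
Proof.
have [uD uM uZ u1] := upar_hom L'.
have uS (b : bool) (x : U') : upar (sg b * x) = sg b * upar x.
  by case: b; rewrite ?mul1r // !mulN1r -!scaleN1r uZ.
rewrite mxE uD uS mulrDr; congr (_ + _).
  case: eqP => [->|_]; last by rewrite !mul0r mulr0 -(scale0r 1) uZ !scale0r.
  by rewrite addbb !mul1r upar_ugen scale1r.
rewrite iota_aff_gen upar_ugen sgZ [RHS]mulrA !mulrA -!signr_addb.
by rewrite [_ (+) (_ (+) _)]addbC.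
Qed.

Lemma natZ (A : algType F) (b : bool) (x : A) : b%:R *: x = b%:R * x.
Proof. by case: b; rewrite ?scale1r ?mul1r // scale0r mul0r. Qed.

Lemma e_br (i j k l : 'I_(m + n)) (r s : int) : e_ i j r * e_ k l s =
  sg ((p i (+) p j) && (p k (+) p l)) * (e_ k l s * e_ i j r)
  + (k == j)%:R * e_ i l (r + s)
  - (i == l)%:R * (sg ((p i (+) p j) && (p k (+) p l)) * e_ k j (r + s))
  + ((r%:~R * (r + s == 0)%:R) *:
     ((k == j)%:R * ((i == l)%:R * (sg (p i) * ((n%:R - m%:R) *: K')))
      + (i == j)%:R * ((k == l)%:R * (sg (p i (+) p k) * K')))).
Proof.
rewrite [LHS]ugen_br /= !big_cons big_nil /= sgZ -[r == - s]addr_eq0 addr0 !addrA natZ.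
congr (_ + _ + _); first by rewrite scaleNr -scalerA natZ sgZ.
rewrite -!sgZ -!natZ !scalerA -scalerDl scalerA.
congr (_ *: _); rewrite signr_addb exprD; ring.
Qed.

Lemma Tmat_manin : super_manin p T.
Proof.
apply: loop_manin (fun i j => iota (e_ i j (-2))) _ _ => [i j|i j k l].
  by rewrite tau_iota der_e mulrN1z opprK scale1r.
have sgI b u : iota (sg b * u) = sg b * iota u by rewrite -!sgZ iotaZ.
have natI (b : bool) u : iota (b%:R * u) = b%:R * iota u by rewrite -!natZ iotaZ.
have NI u : iota (- u) = - iota u by rewrite -!scaleN1r iotaZ.
rewrite -!iotaM e_br mulr0 scale0r addr0 !iotaD NI !natI !sgI.
by [].
Qed.

Definition Top : 'M[E]_(m + n) := map_mx (@rho F m n) T.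

Lemma TopE i j : Top i j = (i == j)%:R * op_tau + sg (p i) * op_mul (e_ i j (-1)).
Proof.
by rewrite !mxE -natZ -sgZ rhoD !rhoZ rho_tau rho_iota natZ sgZ.
Qed.

Lemma Top_manin : super_manin p Top.
Proof. by move=> i j k l; rewrite mrel_map Tmat_manin raddf0. Qed.

Lemma TopX s : Top ^+ s = map_mx (@rho F m n) (T ^+ s).
Proof.
elim: s => [|s IH]; last by rewrite !exprS -mulmxE map_mxM IH.
by apply/matrixP => i j; rewrite !mxE rmorph_nat.
Qed.

Lemma rho_pstr s : rho (pstr p T s) = \sum_x sg (p x) * (Top ^+ s) x x.
Proof.
by rewrite raddf_sum; apply: eq_bigr => x _; rewrite -!sgZ TopX mxE; apply: rhoZ.
Qed.

End Tmatrix.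

(** * Segal-Sugawara vectors *)

Section SegalSugawara.
Variables (F : fieldType) (F0 : forall k, k.+1%:R != 0 :> F) (m n : nat).
Local Notation L := (aff F m n).
Local Notation U := (Uenv L).
Local Notation L' := (afft F m n).
Local Notation U' := (Uenv L').
Local Notation e_ := (@e_ F m n).
Local Notation K' := (@K' F m n).
Local Notation tau := (@tau F m n).
Local Notation iota := (@iota_aff F m n).
Local Notation J := (lideal (@vac_rel F m n)).
Local Notation fJ := (@fJ F m n).
Local Notation fone := (@fone F m n).
Local Notation T := (Tmat F m n).
Local Notation p := (@par m n).
Local Notation sg b := ((-1) ^+ nat_of_bool b).
Local Notation E := (lendoA (@fone_neq0 F m n) (@fJ0 F m n) (@fJD F m n) (@fJZ F m n)).
Local Notation op_mul := (@op_mul F m n).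
Local Notation op_tau := (@op_tau F m n).
Local Notation op_L0 := (@op_L0 F m n).
Local Notation op_L1 := (@op_L1 F m n).
Local Notation X := (@Top F m n).

Local Open Scope quotient_scope.

(** Dividing by these operators gives a cyclic module on which tau, L_0 and L_1 act along with U.
    Its generator serves as the vector [v0], and by [vacP] vanishing there means that all
    coefficients in tau lie in J. *)
Definition annE (a : E) : Prop := fJ (a fone).
Definition Evac := lquot annE.
HB.instance Definition _ := GRing.Lmodule.on Evac.
Definition vac : Evac := \pi_(lquot annE) 1.

Lemma vacP (a : E) : a *: vac = 0 <-> fJ (a fone).
Proof.
rewrite /vac [_ *: _]lquot_scaleE mulr1 lquot_eq0; split=> [|Ja].
  elim=> [|u s x Ss _ IH]; first exact: fJ0.
  by rewrite lendoDE lendoME; apply: fJD => //; apply: (lendo_stable (u : lendo fJ)) Ss.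
by have := lidealD (1 : E) (Ja : annE a) (lideal0 _); rewrite mul1r addr0.
Qed.

Lemma op_mul_sg b u : op_mul (sg b * u) = sg b * op_mul u.
Proof. by rewrite -!sgZ op_mulZ. Qed.
Lemma op_mul_nat (b : bool) u : op_mul (b%:R * u) = b%:R * op_mul u.
Proof. by rewrite -!natZ op_mulZ. Qed.
Lemma op_mulN u : op_mul (- u) = - op_mul u.
Proof. by rewrite -!scaleN1r op_mulZ. Qed.

Let sdim : E := \sum_x sg (p x).

Lemma sdimE : sdim = (m%:R - n%:R)%:A.
Proof.
rewrite /sdim big_split_ord /= scalerBl !scaler_nat; congr (_ + _).
  under eq_bigr => i _ do rewrite /par /= leqNgt ltn_ord.
  by rewrite sumr_const card_ord.
under eq_bigr => i _ do rewrite /par /= leq_addr.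
by rewrite sumr_const card_ord mulNrn.
Qed.

Lemma e_tau i j r : op_mul (e_ i j r) * op_tau =
  op_tau * op_mul (e_ i j r) + r%:~R *: op_mul (e_ i j (r - 1)).
Proof. by rewrite op_tau_mul der_e op_mulZ -addrA scaleNr addNr addr0. Qed.

Let natC (b : bool) (a : E) : a * b%:R = b%:R * a.
Proof. by case: b; rewrite ?mulr1 ?mul1r ?mulr0 ?mul0r. Qed.

Let mul_nat (b : bool) (x y : E) : x * (b%:R * y) = b%:R * (x * y).
Proof. by rewrite mulrA natC mulrA. Qed.

Let mul_sg (b : bool) (x y : E) : x * (sg b * y) = sg b * (x * y).
Proof. by rewrite mulrA commr_sign mulrA. Qed.

Let sgA (b c : bool) (a : E) : sg b * (sg c * a) = sg (b (+) c) * a.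
Proof. by rewrite mulrA signr_addb. Qed.

Let X_e i j k l r :
  sg ((p i (+) p j) && (p k (+) p l)) * (X k l * op_mul (e_ i j r)) =
  (k == l)%:R * (op_tau * op_mul (e_ i j r)) +
  sg (p k) * (sg ((p i (+) p j) && (p k (+) p l)) * (op_mul (e_ k l (-1)) * op_mul (e_ i j r))).
Proof.
rewrite TopE mulrDl mulrDr -!mulrA mul_nat [sg (p k) * (sg _ * _)]mul_sg; congr (_ + _).
by case: (eqVneq k l) => [->|_]; rewrite ?mul0r // addbb andbF !mul1r.
Qed.

Lemma E0_X i j k l : op_mul (e_ i j 0) * X k l =
  sg ((p i (+) p j) && (p k (+) p l)) * (X k l * op_mul (e_ i j 0))
  + (k == j)%:R * (sg (p i (+) p j) * X i l)
  - (i == l)%:R * (sg ((p i (+) p j) && (p k (+) p i)) * X k j).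
Proof.
rewrite X_e !TopE mulrDr mul_nat mul_sg e_tau scale0r addr0 -op_mulM e_br mul0r scale0r addr0.
rewrite !op_mulD op_mulN !op_mul_nat !op_mul_sg add0r op_mulM.
pose t := (k == j)%:R * (sg (p i (+) p j) * ((i == l)%:R * op_tau)).
have -> : (k == j)%:R * (sg (p i (+) p j) *
   ((i == l)%:R * op_tau + sg (p i) * op_mul (e_ i l (-1)))) =
   t + sg (p k) * ((k == j)%:R * op_mul (e_ i l (-1))).
  rewrite !mulrDr sgA [X in _ = _ + X]mul_nat; congr (_ + _); case: (eqVneq k j) => [->|_]; rewrite ?mul0r //.
  by rewrite addbAC addbb.
have -> : (i == l)%:R * (sg ((p i (+) p j) && (p k (+) p i)) *
   ((k == j)%:R * op_tau + sg (p k) * op_mul (e_ k j (-1)))) =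
   t + sg (p k) * ((i == l)%:R * (sg ((p i (+) p j) && (p k (+) p l)) * op_mul (e_ k j (-1)))).
  rewrite !mulrDr /t; congr (_ + _).
    rewrite [sg _ * (_ * op_tau)]mul_nat [in RHS]mul_nat [LHS]mul_nat.
    case: (eqVneq k j) => [->|_]; last by rewrite !mul0r.
    by rewrite [p j (+) _]addbC andbb.
  rewrite mul_nat [in RHS]mul_sg; by case: (eqVneq i l) => [->|_]; rewrite ?mul0r.
rewrite !mulrDr mulrN opprD !addrA; congr (_ - _).
by rewrite [RHS]addrAC addrK.
Qed.

Lemma E1_X i j k l : op_mul (e_ i j 1) * X k l =
  sg ((p i (+) p j) && (p k (+) p l)) * (X k l * op_mul (e_ i j 1))
  + (k == l)%:R * op_mul (e_ i j 0)
  + (k == j)%:R * (sg (p k) * op_mul (e_ i l 0))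
  - (i == l)%:R * (sg (p k (+) ((p i (+) p j) && (p k (+) p i))) * op_mul (e_ k j 0))
  - (i == l)%:R * ((k == j)%:R * (sg (p k (+) p i) * sdim)) * op_mul K'
  + (k == l)%:R * ((i == j)%:R * sg (p i)) * op_mul K'.
Proof.
(* The central term of the bracket carries n - m, the opposite of the superdimension. *)
have sK : sdim * op_mul K' = - op_mul ((n%:R - m%:R) *: K').
  by rewrite sdimE mulr_algl -op_mulZ -opprB scaleNr op_mulN.
rewrite X_e !TopE mulrDr mul_nat mul_sg e_tau scale1r subrr -op_mulM e_br subrr mul1r scale1r.
rewrite !op_mulD op_mulN !op_mul_nat !op_mul_sg op_mulM !mulrDr mulrN !addrA.
rewrite [LHS](ACl (1*3*2*4*5*6*7))%AC /=; congr (_ + _ + _ - _ + _ + _).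
- by rewrite mul_nat.
- rewrite mul_nat sgA; case: (eqVneq i l) => [->|_]; last by rewrite !mul0r.
  by case: (p k); case: (p j); case: (p l).
- rewrite -!mulrA sK !mulrN opprK [LHS]mul_nat [sg (p k) * (_%:R * _)]mul_nat sgA.
  by rewrite [LHS]mul_nat.
rewrite -!mulrA [LHS]mul_nat [sg (p k) * (_%:R * _)]mul_nat sgA [LHS]mul_nat.
by rewrite [p i (+) _]addbC addKb.
Qed.

Lemma K_X k l : op_mul K' * X k l = X k l * op_mul K'.
Proof.
rewrite !TopE mulrDr mulrDl mul_nat mul_sg -!mulrA -!op_mulM K'C op_tau_mul der_K op_mul0.
by rewrite addr0.
Qed.

Lemma L1_X k l : op_L1 * X k l =
  X k l * op_L1 + sg (p k) * op_mul (e_ k l 0) + (k == l)%:R * (op_L0 *+ 2).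
Proof.
rewrite !TopE mulrDr mulrDl mul_nat mul_sg -!mulrA op_L1_tau op_L1_mul der_e.
by rewrite mulrN1z opprK scale1r !mulrDr addrAC !addrA addrAC.
Qed.

Lemma L0_X k l : op_L0 * X k l = X k l * op_L0 + X k l.
Proof.
rewrite !TopE mulrDr mulrDl mul_nat mul_sg -!mulrA op_L0_tau op_L0_mul der_e.
by rewrite mulrN1z opprK scale1r !mulrDr addrACA.
Qed.

Lemma e_vac i j r : 0 <= r -> op_mul (e_ i j r) *: vac = 0.
Proof.
move=> r0; apply/vacP => -[|k] /=; last by rewrite mulr0; apply: lideal0.
by rewrite mulr1; apply: vac_e.
Qed.

Lemma K_vac : op_mul K' *: vac = vac.
Proof.
apply/eqP; rewrite -subr_eq0 -{2}[vac]scale1r -scalerBl; apply/eqP/vacP => j.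
rewrite lendoDE fseqDE /=.
have -> : K' * fone j + (-1 *: fone) j = fone j * (K' - 1).
  by rewrite fseqZE scaleN1r mulrBr mulr1 K'C.
by apply: lideal_mul; apply: vac_K.
Qed.

Let der_fone s j : der s (fone j) = 0.
Proof. by rewrite /fone; case: (j == 0); rewrite ?der0 // -[1%:R]scale1r derC. Qed.

Lemma L0_vac : op_L0 *: vac = 0.
Proof.
apply/vacP => j /=; rewrite der_fone add0r /fone.
by case: j => [|j]; rewrite ?mulr0n ?mul0rn; apply: lideal0.
Qed.

Lemma L1_vac : op_L1 *: vac = 0.
Proof.
by apply/vacP => j /=; rewrite der_fone add0r /fone mul0rn; apply: lideal0.
Qed.

Lemma Usug_kill k y i j r : tpoly (@Usug F m n) k y -> 0 <= r ->
  op_mul (e_ i j r) *: (rho y *: vac) = 0.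
Proof.
move=> Hy r0; rewrite scalerA; apply/vacP => l; rewrite lendoME /=.
have [_] := tpoly_coef (Usug_dsubalg F m n) l Hy; apply; exact: vac_e.
Qed.

Lemma kill_Usug k y : tpoly (@Uneg F m n) k y ->
  (forall i j r, 0 <= r -> op_mul (e_ i j r) *: (rho y *: vac) = 0) ->
  tpoly (@Usug F m n) k y.
Proof.
move=> Ny H; apply: tpoly_Usug => // i j r l r0.
by have := H i j r r0; rewrite scalerA => /vacP /(_ l); rewrite lendoME.
Qed.

Let NP := Uneg_dsubalg F m n.

Lemma tpoly_T i j : tpoly (@Uneg F m n) 1 (T i j).
Proof.
rewrite mxE -natZ -sgZ; apply: tpolyD; apply: tpolyZ => //.
  rewrite -[tau]mul1r -(iota1 F m n) -[tau]expr1; apply: tpoly_term => //.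
  by rewrite -[1]scale1r; apply: dsub_sc.
rewrite -[iota _]mulr1 -(expr0 tau); apply: tpoly_term => //.
by apply: subalg_gen; exists i, j, (-1).
Qed.

Lemma tpoly_TX s i j : tpoly (@Uneg F m n) s ((T ^+ s) i j).
Proof.
elim: s i j => [|s IH] i j.
  by rewrite expr0 mxE -[_%:R]mulr1 -natZ; apply: tpoly_sc.
rewrite exprS mxE; apply: tpoly_sum => a _.
by apply: (tpolyM NP (k := 1)); [apply: tpoly_T | apply: IH].
Qed.

Lemma tpoly_pstr s : tpoly (@Uneg F m n) s (pstr p T s).
Proof.
by apply: tpoly_sum => x _; rewrite -sgZ; apply: tpolyZ => //; apply: tpoly_TX.
Qed.

Let reg2 (x : E) : x *+ 2 = 0 -> x = 0.
Proof. exact: (lmod_reg F0). Qed.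

Let L1_pstr s : op_L1 *: (rho (pstr p T s) *: vac) = \sum_(a < s)
  (sdim *: (rho (pstr p T s.-1) *: vac) + (rho (pstr p T s.-1) *: vac) *+ (2 * (s.-1 - a))
   - rho (pstr p T a) *: (rho (pstr p T (s.-1 - a)) *: vac)).
Proof.
rewrite !rho_pstr (L1_pT E0_X L1_X L0_X (fun i j => e_vac i j (lexx 0)) L0_vac L1_vac).
by apply: eq_bigr => a _; rewrite !rho_pstr.
Qed.

Lemma pstr_Usug s : tpoly (@Usug F m n) s (pstr p T s).
Proof.
elim/ltn_ind: s => s IH; apply: kill_Usug; first exact: tpoly_pstr.
have e0v i j := e_vac i j (lexx 0); have e1v i j := e_vac i j ler01.
have kill i j r a : (a < s)%N -> 0 <= r ->
    op_mul (e_ i j r) *: (rho (pstr p T a) *: vac) = 0.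
  by move=> /IH/Usug_kill H /H.
move=> i j [[|r]|//] _; first by rewrite rho_pstr; apply: (E0_pT E0_X e0v).
elim: r => [|r IHr].
  rewrite rho_pstr; exact: (E1_pT reg2 (@Top_manin F m n) E0_X E1_X K_X e0v e1v K_vac).
set e1 := op_mul (e_ i j r.+1) in IHr.
(* From [L_1, e_ij[r+1]] = - (r+1) e_ij[r+2]; here [e1] is e_ij[r+1]. *)
have -> : op_mul (e_ i j r.+2) = (r.+1%:R^-1)%:A * (e1 * op_L1 - op_L1 * e1).
  rewrite op_L1_mul der_e op_mulZ opprD addrA subrr add0r scaleNr opprK mulr_algl scalerA.
  by rewrite mulVf // scale1r -[in RHS]PoszD addn1.
(* The term with [e1] acting first vanishes by induction on [r]. In the other one, L_1 p_s is a
   combination of p_(s-1) and of products p_a p_b with a, b < s, which [e1] kills by induction on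
   [s]. *)
rewrite -scalerA scalerBl -[(op_L1 * _) *: _]scalerA IHr scaler0 subr0 -scalerA L1_pstr.
rewrite scaler_sumr big1 ?scaler0 // => -[a /= a_s] _.
have s1 : (s.-1 < s)%N by case: (s) a_s.
have r1 : 0 <= r.+1%:Z by [].
have sb : (s.-1 - a < s)%N by apply: leq_ltn_trans s1; apply: leq_subr.
rewrite scalerBr scalerDr -scalerMnr kill // mul0rn addr0.
rewrite [e1 *: (sdim *: _)]scalerA sdimE mulr_algr -mulr_algl -scalerA kill // scaler0 add0r.
rewrite [rho _ *: (rho _ *: _)]scalerA -rhoM.
by rewrite (Usug_kill _ _ (tpolyM (Usug_dsubalg F m n) (IH _ a_s) (IH _ sb))) // oppr0.
Qed.

Lemma zsum0 c : zsum p T c 0 = 1.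
Proof.
rewrite /zsum (eq_bigr (fun _ => 1)) => [|I _].
  by rewrite sumr_const card_ffun !card_ord expn0.
rewrite (eq_bigr (fun _ => 1)) => [|s _]; first by rewrite sumr_const card_Sn.
rewrite big_ord0 mulr1 /permsgn /bzsign !big_ord0 /= !addbF.
have -> : s = 1%g by apply/permP => -[].
by rewrite odd_perm1 andbF.
Qed.

Lemma zsum_Usug c k : tpoly (@Usug F m n) k (zsum p T c k).
Proof.
have UP := Usug_dsubalg F m n.
elim/ltn_ind: k => -[|k] IH.
  by rewrite zsum0 -[1]scale1r; apply: tpoly_sc.
have kj (j : 'I_k.+1) : (k - j < k.+1)%N by rewrite ltnS leq_subr.
have dj (j : 'I_k.+1) : (j.+1 + (k - j) = k.+1)%N by rewrite addSn subnKC // -ltnS.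
case: c IH => IH.
  rewrite (zsum_newtonA (@Tmat_manin F m n)); apply: tpoly_sum => j _.
  rewrite -scaler_nat; apply: tpolyZ => //; rewrite -[X in tpoly _ X](dj j) addnC.
  apply: tpolyM => //; first exact: IH.
  by rewrite -sgZ; apply: tpolyZ => //; apply: pstr_Usug.
rewrite (zsum_newtonH (@Tmat_manin F m n)); apply: tpoly_sum => j _.
rewrite -scaler_nat; apply: tpolyZ => //; rewrite -[X in tpoly _ X](dj j).
by apply: tpolyM => //; [apply: pstr_Usug | apply: IH].
Qed.

(** Both series start with 1 and solve theta f = f dlog T: the Berezinian by [theta_Ber], the other
    by the Newton identity. *)
Lemma Ber_zsum k : fcoef (Ber_uT T) k = (k`!%:R)^-1 *: zsum p T true k.
Proof.
have reg k' (x : U') : x *+ k'.+1 = 0 -> x = 0 by apply: lmod_reg.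
have [Ber0 thB] := theta_Ber reg (@Tmat_manin F m n).
pose f : fps U' := FPS (fun k => (k`!%:R)^-1 *: zsum p T true k).
suff : Ber_uT T = f by move=> ->.
apply: (theta_dlog_unique reg (T := T)) => //.
  by rewrite Ber0 /= zsum0 invr1 scale1r.
have dlog0 : fcoef (dlog T) 0 = 0.
  rewrite fcoef_sum big1 // => a _.
  by rewrite fcoef_sign fcoefD fcoefN fcoef1 inv_one_uT0 !eqxx subrr mulr0.
have dlogS j : fcoef (dlog T) j.+1 = sg (odd j) * pstr p T j.+1.
  rewrite fcoef_sum mulr_sumr; apply: eq_bigr => a _.
  rewrite fcoef_sign fcoefD fcoefN fcoef1 add0r mxE /=.
  rewrite [(- T) ^+ _]exprNn -[(-1) ^+ j.+1]signr_odd /=.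
  case: (odd j); rewrite /= ?mul1r ?mulN1r ?mulrN //.
  by rewrite mxE mulrN opprK.
apply: fpsP => -[|k']; first by rewrite fcoefM big_ord1 dlog0 mulr0.
rewrite fcoefM big_ord_recr /= subnn dlog0 mulr0 addr0.
rewrite (zsum_newtonA (@Tmat_manin F m n)) scaler_sumr -sumrMnl (reindex_inj rev_ord_inj) /=.
apply: eq_bigr => j _; rewrite subSS.
have jk : (j <= k')%N by rewrite -ltnS.
rewrite subKn // subSn // dlogS -scalerAl.
rewrite -!scaler_nat !scalerA; congr (_ *: _).
(* What is left is the identity (k'+1) / (k'+1)! times k'! / j! equals 1 / j!, where k'! / j! is the
   falling factorial. *)
have nz l : (0 < l)%N -> l%:R != 0 :> F by case: l.
rewrite factS natrM invfM mulrA mulfV // mul1r.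
have := ffact_fact (leq_subr j k'); rewrite subKn // => <-.
by rewrite natrM invfM mulrAC mulVf ?mul1r // nz // ffact_gt0 leq_subr.
Qed.

End SegalSugawara.

Section Expansion.
Variables (F : fieldType) (m n k : nat) (x : Uenv (afft F m n)).
Hypothesis Ux : tpoly (@Usug F m n) k x.

Let UP := Usug_dsubalg F m n.

Lemma Usug_expansion : exists! c : {ffun 'I_k.+1 -> Uenv (aff F m n)}, tau_expansion x c.
Proof.
pose c : {ffun 'I_k.+1 -> Uenv (aff F m n)} :=
  [ffun l : 'I_k.+1 => (rho x (@fone F m n) : fseq (Uenv (aff F m n))) (k - l)%N].
have xc : tau_expansion x c.
  split=> [l|]; first by rewrite ffunE; have [] := tpoly_coef UP (k - l) Ux.
  by rewrite [LHS](tpoly_expansion Ux); apply: eq_bigr => l _; rewrite ffunE.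
by exists c; split=> // d; apply: tau_expansion_uniq.
Qed.

Lemma Usug_segal_sugawara (c : {ffun 'I_k.+1 -> Uenv (aff F m n)}) l :
  tau_expansion x c -> segal_sugawara (to_vac (c l)).
Proof.
case=> _ xc i j r r0; rewrite [_ *: _]lquot_scaleE; apply/lquot_eq0.
have [_] := tpoly_coef UP (k - l) Ux.
by rewrite {1}xc rho_expansion; apply; apply: vac_e.
Qed.

End Expansion.

Theorem corollary3p3 (R : realType) (m n : nat) (mn_gt0 : (0 < m + n)%N) :
  let T := Tmat R[i] m n in
  (forall k : nat,
    [/\ exists! s, tau_expansion (k := k) (str (tens_mul (Asym k) (Tprod T k))) s,
        exists! h, tau_expansion (k := k) (str (tens_mul (Hsym k) (Tprod T k))) h
      & exists! b, tau_expansion (k := k) (fcoef (Ber_uT T) k) b]) /\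
  (forall (k : nat) (s h b : {ffun 'I_k.+1 -> Uenv (aff R[i] m n)}),
    tau_expansion (str (tens_mul (Asym k) (Tprod T k))) s ->
    tau_expansion (str (tens_mul (Hsym k) (Tprod T k))) h ->
    tau_expansion (fcoef (Ber_uT T) k) b ->
    forall l : 'I_k.+1,
      [/\ segal_sugawara (to_vac (s l)),
          segal_sugawara (to_vac (h l)),
          segal_sugawara (to_vac (b l))
        & b l = s l]).
Proof.
move=> T.
have F0 k : k.+1%:R != 0 :> R[i] by rewrite pnatr_eq0.
have UA k : tpoly (@Usug R[i] m n) k (str (tens_mul (Asym k) (Tprod T k))).
  rewrite (str_Asym (@Tmat_par R[i] m n)); apply: tpolyZ; first exact: Usug_dsubalg.
  exact: zsum_Usug.
have UH k : tpoly (@Usug R[i] m n) k (str (tens_mul (Hsym k) (Tprod T k))).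
  rewrite (str_Hsym (@Tmat_par R[i] m n)); apply: tpolyZ; first exact: Usug_dsubalg.
  exact: zsum_Usug.
have BA k : fcoef (Ber_uT T) k = str (tens_mul (Asym k) (Tprod T k)).
  by rewrite (str_Asym (@Tmat_par R[i] m n)); apply: Ber_zsum.
split=> [k|k s h b xs xh]; rewrite BA; first by split; apply: Usug_expansion.
move=> xb l; split; [exact: Usug_segal_sugawara xs | exact: Usug_segal_sugawara xh | |].
  exact: Usug_segal_sugawara xb.
by rewrite (tau_expansion_uniq xb xs).
Qed.
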